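(* Let $\mathcal{E}$ be an elliptic curve over $\mathbb{C}$, let $S=\mathbb{P}^1\times\mathcal{E}$, and let $\mathscr{A}$ be an ample line bundle on $\mathcal{E}$ such that $L=\mathcal{O}_{\mathbb{P}^1}(2)\boxtimes\mathscr{A}^{\otimes2}$ is very ample. Let $S\subseteq\mathbb{P}^n$ be the embedding given by $L$ and let $C\subseteq\mathbb{P}^{n+1}$ be the projective cone over $S$. Then the singularity of $C$ at its vertex is canonical but not klt.
   Context: Varieties are over $\mathbb{C}$; $C$ is a normal variety, not assumed $\mathbb{Q}$-Gorenstein. The embedding is by the complete linear system $|L|$. For a Weil divisor $D$ on a normal variety $X$, $\mathcal{O}_X(D)$ is the sheaf of rational functions $\phi$ with $\mathrm{div}(\phi)+D\ge0$. For a divisorial valuation $v=\mathrm{val}_F$ ($F$ a prime divisor over $X$, i.e. on some normal variety $Y$ with a projective birational morphism to $X$) with center $c_X(v)$, and a fractional ideal sheaf $\mathcal{I}$, $v(\mathcal{I})=\min\{v(\phi)\mid\phi\in\mathcal{I}(U),\ U\cap c_X(v)\ne\emptyset\}$. For an integral Weil divisor $D$, $v^{\natural}(D)=v(\mathcal{O}_X(-D))$; for a $\mathbb{Q}$-divisor $D$, $v(D)=\lim_{k\to\infty}\frac{v^{\natural}(k!D)}{k!}=\inf_{k\ge1}\frac{v^{\natural}(kD)}{k}$. For $f:Y\to X$ projective birational with $Y$ normal: $f^{\natural}D=\sum_E\mathrm{val}_E(\mathcal{O}_X(-D))\cdot E$ and $f^*D=\sum_E\mathrm{val}_E(D)\cdot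 E$ (sums over prime divisors $E$ on $Y$). Canonical divisors are chosen with $K_X=f_*K_Y$. Set $K_{m,Y/X}=K_Y-\frac1mf^{\natural}(mK_X)$ for $m\ge1$ and $K_{Y/X}=K_Y+f^*(-K_X)$. $X$ is canonical (has canonical singularities) if $\mathrm{ord}_F(K_{Y/X})+1\ge1$ for every exceptional prime divisor $F$ over $X$ (with $F$ a divisor on $Y$). $X$ is klt (equivalently, log terminal) if there is an integer $m_0\ge1$ such that $\mathrm{ord}_F(K_{m_0,Y/X})+1>0$ for every prime divisor $F$ over $X$. $C$ is smooth away from its vertex. *)

(* Defs.v *)
From mathcomp Require Import all_boot all_order all_algebra.
From mathcomp Require Import boolp classical_sets reals complex.

Set Implicit Arguments.
Unset Strict Implicit.
Unset Printing Implicit Defensive.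

Import Order.TTheory GRing.Theory Num.Theory.
Local Open Scope ring_scope.
Local Open Scope classical_set_scope.

(* Integral projective varieties over the complex numbers R[i] are handled as
   Zariski models: an integral separated scheme of finite type is determined by
   the set of its local rings, as subrings of its function field.  Everything
   lives in one field K, with structure map iota : R[i] -> K.  A variety is
   therefore a term X : set (set K): the elements O of X are its scheme-theoretic
   points, each point being identified with its local ring.  In these terms

   - a point O' is a specialization of O iff O' `<=` O, and the generic point is
     the function field of X, which is the union of the local rings;
   - if X and Y have the same function field, the identity of that field is
     induced by a morphism Y -> X iff every point of Y dominates a point of X,
     which is then its image (see center).  Up to isomorphism, this describes
     every birational morphism between projective varieties.

   The function field of X may be smaller than K: this lets a curve, a surface
   ruled over it and a cone over the surface coexist in the function field of
   the cone. *)

Section Varieties.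

Variables (R : realType) (K : fieldType) (iota : {rmorphism R[i] -> K}).

Definition subalgebra (A : set K) : Prop :=
  [/\ forall a, A (iota a),
      forall x y, A x -> A y -> A (x - y)
    & forall x y, A x -> A y -> A (x * y)].

Definition alg_gen (G : set K) : set K := smallest subalgebra G.

Definition prime_ideal (A P : set K) : Prop :=
  [/\ P `<=` A /\ P 0,
      forall x y, P x -> P y -> P (x + y),
      forall a x, A a -> P x -> P (a * x),
      ~ P 1
    & forall a b, A a -> A b -> P (a * b) -> P a \/ P b].

Definition localization (A P : set K) : set K :=
  [set z | exists a b, [/\ A a, A b, ~ P b & z = a / b]].

Definition is_unit (O : set K) (z : K) : Prop := [/\ z != 0, O z & O z^-1].

Definition max_ideal (O : set K) : set K := [set z | O z /\ ~ is_unit O z].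

Definition dominates (O' O : set K) : Prop :=
  O `<=` O' /\ max_ideal O `<=` max_ideal O'.

Definition transcendental_over (F : set K) (x : K) : Prop :=
  forall p : {poly K}, (forall i, F p`_i) -> root p x -> p = 0.

(* Spec A *)
Definition affine_model (A : set K) : set (set K) :=
  [set O | exists2 P, prime_ideal A P & O = localization A P].

(* The closed subvariety of projective space whose generic point has the
   homogeneous coordinates y; the charts are Spec R[i][y_j / y_i]. *)
Definition proj_model (y : seq K) : set (set K) :=
  [set O | exists yi, [/\ yi \in y, yi != 0
    & affine_model (alg_gen [set z / yi | z in [set` y]]) O]].

Definition projective_variety (X : set (set K)) : Prop :=
  exists2 y : seq K, has (fun z => z != 0) y & X = proj_model y.

Definition function_field (X : set (set K)) : set K := \bigcup_(O in X) O.

(* Zariski topology: the loci where finitely many rational functions are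
   regular form a basis of open sets. *)
Definition open_in (X U : set (set K)) : Prop :=
  U `<=` X /\ forall O, U O ->
    exists f : seq K, (forall z, z \in f -> O z) /\
      forall O', X O' -> (forall z, z \in f -> O' z) -> U O'.

Definition normal (X : set (set K)) : Prop :=
  forall O, X O -> forall z, function_field X z ->
  forall p : {poly K}, p \is monic -> (forall i, O p`_i) -> root p z -> O z.

Definition chain (X : set (set K)) (d : nat) : Prop :=
  exists c : nat -> set K,
    (forall i, (i <= d)%N -> X (c i)) /\
    (forall i, (i < d)%N -> c i.+1 `<=` c i /\ c i.+1 <> c i).

Definition dimension (X : set (set K)) (d : nat) : Prop :=
  chain X d /\ forall e, chain X e -> (e <= d)%N.

(* Generic points of the closed irreducible subsets of codimension one. *)
Definition prime_divisor (X : set (set K)) (O : set K) : Prop :=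
  [/\ X O, O <> function_field X
    & forall O', X O' -> O `<=` O' -> O' = O \/ O' = function_field X].

(* The point of X dominated by O (unique when there is one).  It is the center
   on X of a valuation ring O, and the image of O when O is a point of a variety
   mapping to X. *)
Definition center (X : set (set K)) (O : set K) : set K :=
  xget setT [set O0 | X O0 /\ dominates O O0].

(* Product of two varieties whose function fields are linearly disjoint over
   R[i]: the ring generated by O1 and O2 is then their tensor product, and the
   points over (O1, O2) are its primes containing both maximal ideals. *)
Definition product (X1 X2 : set (set K)) : set (set K) :=
  [set O | exists O1 O2 P, [/\ X1 O1, X2 O2,
     prime_ideal (alg_gen (O1 `|` O2)) P,
     max_ideal O1 `|` max_ideal O2 `<=` P
   & O = localization (alg_gen (O1 `|` O2)) P]].

(* A line bundle is given as an invertible subsheaf of the constant sheaf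
   function_field X: L O generates its stalk at O, and a generator at O is
   still a generator in a neighbourhood of O.  Only the values of L at points
   of X, up to units, are meaningful. *)
Definition line_bundle (X : set (set K)) (L : set K -> K) : Prop :=
  forall O, X O -> [/\ L O != 0, function_field X (L O)
    & exists U, [/\ open_in X U, U O
        & forall O', U O' -> is_unit O' (L O / L O')]].

Definition tensor_power (L : set K -> K) (m : nat) : set K -> K :=
  fun O => L O ^+ m.

(* External tensor product of L1 and L2, on product X1 X2. *)
Definition box_tensor (X1 X2 : set (set K)) (L1 L2 : set K -> K) : set K -> K :=
  fun O => L1 (center X1 O) * L2 (center X2 O).

(* O(1) on proj_model y, as the subsheaf generated by the coordinates y. *)
Definition twisting_sheaf (y : seq K) : set K -> K :=
  fun O => xget 0
    [set g | [/\ g \in y, g != 0 & forall z, z \in y -> O (z / g)]].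

Definition global_sections (X : set (set K)) (L : set K -> K) : set K :=
  [set phi | function_field X phi /\ forall O, X O -> O (phi / L O)].

Definition sections_basis (X : set (set K)) (L : set K -> K)
    (n : nat) (s : n.-tuple K) : Prop :=
  (forall phi, global_sections X L phi <->
     exists c : 'I_n -> R[i], phi = \sum_(i < n) iota (c i) * s`_i) /\
  (forall c : 'I_n -> R[i],
     \sum_(i < n) iota (c i) * s`_i = 0 -> forall i, c i = 0).

(* The basis s of H^0(X, L) generates L, and the morphism to P^n that it defines
   is an isomorphism of X onto its image (whose generic point is s), that is, a
   closed immersion. *)
Definition complete_embedding (X : set (set K)) (L : set K -> K)
    (n : nat) (s : n.+1.-tuple K) : Prop :=
  [/\ sections_basis X L s,
      forall O, X O -> exists2 z, z \in s & is_unit O (z / L O)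
    & proj_model s = X].

Definition very_ample (X : set (set K)) (L : set K -> K) : Prop :=
  exists (n : nat) (s : n.+1.-tuple K), complete_embedding X L s.

Definition ample (X : set (set K)) (L : set K -> K) : Prop :=
  exists2 m : nat, (0 < m)%N & very_ample X (tensor_power L m).

Definition projective_line (t : K) : set (set K) := proj_model [:: 1; t].

(* Weierstrass form y^2 = x^3 + a x + b with nonzero discriminant; (1 : x : y)
   is the generic point of the plane cubic. *)
Definition elliptic_curve (E : set (set K)) : Prop :=
  exists (a b : R[i]) (x y : K),
    [/\ 4 * a ^+ 3 + 27 * b ^+ 2 != 0,
        transcendental_over (range iota) x,
        y ^+ 2 = x ^+ 3 + iota a * x + iota b
      & E = proj_model [:: 1; x; y]].

(* Projective cone over proj_model s; w is meant to be transcendental over the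
   function field of proj_model s, to which the coordinates s belong. *)
Definition projective_cone (s : seq K) (w : K) : set (set K) :=
  proj_model (rcons s w).

(* Local ring at (0 : ... : 0 : 1). *)
Definition cone_vertex (s : seq K) (w : K) : set K :=
  let A := alg_gen [set z / w | z in [set` s]] in
  localization A [set z | exists2 c : nat -> K, forall i, A (c i)
                        & z = \sum_(i < size s) c i * (s`_i / w)].

(* Minimum of a set of integers; 0 when there is none. *)
Definition imin (A : set int) : int :=
  xget 0 [set n | A n /\ forall m, A m -> n <= m].

(* Valuation of a discrete valuation ring O; meaningful on nonzero elements of
   its fraction field. *)
Definition ord (O : set K) (z : K) : int :=
  xget 0 [set n : int | exists pi u,
    [/\ pi != 0, max_ideal O = [set pi * a | a in O], is_unit O u
      & z = u * pi ^ n]].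

(* From here on the varieties of interest have K as function field. *)

Definition derivation (D : K -> K) : Prop :=
  [/\ forall a, D (iota a) = 0,
      forall x y, D (x + y) = D x + D y
    & forall x y, D (x * y) = x * D y + y * D x].

(* The rational form w.1 dx_1 /\ ... /\ dx_d, with x = w.2, is seen as an
   alternating map on tuples of derivations of K over R[i]. *)
Definition form (d : nat) := (K * ('I_d -> K))%type.

Definition form_eval d (w : form d) (D : 'I_d -> K -> K) : K :=
  w.1 * \det (\matrix_(i, j) D i (w.2 j)).

Definition form_nonzero d (w : form d) : Prop :=
  exists2 D : 'I_d -> K -> K, forall i, derivation (D i) & form_eval w D != 0.

(* Coefficient of div w along the prime divisor with valuation ring O, for d the
   transcendence degree of K.  The module of differentials of O over R[i] is free
   of rank d and its dual consists of the derivations of K that preserve O, so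
   that w is pi ^ n times a generator of its top exterior power iff n is the
   minimal value of w on tuples of such derivations. *)
Definition ord_form d (w : form d) (O : set K) : int :=
  imin [set n | exists D : 'I_d -> K -> K,
    [/\ forall i, derivation (D i) /\ (forall z, O z -> O (D i z)),
        form_eval w D != 0 & n = ord O (form_eval w D)]].

(* Weil divisors D : set K -> int are given by their coefficients at the prime
   divisors of X; this is the sheaf O_X(D). *)
Definition divisorial_sheaf (X : set (set K)) (D : set K -> int)
    (U : set (set K)) : set K :=
  [set phi | function_field X phi /\ (phi <> 0 ->
    forall O, U O -> prime_divisor X O -> 0 <= ord O phi + D O)].

(* v(I), for the valuation v with valuation ring F. *)
Definition val_sheaf (X : set (set K)) (F : set K)
    (I : set (set K) -> set K) : int :=
  imin [set n | exists U phi,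
    [/\ open_in X U, exists2 O, U O & O `<=` center X F,
        I U phi, phi != 0 & n = ord F phi]].

(* v^natural(D) *)
Definition val_nat (X : set (set K)) (F : set K) (D : set K -> int) : int :=
  val_sheaf X F (divisorial_sheaf X (fun O => - D O)).

(* v(D) *)
Definition val_div (X : set (set K)) (F : set K) (D : set K -> int) : R :=
  inf [set (val_nat X F (fun O => D O *+ k))%:~R / k%:R
      | k in [set k : nat | (0 < k)%N]].

(* Normal projective varieties Y with a birational morphism to X. *)
Definition normal_modification (Y X : set (set K)) : Prop :=
  [/\ projective_variety Y, normal Y, function_field Y = function_field X
    & forall O', Y O' -> exists2 O, X O & dominates O' O].

Definition divisor_over (X : set (set K)) (F : set K) : Prop :=
  exists2 Y, normal_modification Y X & prime_divisor Y F.

Definition exceptional (X : set (set K)) (F : set K) : Prop :=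
  ~ prime_divisor X (center X F).

(* The same rational form w defines K_Y and K_X, so that K_X = f_* K_Y. *)

(* ord_F(K_{m,Y/X}), where K_{m,Y/X} = K_Y - (1/m) f^natural(m K_X) *)
Definition ord_K_rel_m (X : set (set K)) d (w : form d) (m : nat) (F : set K) : R :=
  (ord_form w F)%:~R
  - (val_nat X F (fun O => ord_form w O *+ m))%:~R / m%:R.

(* ord_F(K_{Y/X}), where K_{Y/X} = K_Y + f^*(- K_X) *)
Definition ord_K_rel (X : set (set K)) d (w : form d) (F : set K) : R :=
  (ord_form w F)%:~R + val_div X F (fun O => - ord_form w O).

(* An open subvariety U of X is canonical, resp. klt.  By compactifying over X
   and normalizing, the prime divisors over U are the prime divisors over X whose
   center is (the closure of) a point of U. *)
Definition canonical_on (X U : set (set K)) : Prop :=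
  forall d (w : form d), dimension X d -> form_nonzero w ->
  forall F, divisor_over X F -> U (center X F) -> exceptional X F ->
    1 <= ord_K_rel X w F + 1.

Definition klt_on (X U : set (set K)) : Prop :=
  exists2 m0 : nat, (0 < m0)%N &
  forall d (w : form d), dimension X d -> form_nonzero w ->
  forall F, divisor_over X F -> U (center X F) ->
    0 < ord_K_rel_m X w m0 F + 1.

(* The singularity of X at the point p. *)
Definition canonical_at (X : set (set K)) (p : set K) : Prop :=
  exists U, [/\ open_in X U, U p & canonical_on X U].

Definition klt_at (X : set (set K)) (p : set K) : Prop :=
  exists U, [/\ open_in X U, U p & klt_on X U].

End Varieties.

(* Main.v *)
(** Blow up the vertex of the cone: the result is the total space of the dual of L
    over S = P^1 x E, with the zero section as exceptional divisor, and it is smooth.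
    Writing u for the fibre coordinate, a section of the k-th power of the canonical
    sheaf near the vertex has a leading coefficient at u ^ j (du / u) ^ k that is a
    section of k K_S + j L, of degree 2j - 2k along P^1.  For k > 0 this forces
    j >= k, so pluricanonical forms stay regular on the smooth blowup, and hence on
    every divisor over the cone: the vertex is canonical.  For k = - m < 0 the degree
    2 j deg A along E only forces j >= 0, so that the zero section has discrepancy at
    most -1 with respect to every K_m, and the vertex is not klt.

    Regularity in codimension one is turned into regularity at a point by the fact
    that a Noetherian normal domain is an intersection of discrete valuation rings. *)

(* Degrees never appear as numbers. On P^1 they are tested over the generic point of E, by comparing
   a polynomial in [t] with one in [t^-1]. On E they enter through a single fact: regular functions
   are constants, so that a nonzero section of a negative power of [A], multiplied by sections of a
   positive power, would make the function field of E constant. The invariant differential dx/2y has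
   neither zeros nor poles, so K_S is the O(-2) of P^1 alone and is not proportional to L: positive
   multiples of K are constrained by P^1 and negative ones by E, which is what separates the two
   conclusions. The obstacle is that canonicity quantifies over all divisors F over the cone, where
   the order of a form is known only through derivations preserving a valuation ring. Inequalities
   between orders are therefore turned into memberships phi (H g^2 / u)^k in a ring, with H the
   coefficient of the form and g the homogeneous coordinate of the chart of P^1. A membership proved
   in a localization of a smooth chart passes to every valuation ring containing it. *)
Require Import Defs.
From mathcomp Require Import all_boot all_order all_algebra.
From mathcomp Require Import boolp classical_sets reals complex.
From mathcomp Require Import ring zify.

Set Implicit Arguments.
Unset Strict Implicit.
Unset Printing Implicit Defensive.

Import Order.TTheory GRing.Theory Num.Theory.
Local Open Scope ring_scope.
Local Open Scope classical_set_scope.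

(** * Subrings, local rings and projective models *)

Section LocalRings.
Variables (R : realType) (K : fieldType) (iota : {rmorphism R[i] -> K}).
Local Notation subalg := (subalgebra iota).
Implicit Types (A B O V F I P M G : set K) (x y z a b u : K).

Lemma sa_iota A c : subalg A -> A (iota c).
Proof. by case. Qed.
Arguments sa_iota : clear implicits.
Lemma saB A x y : subalg A -> A x -> A y -> A (x - y).
Proof. by case=> _ h _; apply: h. Qed.
Lemma saM A x y : subalg A -> A x -> A y -> A (x * y).
Proof. by case=> _ _; apply. Qed.
Lemma sa0 A : subalg A -> A 0.
Proof. by move=> h; have := sa_iota A 0 h; rewrite rmorph0. Qed.
Lemma sa1 A : subalg A -> A 1.
Proof. by move=> h; have := sa_iota A 1 h; rewrite rmorph1. Qed.
Lemma saN A x : subalg A -> A x -> A (- x).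
Proof. by move=> sA Ax; rewrite -sub0r; apply: saB => //; apply: sa0. Qed.
Lemma saD A x y : subalg A -> A x -> A y -> A (x + y).
Proof. by move=> sA Ax Ay; rewrite -[y]opprK; apply: saB => //; apply: saN. Qed.
Lemma saX A x n : subalg A -> A x -> A (x ^+ n).
Proof.
by move=> sA Ax; elim: n => [|n IH]; [apply: sa1 | rewrite exprS; apply: saM].
Qed.
Lemma sa_sum A (J : Type) (r : seq J) (Q : pred J) (f : J -> K) :
  subalg A -> (forall j, Q j -> A (f j)) -> A (\sum_(j <- r | Q j) f j).
Proof. by move=> sA Af; apply: (big_ind A) => //; [apply: sa0 | move=> *; apply: saD]. Qed.
Lemma sa_prod A (J : Type) (r : seq J) (Q : pred J) (f : J -> K) :
  subalg A -> (forall j, Q j -> A (f j)) -> A (\prod_(j <- r | Q j) f j).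
Proof. by move=> sA Af; apply: (big_ind A) => //; [apply: sa1 | move=> *; apply: saM]. Qed.
Lemma sa_nat A n : subalg A -> A n%:R.
Proof. by move=> sA; elim: n => [|n IH]; [apply: sa0 | rewrite mulrS; apply: saD => //; apply: sa1]. Qed.
Lemma saMn A x n : subalg A -> A x -> A (x *+ n).
Proof. by move=> sA Ax; rewrite -mulr_natr; apply: saM => //; apply: sa_nat. Qed.

Lemma setT_sa : subalg setT.
Proof. by []. Qed.

Lemma range_sa : subalg (range iota).
Proof.
split=> [a|_ _ [a _ <-] [b _ <-]|_ _ [a _ <-] [b _ <-]]; first by exists a.
  by exists (a - b); rewrite // rmorphB.
by exists (a * b); rewrite // rmorphM.
Qed.

Lemma alg_gen_sub G : G `<=` alg_gen iota G.
Proof. exact: sub_gen_smallest. Qed.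
Lemma alg_gen_min G A : subalg A -> G `<=` A -> alg_gen iota G `<=` A.
Proof. by move=> sA GA; apply: smallest_sub. Qed.
Lemma alg_gen_sa G : subalg (alg_gen iota G).
Proof.
split=> [a|x y Gx Gy|x y Gx Gy] A [sA GA]; first exact: sa_iota.
  by apply: saB; [|apply: Gx|apply: Gy].
by apply: saM; [|apply: Gx|apply: Gy].
Qed.

Lemma is_unit_neq0 A x : is_unit A x -> x != 0.
Proof. by case. Qed.

End LocalRings.
Arguments sa_sum {R K iota A J r Q f}.
Arguments sa_prod {R K iota A J r Q f}.

#[global] Hint Extern 0 (subalgebra _ setT) => exact: setT_sa : sadb.
#[global] Hint Extern 0 (subalgebra _ (range _)) => exact: range_sa : sadb.
#[global] Hint Extern 0 (subalgebra _ (alg_gen _ _)) => exact: alg_gen_sa : sadb.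

Ltac sasub := first [eassumption | solve [auto 4 with sadb nocore]].
(** Syntax-directed membership in a subalgebra. Inverses are never derived, so a membership of
    [z^-1] has to be in the context beforehand; this explains the recurring pattern
    [have := ...; move=> *; sa]. *)
Ltac sa := repeat first [assumption |
  lazymatch goal with
  | |- subalgebra _ _ => sasub
  | |- ?A (@Algebra.add _ ?x (@Algebra.opp _ ?y)) => eapply (@saB _ _ _ A x y); [sasub | | ]
  | |- ?A (@Algebra.add _ ?x ?y) => eapply (@saD _ _ _ A x y); [sasub | | ]
  | |- ?A (@GRing.mul _ ?x ?y) => eapply (@saM _ _ _ A x y); [sasub | | ]
  | |- ?A (@Algebra.opp _ ?x) => eapply (@saN _ _ _ A x); [sasub | ]
  | |- ?A (@GRing.exp _ ?x ?n) => eapply (@saX _ _ _ A x n); [sasub | ]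
  | |- ?A (@Algebra.zero _) => eapply (@sa0 _ _ _ A); sasub
  | |- ?A (@GRing.one _) => eapply (@sa1 _ _ _ A); sasub
  | |- ?A (@Algebra.natmul _ (@GRing.one _) ?n) => eapply (@sa_nat _ _ _ A n); sasub
  | |- ?A (@Algebra.natmul _ ?x ?n) => eapply (@saMn _ _ _ A x n); [sasub | ]
  | |- ?A (GRing.RMorphism.sort ?f ?c) => eapply (@sa_iota _ _ f A c); sasub
  | |- ?A (@Algebra.Additive.sort _ _ _ ?c) => progress simpl
  end].

Ltac fld := field; repeat (apply/andP; split); repeat first [assumption | exact: oner_neq0
  | eapply is_unit_neq0; eassumption | match goal with h : _ |- _ => apply: h; assumption end].

Section LocalRings2.
Variables (R : realType) (K : fieldType) (iota : {rmorphism R[i] -> K}).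
Local Notation subalg := (subalgebra iota).
Implicit Types (A B O V F I P M G : set K) (x y z a b u : K) (ys : seq K).

Lemma is_unit1 A : subalg A -> is_unit A 1.
Proof. by move=> sA; split; rewrite ?oner_neq0 ?invr1 //; sa. Qed.
Lemma is_unitM A x y : subalg A -> is_unit A x -> is_unit A y -> is_unit A (x * y).
Proof.
by move=> sA [x0 Ax Ax'] [y0 Ay Ay']; split; rewrite ?mulf_neq0 ?invfM //; sa.
Qed.
Lemma is_unitV A x : is_unit A x -> is_unit A x^-1.
Proof. by move=> [x0 Ax Ax']; split; rewrite ?invr_eq0 ?invrK. Qed.
Lemma is_unit_div A x y : subalg A -> is_unit A x -> is_unit A y -> is_unit A (x / y).
Proof. by move=> sA ux uy; apply: is_unitM => //; apply: is_unitV. Qed.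
Lemma is_unitX A x n : subalg A -> is_unit A x -> is_unit A (x ^+ n).
Proof.
by move=> sA ux; elim: n => [|n IH]; [apply: is_unit1 | rewrite exprS; apply: is_unitM].
Qed.
Lemma is_unit_mono A B x : A `<=` B -> is_unit A x -> is_unit B x.
Proof. by move=> AB [x0 Ax Ax']; split; [|apply: AB|apply: AB]. Qed.
Lemma is_unit_in A x : is_unit A x -> A x.
Proof. by case. Qed.
Lemma is_unit_inV A x : is_unit A x -> A x^-1.
Proof. by case. Qed.
Lemma is_unit_iota A c : subalg A -> c != 0 -> is_unit A (iota c).
Proof.
move=> sA c0; split; [by rewrite fmorph_eq0 | sa | rewrite -fmorphV; sa].
Qed.
Lemma is_unit_setT x : is_unit setT x <-> x != 0.
Proof. by split=> [[]|]. Qed.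
Lemma natr_neq0 n : n.+1%:R != 0 :> K.
Proof. by rewrite -(rmorph_nat iota) fmorph_eq0 pnatr_eq0. Qed.

Lemma mx_in O x : max_ideal O x -> O x. Proof. by case. Qed.
Lemma mx0 O : subalg O -> max_ideal O 0.
Proof. by move=> sO; split; [sa | case; rewrite eqxx]. Qed.
Lemma mxN1 O : subalg O -> ~ max_ideal O 1.
Proof. by move=> sO [_]; apply; apply: is_unit1. Qed.
Lemma mxM O a x : subalg O -> O a -> max_ideal O x -> max_ideal O (a * x).
Proof.
move=> sO Oa [Ox nux]; split; first by sa.
move=> [ax0 _ axV]; apply: nux.
have [a0 x0] : a != 0 /\ x != 0 by apply/andP; rewrite -negb_or -mulf_eq0.
by split=> //; rewrite (_ : x^-1 = a * (a * x)^-1); [sa | fld].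
Qed.
Lemma unit_or_mx O x : O x -> is_unit O x \/ max_ideal O x.
Proof. by move=> Ox; case: (pselect (is_unit O x)) => h; [left | right]. Qed.

Definition local_ring O : Prop :=
  subalg O /\ forall x y, max_ideal O x -> max_ideal O y -> max_ideal O (x + y).

Lemma local_sa O : local_ring O -> subalg O. Proof. by case. Qed.
Lemma mxD O x y : local_ring O -> max_ideal O x -> max_ideal O y -> max_ideal O (x + y).
Proof. by case=> _; apply. Qed.
Lemma mxN O x : local_ring O -> max_ideal O x -> max_ideal O (- x).
Proof. by move=> [sO _] mx; rewrite -mulN1r; apply: mxM => //; sa. Qed.
Lemma mxB O x y : local_ring O -> max_ideal O x -> max_ideal O y -> max_ideal O (x - y).
Proof. by move=> lO mx my; apply: mxD => //; apply: mxN. Qed.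
Lemma unitDmx O x y : local_ring O -> is_unit O x -> max_ideal O y -> is_unit O (x + y).
Proof.
move=> lO ux my; have sO := local_sa lO.
case: (@unit_or_mx O (x + y)) => // [|mxy]; first by case: ux my => _ ? _ [? _]; sa.
by have := mxB lO mxy my; rewrite addrK => -[].
Qed.
Lemma mx_prime O a b : local_ring O -> O a -> O b -> max_ideal O (a * b) ->
  max_ideal O a \/ max_ideal O b.
Proof.
move=> lO Oa Ob [_ nu]; case: (unit_or_mx Oa) => ua; [right | by left].
by split=> // ub; apply: nu; apply: is_unitM => //; case: lO.
Qed.
Lemma local_setT : local_ring setT.
Proof.
split=> // x y [_ nx] [_ ny].
have /negP/negPn/eqP-> : ~ x != 0 by rewrite -is_unit_setT.
by rewrite add0r; split.
Qed.
Lemma mx_setT x : max_ideal setT x -> x = 0.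
Proof. by move=> [_ nx]; apply/eqP/negPn/negP; rewrite -is_unit_setT. Qed.

(** For [V] local and containing [A], this is [A] localized at the contraction of the maximal ideal
    of [V]. With [V = setT] it is the fraction field of [A]. *)
Definition locin A V : set K :=
  [set z | exists a b, [/\ A a, A b, is_unit V b & z = a / b]].

Lemma locin_sub A V : subalg A -> subalg V -> A `<=` locin A V.
Proof.
by move=> sA sV a Aa; exists a, 1; split; rewrite ?divr1 //; [sa|apply: is_unit1].
Qed.
Lemma locin_le A V : subalg V -> A `<=` V -> locin A V `<=` V.
Proof. by move=> sV AV _ [a [b [Aa Ab ub ->]]]; have := AV _ Aa; case: ub => _ _ *; sa. Qed.
Lemma locin_sa A V : subalg A -> subalg V -> subalg (locin A V).
Proof.
move=> sA sV; split.
- by move=> a; apply: locin_sub => //; sa.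
- move=> _ _ [a [b [Aa Ab ub ->]]] [c [d [Ac Ad ud ->]]].
  exists (a * d - c * b), (b * d); split; [sa|sa|exact: is_unitM|].
  by fld.
- move=> _ _ [a [b [Aa Ab ub ->]]] [c [d [Ac Ad ud ->]]].
  exists (a * c), (b * d); split; [sa|sa|exact: is_unitM|].
  by fld.
Qed.
Lemma locin_unit A V x : subalg A -> subalg V -> A `<=` V ->
  locin A V x -> is_unit V x -> is_unit (locin A V) x.
Proof.
move=> sA sV AV [a [b [Aa Ab ub xE]]] ux; split; [exact: is_unit_neq0 ux|by exists a, b|].
have aE : a = x * b by rewrite xE divfK // (is_unit_neq0 ub).
by exists b, a; split; rewrite // ?xE ?invf_div // aE; apply: is_unitM.
Qed.
Lemma locin_mx A V x : subalg A -> subalg V -> A `<=` V ->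
  max_ideal (locin A V) x -> max_ideal V x.
Proof.
move=> sA sV AV [lx nx]; split; first exact: (locin_le sV AV).
by move=> ux; apply: nx; apply: locin_unit.
Qed.
Lemma locin_local A V : subalg A -> local_ring V -> A `<=` V -> local_ring (locin A V).
Proof.
move=> sA lV AV; have sV := local_sa lV; split; first exact: locin_sa.
move=> x y mx my; have sL := locin_sa sA sV; split.
  by case: mx my => lx _ [ly _]; sa.
move/(is_unit_mono (locin_le sV AV)).
by have [] := mxD lV (locin_mx sA sV AV mx) (locin_mx sA sV AV my).
Qed.
Lemma locin_dom A V : subalg A -> local_ring V -> A `<=` V -> dominates V (locin A V).
Proof.
by move=> sA [sV _] AV; split; [exact: locin_le | move=> x; exact: locin_mx].
Qed.

(** Localization at a prime without naming the prime: it is recovered as the trace on [A] of the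
    non-units of [O], and [affine_modelP] identifies these rings with the points of Spec A. *)
Definition is_loc A O : Prop :=
  [/\ subalg A, local_ring O, A `<=` O & O `<=` locin A O].

Lemma is_locE A O : is_loc A O -> O = locin A O.
Proof. by move=> [sA [sO _] AO OA]; apply/seteqP; split => //; apply: locin_le. Qed.
Lemma is_loc_locin A V : subalg A -> local_ring V -> A `<=` V -> is_loc A (locin A V).
Proof.
move=> sA lV AV; have sV := local_sa lV; split=> //; first exact: locin_local.
  exact: locin_sub.
move=> _ [a [b [Aa Ab ub ->]]]; exists a, b; split=> //.
by apply: locin_unit => //; apply: locin_sub.
Qed.
(** Changes the chart through which a point is seen. It is enough to write elements of the old ring
    as fractions over the new one, because units of [O] lying in [locin B O] stay invertible
    there. *)
Lemma is_loc_trans A B O : is_loc A O -> subalg B -> B `<=` O ->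
  A `<=` locin B O -> is_loc B O.
Proof.
move=> [sA lO AO OA] sB BO AB; have sO := local_sa lO; split=> // z Oz.
have [a [b [Aa Ab ub ->]]] := OA _ Oz.
have sL := locin_sa sB sO.
have := AB _ Aa; have [_ _ ? ?] := locin_unit sB sO BO (AB _ Ab) ub.
by sa.
Qed.
Lemma is_loc_over A O V : is_loc A O -> local_ring V -> O `<=` V ->
  locin O V = locin A V.
Proof.
move=> [sA lO AO OA] lV OV; have sV := local_sa lV; have sO := local_sa lO.
apply/seteqP; split=> z [a [b [Oa Ob ub ->]]]; last first.
  by exists a, b; split=> //; apply: AO.
have AV : A `<=` V by apply: subset_trans OV.
have h x : O x -> locin A V x.
  move/OA=> [c [d [Ac Ad ud ->]]]; exists c, d; split=> //; exact: is_unit_mono ud.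
have [_ _ hb] := locin_unit sA sV AV (h _ Ob) ub.
by have sL := locin_sa sA sV; have := h _ Oa; move=> *; sa.
Qed.
(** Domination makes denominators that are units in [V] already units in [O], so that the center of
    [V] depends only on [A] and [V]. *)
Lemma is_loc_dom A O V : is_loc A O -> local_ring V -> O `<=` V -> dominates V O ->
  O = locin A V.
Proof.
move=> hO lV OV dom; have [sA lO AO OA] := hO.
rewrite -(is_loc_over hO lV OV); apply/seteqP; split.
  by apply: locin_sub; apply: local_sa.
move=> _ [a [b [Oa Ob ub ->]]]; have sO := local_sa lO.
suff [_ _ ?] : is_unit O b by sa.
by case: (unit_or_mx Ob) => // /(proj2 dom) [].
Qed.

Lemma prime_mx A V : subalg A -> local_ring V -> A `<=` V ->
  prime_ideal A (A `&` max_ideal V).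
Proof.
move=> sA lV AV; have sV := local_sa lV; split.
- by split=> [x []//|]; split; [sa | apply: mx0].
- by move=> x y [Ax mx] [Ay my]; split; [sa | apply: mxD].
- by move=> a x Aa [Ax mx]; split; [sa | apply: mxM => //; apply: AV].
- by move=> [_ m1]; apply: (mxN1 sV).
- move=> a b Aa Ab [_ mab].
  by case: (mx_prime lV (AV _ Aa) (AV _ Ab) mab); [left|right].
Qed.
Lemma localization_mx A V : A `<=` V -> localization A (A `&` max_ideal V) = locin A V.
Proof.
move=> AV; apply/seteqP; split=> _ [a [b [Aa Ab h ->]]]; exists a, b; split=> //.
  by case: (unit_or_mx (AV _ Ab)) => // mb; case: h.
by move=> [_ []].
Qed.

Lemma prime_loc A P : subalg A -> prime_ideal A P ->
  is_loc A (localization A P) /\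
  forall a, A a -> (max_ideal (localization A P) a <-> P a).
Proof.
move=> sA pP; have [[PA P0] PD PM P1 Pp] := pP.
set V := localization A P.
have unz b : ~ P b -> b != 0 by move=> h; apply/eqP=> b0; apply: h; rewrite b0.
have AV : A `<=` V by move=> a Aa; exists a, 1; split; rewrite ?divr1 //; sa.
have nPM b d : A b -> A d -> ~ P b -> ~ P d -> ~ P (b * d).
  by move=> Ab Ad nb nd /(Pp _ _ Ab Ad) [].
have sV : subalg V.
  split.
  - by move=> a; apply: AV; sa.
  - move=> _ _ [a [b [Aa Ab ub ->]]] [c [d [Ac Ad ud ->]]].
    exists (a * d - c * b), (b * d); split; [sa|sa|exact: nPM|].
    by fld.
  - move=> _ _ [a [b [Aa Ab ub ->]]] [c [d [Ac Ad ud ->]]].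
    exists (a * c), (b * d); split; [sa|sa|exact: nPM|].
    by fld.
have uV a b : A a -> A b -> ~ P b -> is_unit V (a / b) <-> ~ P a.
  move=> Aa Ab nPb; split=> [[ab0 _ [c [d [Ac Ad nPd]]]]|nPa].
    rewrite invf_div => e Pa; have a0 : a != 0.
      by apply: contraNneq ab0 => ->; rewrite mul0r.
    have : b * d = c * a.
      have := congr1 (fun z => z * a * d) e; rewrite divfK //.
      by rewrite (mulrAC c) divfK ?unz.
    by move=> e'; apply: (nPM _ _ Ab Ad nPb nPd); rewrite e'; apply: PM.
  split; first by rewrite mulf_neq0 ?invr_eq0 ?unz.
    by exists a, b.
  by exists b, a; rewrite invf_div.
have mV a : A a -> max_ideal V a <-> P a.
  move=> Aa; split=> [[_ nu]|Pa].
    by case: (pselect (P a)) => // nPa; case: nu; rewrite -[a]divr1; apply/uV => //; sa.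
  split; first exact: AV.
  by rewrite -[a]divr1 => /uV h; apply: h => //; sa.
split=> //; split=> //.
- split=> // _ _ [[a [b [Aa Ab nb ->]]] na] [[c [d [Ac Ad nd ->]]] nc].
  have Pa : P a by case: (pselect (P a)) => // /(proj2 (uV _ _ Aa Ab nb)) /na.
  have Pc : P c by case: (pselect (P c)) => // /(proj2 (uV _ _ Ac Ad nd)) /nc.
  have -> : a / b + c / d = (d * a + b * c) / (b * d) by fld.
  have Pn : P (d * a + b * c) by apply: PD; apply: PM.
  split; first by exists (d * a + b * c), (b * d); split=> //; [sa|sa|apply: nPM].
  by move/(uV _ _ (PA _ Pn)); apply=> //; [sa|apply: nPM].
- move=> _ [a [b [Aa Ab nb ->]]]; exists a, b; split=> //.
  by rewrite -[b]divr1; apply/uV => //; sa.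
Qed.

Lemma affine_modelP A O : subalg A -> affine_model A O <-> is_loc A O.
Proof.
move=> sA; split=> [[P pP ->]|hO]; first by case: (prime_loc sA pP).
have [_ lO AO OA] := hO; exists (A `&` max_ideal O); first exact: prime_mx.
by rewrite localization_mx //; apply: is_locE.
Qed.

Definition chart (y : seq K) (yi : K) : set K :=
  alg_gen iota [set z / yi | z in [set` y]].

Lemma chart_sa ys yi : subalg (chart ys yi). Proof. exact: alg_gen_sa. Qed.
Lemma chart_in ys yi z : z \in ys -> chart ys yi (z / yi).
Proof. by move=> zy; apply: alg_gen_sub; exists z. Qed.
Arguments chart_in [ys] yi [z].
Lemma chart_min ys yi A : subalg A -> (forall z, z \in ys -> A (z / yi)) -> chart ys yi `<=` A.
Proof. by move=> sA h; apply: alg_gen_min => // _ [z zy <-]; apply: h. Qed.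

Lemma proj_modelP ys O : proj_model iota ys O <->
  exists yi, [/\ yi \in ys, yi != 0 & is_loc (chart ys yi) O].
Proof.
by split=> -[yi [h1 h2 h3]]; exists yi; split=> //; apply/affine_modelP => //;
  apply: chart_sa.
Qed.

(** The existence half of the valuative criterion, once a coordinate dividing all the others in [V]
    is known. *)
Lemma proj_point ys yi V : yi \in ys -> yi != 0 -> local_ring V ->
  (forall z, z \in ys -> V (z / yi)) ->
  [/\ proj_model iota ys (locin (chart ys yi) V), is_loc (chart ys yi) (locin (chart ys yi) V),
   locin (chart ys yi) V `<=` V & dominates V (locin (chart ys yi) V)].
Proof.
move=> yiy yi0 lV h; have sV := local_sa lV.
have cV := chart_min sV h; have sC := chart_sa ys yi.
have hl := is_loc_locin sC lV cV.
split=> //; last exact: locin_dom.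
  by apply/proj_modelP; exists yi.
exact: locin_le.
Qed.

(** Separatedness. The ratio of the two pivot coordinates is a unit of [V], hence a unit at each
    dominated point, so either point can be read in the chart of the other. *)
Lemma proj_center_unique ys V O O' : local_ring V -> proj_model iota ys O -> proj_model iota ys O' ->
  dominates V O -> dominates V O' -> O = O'.
Proof.
move=> lV /proj_modelP [yi [iy i0 hO]] /proj_modelP [yj [jy j0 hO']] d d'.
have sV := local_sa lV.
have sub (W : set K) (yk yl : K) : yk != 0 -> yl != 0 -> yk \in ys -> yl \in ys ->
    is_loc (chart ys yk) W -> dominates V W -> V (yk / yl) ->
    forall z, z \in ys -> W (z / yl).
  move=> k0 l0 ky ly [_ lW cW _] [WV mW] h z zy; have sW := local_sa lW.
  have u : is_unit W (yl / yk).
    case: (@unit_or_mx W (yl / yk)) => //; first by apply: cW; apply: chart_in.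
    move/mW => [_ []]; split; rewrite ?invf_div //; first by rewrite mulf_neq0 ?invr_eq0.
    by apply: WV; apply: cW; apply: chart_in.
  have -> : z / yl = z / yk * (yl / yk)^-1 by fld.
  by have := cW _ (chart_in yk zy); case: u => *; sa.
have [OV _] := d; have [OV' _] := d'.
have [_ _ cO _] := hO; have [_ _ cO' _] := hO'.
have h1 := sub _ _ _ i0 j0 iy jy hO d (OV' _ (cO' _ (chart_in yj iy))).
have h2 := sub _ _ _ j0 i0 jy iy hO' d' (OV _ (cO _ (chart_in yi jy))).
have [_ lO _ _] := hO; have [_ lO' _ _] := hO'.
rewrite (is_loc_dom hO lV OV d) (is_loc_dom hO' lV OV' d').
have aux (W : set K) (yk yl : K) : is_loc (chart ys yl) W -> W `<=` V -> dominates V W ->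
  (forall z, z \in ys -> W (z / yk)) -> locin (chart ys yk) V `<=` locin (chart ys yl) V.
  move=> hW WV dW hz; have [_ lW _ _] := hW.
  rewrite -(is_loc_dom hW lV WV dW) => _ [a [b [ca cb ub ->]]].
  have sW := local_sa lW; have cW := chart_min sW hz.
  have Wa := cW _ ca; have Wb := cW _ cb.
  suff [_ _ ?] : is_unit W b by sa.
  by case: (unit_or_mx Wb) => // /(proj2 dW) [].
by apply/seteqP; split; apply: aux; eauto.
Qed.

Lemma proj_over ys O V : proj_model iota ys O -> local_ring V -> O `<=` V ->
  [/\ proj_model iota ys (locin O V), locin O V `<=` V & dominates V (locin O V)].
Proof.
move=> /proj_modelP [yi [iy i0 hO]] lV OV.
have [_ lO cO _] := hO; rewrite (is_loc_over hO lV OV).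
have [] := @proj_point ys yi V iy i0 lV; last by [].
by move=> z zy; apply: OV; apply: cO; apply: chart_in.
Qed.

Lemma center_proj ys V O : local_ring V -> proj_model iota ys O -> dominates V O ->
  center (proj_model iota ys) V = O.
Proof.
move=> lV yO d; apply: xget_unique => // O' [yO' d'].
exact: (proj_center_unique lV yO' yO d' d).
Qed.

Lemma proj_local ys O : proj_model iota ys O -> local_ring O.
Proof. by move=> /proj_modelP [yi [_ _ []]]. Qed.

Lemma dominates_refl O : dominates O O. Proof. by split. Qed.
Definition subfield F := subalg F /\ forall x, F x -> F x^-1.

Lemma subfield_locin A : subalg A -> subfield (locin A setT).
Proof.
move=> sA; split; first exact: locin_sa.
move=> _ [a [b [Aa Ab /is_unit_setT b0 ->]]]; have [->|a0] := eqVneq a 0.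
  by rewrite mul0r invr0; exists 0, 1; split; rewrite ?mul0r ?is_unit_setT ?oner_neq0 //; sa.
by exists b, a; split; rewrite ?is_unit_setT ?invf_div.
Qed.
Lemma subfield_sa F : subfield F -> subalg F. Proof. by case. Qed.
Lemma sfV F x : subfield F -> F x -> F x^-1. Proof. by case=> _; apply. Qed.
Lemma sf_div F x y : subfield F -> F x -> F y -> F (x / y).
Proof. by move=> [sF vF] Fx Fy; have := vF _ Fy; move=> *; sa. Qed.
Lemma subfield_setT : subfield setT. Proof. by split. Qed.
Lemma locin_min A V F : subfield F -> A `<=` F -> locin A V `<=` F.
Proof. by move=> sF AF _ [a [b [Aa Ab _ ->]]]; apply: sf_div => //; apply: AF. Qed.
(** The function field is a union over all points; the generic point of any one chart already
    contains every other local ring. *)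
Lemma function_field_proj ys yi : yi \in ys -> yi != 0 ->
  function_field (proj_model iota ys) = locin (chart ys yi) setT.
Proof.
move=> iy i0; apply/seteqP; split; last first.
  move=> z hz; exists (locin (chart ys yi) setT) => //.
  by have [] := @proj_point ys yi setT iy i0 local_setT (fun _ _ => I).
have sF := subfield_locin (chart_sa ys yi); have sT := setT_sa iota.
move=> z [O /proj_modelP [yj [jy j0 [_ lO cO OA]]]] /OA.
apply: locin_min => //; apply: chart_min; first exact: subfield_sa.
move=> x xy; have -> : x / yj = (x / yi) / (yj / yi) by fld.
by apply: sf_div => //; apply: locin_sub => //; (exact: chart_sa || exact: chart_in).
Qed.

End LocalRings2.
Arguments chart_in {R K iota ys} yi {z}.
#[global] Hint Extern 0 (subalgebra _ (chart _ _ _)) => exact: chart_sa : sadb.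
#[global] Hint Extern 0 (subalgebra _ _) => (apply: local_sa; assumption) : sadb.
#[global] Hint Extern 0 (subalgebra _ _) => (apply: subfield_sa; assumption) : sadb.

(** * Noetherian subrings *)

Section Noetherian.
Variables (R : realType) (K : fieldType) (iota : {rmorphism R[i] -> K}).
Local Notation subalg := (subalgebra iota).
Local Notation local_ring := (local_ring iota).
Local Notation is_loc := (is_loc iota).
Local Notation subfield := (subfield iota).
Implicit Types (A B O V F I P M G : set K) (x y z a b u : K) (p q : {poly K}).

Definition polyin A p : Prop := forall i, A p`_i.
Definition adj A u : set K := [set p.[u] | p in polyin A].

Lemma polyinC A a : subalg A -> A a -> polyin A a%:P.
Proof. by move=> sA Aa i; rewrite coefC; case: eqP => _; sa. Qed.
Lemma polyinX A : subalg A -> polyin A 'X.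
Proof. by move=> sA i; rewrite coefX; case: eqP => _; sa. Qed.
Lemma polyinD A p q : subalg A -> polyin A p -> polyin A q -> polyin A (p + q).
Proof. by move=> sA hp hq i; rewrite coefD; sa. Qed.
Lemma polyinB A p q : subalg A -> polyin A p -> polyin A q -> polyin A (p - q).
Proof. by move=> sA hp hq i; rewrite coefB; sa. Qed.
Lemma polyinM A p q : subalg A -> polyin A p -> polyin A q -> polyin A (p * q).
Proof. by move=> sA hp hq i; rewrite coefM; apply: (sa_sum sA) => j _; sa. Qed.
Lemma polyinXn A p n : subalg A -> polyin A p -> polyin A (p ^+ n).
Proof.
move=> sA hp; elim: n => [|n IH]; last by rewrite exprS; apply: polyinM.
by rewrite expr0; apply: polyinC => //; sa.
Qed.
Lemma polyin_sum A (J : Type) (r : seq J) (f : J -> {poly K}) :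
  subalg A -> (forall j, polyin A (f j)) -> polyin A (\sum_(j <- r) f j).
Proof. by move=> sA h i; rewrite coef_sum; apply: (sa_sum sA) => j _; apply: h. Qed.
Lemma polyin_mono A B p : A `<=` B -> polyin A p -> polyin B p.
Proof. by move=> AB hp i; apply: AB. Qed.
Lemma polyin_horner A B p u : subalg B -> A `<=` B -> B u -> polyin A p -> B p.[u].
Proof.
move=> sB AB Bu hp; rewrite horner_coef; apply: (sa_sum sB) => i _.
by have := AB _ (hp i); move=> *; sa.
Qed.
Lemma polyin_poly A n (f : nat -> K) : subalg A -> (forall i, A (f i)) -> polyin A (\poly_(i < n) f i).
Proof. by move=> sA h i; rewrite coef_poly; case: ifP => _ //; sa. Qed.

Lemma adj_sa A u : subalg A -> subalg (adj A u).
Proof.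
move=> sA; split.
- by move=> a; exists (iota a)%:P; rewrite ?hornerC //; apply: polyinC => //; sa.
- by move=> _ _ [p hp <-] [q hq <-]; exists (p - q); [apply: polyinB | rewrite !hornerE].
- by move=> _ _ [p hp <-] [q hq <-]; exists (p * q); [apply: polyinM | rewrite !hornerE].
Qed.
Lemma adj_base A u : subalg A -> A `<=` adj A u.
Proof. by move=> sA a Aa; exists a%:P; rewrite ?hornerC //; apply: polyinC. Qed.
Lemma adj_gen A u : subalg A -> adj A u u.
Proof. by move=> sA; exists 'X; rewrite ?hornerX //; apply: polyinX. Qed.
Lemma adj_min A B u : subalg B -> A `<=` B -> B u -> adj A u `<=` B.
Proof. by move=> sB AB Bu _ [p hp <-]; apply: polyin_horner hp. Qed.

Lemma alg_gen_cons z (l : seq K) : alg_gen iota [set` z :: l] = adj (alg_gen iota [set` l]) z.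
Proof.
apply/seteqP; split.
  apply: alg_gen_min; first by apply: adj_sa; sa.
  move=> x /=; rewrite inE => /orP[/eqP->|xl]; first by apply: adj_gen; sa.
  by apply: adj_base; [sa|apply: alg_gen_sub].
apply: adj_min; first by sa.
  apply: alg_gen_min; first by sa.
  by move=> x /= xl; apply: alg_gen_sub; rewrite /= inE xl orbT.
by apply: alg_gen_sub; rewrite /= inE eqxx.
Qed.

Fixpoint span A (g : seq K) : set K :=
  if g is z :: g' then [set x | exists a y, [/\ A a, span A g' y & x = a * z + y]]
  else [set 0].
Definition ideal A I : Prop :=
  [/\ I `<=` A, I 0, (forall x y, I x -> I y -> I (x + y))
    & forall a x, A a -> I x -> I (a * x)].
Definition noeth A : Prop :=
  forall I, ideal A I -> exists g : seq K, (forall z, z \in g -> I z) /\ I `<=` span A g.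

Lemma span0 A g : subalg A -> span A g 0.
Proof.
move=> sA; elim: g => [//|z g IH] /=; exists 0, 0.
by split=> //; [sa | rewrite mul0r addr0].
Qed.
Lemma spanD A g x y : subalg A -> span A g x -> span A g y -> span A g (x + y).
Proof.
move=> sA; elim: g x y => [_ _ -> ->|z g IH x y] /=; first exact: addr0.
move=> [a [x' [Aa gx ->]]] [b [y' [Ab gy ->]]]; exists (a + b), (x' + y').
by split; [sa | apply: IH | ring].
Qed.
Lemma spanM A g a x : subalg A -> A a -> span A g x -> span A g (a * x).
Proof.
move=> sA Aa; elim: g x => [_ ->|z g IH x] /=; first exact: mulr0.
move=> [b [y [Ab gy ->]]]; exists (a * b), (a * y).
by split; [sa | apply: IH | ring].
Qed.
Lemma span_mem A g z : subalg A -> z \in g -> span A g z.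
Proof.
move=> sA; elim: g => [//|y g IH]; rewrite inE => /orP[/eqP->|zg] /=.
  by exists 1, 0; split; [sa | apply: span0 | ring].
by exists 0, z; split; [sa | apply: IH | ring].
Qed.
Lemma span_min A g I : I 0 -> (forall x y, I x -> I y -> I (x + y)) ->
  (forall a x, A a -> I x -> I (a * x)) -> (forall z, z \in g -> I z) -> span A g `<=` I.
Proof.
move=> I0 ID IM; elim: g => [_ _ ->//|z g IH h x] /= [a [y [Aa gy ->]]].
apply: ID; first by apply: IM => //; apply: h; rewrite inE eqxx.
by apply: IH gy => z' zg; apply: h; rewrite inE zg orbT.
Qed.
Lemma span_le A g g' : subalg A -> (forall z, z \in g -> span A g' z) -> span A g `<=` span A g'.
Proof. by move=> sA h; apply: span_min => // *; [apply: span0|apply: spanD|apply: spanM]. Qed.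
Lemma span_coef A g x : subalg A -> span A g x ->
  exists c : nat -> K, (forall i, A (c i)) /\ x = \sum_(i < size g) c i * g`_i.
Proof.
move=> sA; elim: g x => [_ ->|z g IH x] /=.
  by exists (fun=> 0); split=> [i|]; [sa | rewrite big_ord0].
move=> [a [y [Aa /IH[c [hc ->]] ->]]].
exists (fun i => if i is j.+1 then c j else a); split=> [[|i]|] //.
by rewrite big_ord_recl.
Qed.

Lemma mem_mkseqP (x : nat -> K) n z : z \in mkseq x n -> exists2 i, (i < n)%N & z = x i.
Proof. by rewrite /mkseq => /mapP [j]; rewrite mem_iota add0n => /andP[_ h] ->; exists j. Qed.
Lemma mkseq_mem (x : nat -> K) n i : (i < n)%N -> x i \in mkseq x n.
Proof. by move=> h; apply/mapP; exists i; rewrite ?mem_iota. Qed.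
Lemma span_mkseq_mono A (x : nat -> K) m n : subalg A -> (m <= n)%N ->
  span A (mkseq x m) `<=` span A (mkseq x n).
Proof.
move=> sA mn; apply: span_le => // z /mem_mkseqP [i im ->].
by apply: span_mem => //; apply: mkseq_mem; apply: leq_trans mn.
Qed.

(** The ascending chain condition for elements: finitely many generators of the ideal of all the
    [x n] already lie in the span of an initial segment. *)
Lemma noeth_seq A (x : nat -> K) : subalg A -> noeth A -> (forall n, A (x n)) ->
  exists N, span A (mkseq x N) (x N).
Proof.
move=> sA nA Ax; pose J := [set z | exists n, span A (mkseq x n) z].
have [] := nA J.
  split.
  - move=> z [n]; apply: span_min; try by move=> *; sa.
    by move=> y /mem_mkseqP [i _ ->].
  - by exists 0; rewrite //=.
  - move=> y z [m hy] [n hz]; exists (maxn m n); apply: spanD => //.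
      by apply: span_mkseq_mono hy => //; apply: leq_maxl.
    by apply: span_mkseq_mono hz => //; apply: leq_maxr.
  - by move=> a z Aa [n hz]; exists n; apply: spanM.
move=> g [hg Jg].
have [N hN] : exists N, forall z, z \in g -> span A (mkseq x N) z.
  elim: g hg {Jg} => [_|y g IH hg]; first by exists 0.
  have [z zg|N hN] := IH; first by apply: hg; rewrite inE zg orbT.
  have [|m hm] := hg y; first by rewrite inE eqxx.
  exists (maxn m N) => z; rewrite inE => /orP[/eqP->|zg].
    by apply: span_mkseq_mono hm => //; apply: leq_maxl.
  by apply: span_mkseq_mono (hN _ zg) => //; apply: leq_maxr.
exists N; apply: (span_le sA hN); apply: Jg; exists N.+1.
by apply: span_mem => //; apply: mkseq_mem.
Qed.

(** The family is indexed so that a maximal ideal keeps its index: below, [J c] is a denominator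
    ideal and its multiplier [c] is used afterwards. *)
Lemma noeth_max A (T : choiceType) (J : T -> set K) (Q : T -> Prop) (c0 : T) :
  subalg A -> noeth A -> (forall c, ideal A (J c)) -> Q c0 ->
  exists2 c, Q c & forall c', Q c' -> J c `<=` J c' -> J c' `<=` J c.
Proof.
move=> sA nA hJ Q0; apply: contrapT => hno.
(* Each strict enlargement comes with an element that witnesses it; the sequence of witnesses
   contradicts [noeth_seq]. *)
have step (c : T) : exists cx : T * K, Q c -> [/\ Q cx.1, J c `<=` J cx.1, J cx.1 cx.2 & ~ J c cx.2].
  case: (pselect (Q c)) => Qc; last by exists (c, 0).
  apply: contrapT => h; apply: hno; exists c => // c' Qc' le x Jx.
  by apply: contrapT => nJx; apply: h; exists (c', x).
have [f hf] := choice step.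
pose c n := iter n (fun d => (f d).1) c0; pose x n := (f (c n)).2.
have Qc n : Q (c n) by elim: n => [//|n IH] /=; case: (hf _ IH).
have mono m n : (m <= n)%N -> J (c m) `<=` J (c n).
  elim: n => [|n IH]; first by rewrite leqn0 => /eqP->.
  rewrite leq_eqVlt => /orP[/eqP->//|/IH h]; apply: subset_trans h _.
  by case: (hf _ (Qc n)).
have [|N] := noeth_seq (x := x) sA nA.
  by move=> n; have [_ _ h _] := hf _ (Qc n); case: (hJ (f (c n)).1) => sub _ _ _; apply: sub.
have [_ _ _ nx] := hf _ (Qc N); move=> h; apply: nx.
have [sub J0 JD JM] := hJ (c N).
apply: span_min h => // z /mem_mkseqP [i iN ->].
by apply: (mono i.+1) => //; have [_ _ h _] := hf _ (Qc i).
Qed.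

Lemma noeth_sf F : subfield F -> noeth F.
Proof.
move=> sF I [IF I0 ID IM]; case: (pselect (exists2 x, I x & x != 0)) => [[x Ix x0]|h].
  exists [:: x]; split=> [z|y Iy]; first by rewrite inE => /eqP->.
  exists (y / x), 0; split=> //=; last by rewrite divfK // addr0.
  by apply: (sf_div sF); apply: IF.
exists [::]; split=> // y Iy /=; apply/eqP; case: eqP => // /eqP y0.
by case: h; exists y.
Qed.
Lemma range_subfield : subfield (range iota).
Proof. by split; [sa | move=> _ [a _ <-]; exists a^-1; rewrite // fmorphV]. Qed.

(** Generators of the contraction [A ∩ I] generate [I], since every element of [I] is a unit times
    an element of [A]. *)
Lemma noeth_loc A V : is_loc A V -> noeth A -> noeth V.
Proof.
move=> [sA lV AV VA] nA I [IV I0 ID IM]; have sV := local_sa lV.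
have [|g [hg Ig]] := nA (A `&` I).
  split; first by move=> x [].
  - by split=> //; sa.
  - by move=> x y [Ax Ix] [Ay Iy]; split; [sa | apply: ID].
  - by move=> a x Aa [Ax Ix]; split; [sa | apply: IM => //; apply: AV].
exists g; split=> [z /hg []//|x Ix].
have [a [b [Aa Ab ub xE]]] := VA _ (IV _ Ix).
have aE : a = b * x by rewrite xE mulrC divfK // (is_unit_neq0 ub).
have Ia : (A `&` I) a by split=> //; rewrite aE; apply: IM => //; apply: AV.
have -> : x = b^-1 * a by rewrite xE mulrC.
apply: spanM => //; first exact: is_unit_inV ub.
apply: span_min (Ig _ Ia).
- exact: span0.
- by move=> *; apply: spanD.
- by move=> *; apply: spanM => //; apply: AV.
- by move=> *; apply: span_mem.
Qed.

(* Lifts an A-combination of leading coefficients to a combination of the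
   polynomials themselves, all shifted to the common degree d - 1. *)
Lemma lead_span A u (g : seq {poly K}) d x : subalg A ->
  (forall p, p \in g -> polyin A p /\ (size p <= d)%N) ->
  span A [seq lead_coef p | p <- g] x ->
  exists h : {poly K}, [/\ polyin A h, (size h <= d)%N, h`_d.-1 = x
    & span (adj A u) [seq p.[u] | p <- g] h.[u]].
Proof.
move=> sA; elim: g x => [x _ ->|p g IH x hg] /=.
  by exists 0; rewrite size_poly0 coef0 horner0; split=> // i; rewrite coef0; sa.
move=> [a [y [Aa gy ->]]].
have [q qg|h [hA hd hx hs]] := IH _ _ gy; first by apply: hg; rewrite inE qg orbT.
have [|pA pd] := hg p; first by rewrite inE eqxx.
exists (a%:P * 'X^(d - size p) * p + h); split.
- apply: polyinD => //; apply: polyinM => //; apply: polyinM => //; first exact: polyinC.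
  by apply: polyinXn => //; apply: polyinX.
- apply: leq_trans (size_polyD _ _) _; rewrite geq_max hd andbT -mulrA mul_polyC.
  apply: leq_trans (size_scale_leq _ _) _; rewrite mulrC.
  have [->|p0] := eqVneq p 0; first by rewrite mul0r size_poly0.
  by rewrite size_mulXn // subnK.
- rewrite coefD hx; congr (_ + _); rewrite -mulrA coefCM; congr (_ * _).
  rewrite mulrC coefMXn; have [->|p0] := eqVneq p 0.
    by rewrite lead_coef0 coef0 if_same.
  rewrite -size_poly_gt0 in p0; rewrite lead_coefE; case: ifP; first by lia.
  by move=> _; congr (_`_ _); lia.
- have sB := adj_sa u sA; exists (a * u ^+ (d - size p)), h.[u]; split=> //.
    by have := adj_base u sA Aa; have := adj_gen u sA; move=> *; sa.
  by rewrite !hornerE.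
Qed.

(** The element [u] may be algebraic over [A], so elements of the ideal are followed through
    polynomials representing them: each new generator is represented by a polynomial of least size
    among those whose value escapes the span so far. *)
Theorem hilbert_basis A u : subalg A -> noeth A -> noeth (adj A u).
Proof.
move=> sA nA I [IA I0 ID IM]; apply: contrapT => hno; have sB := adj_sa u sA.
pose bad (g : seq {poly K}) p :=
  [/\ polyin A p, I p.[u] & ~ span (adj A u) [seq q.[u] | q <- g] p.[u]].
have step (g : seq {poly K}) : exists p, (forall q, q \in g -> I q.[u]) ->
    bad g p /\ forall q, bad g q -> (size p <= size q)%N.
  case: (pselect (forall q, q \in g -> I q.[u])) => [hg|]; last by exists 0.
  have [p hp] : exists p, bad g p.
    apply: contrapT => h; apply: hno; exists [seq q.[u] | q <- g]; split.
      by move=> _ /mapP [q /hg h' ->].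
    move=> x Ix; apply: contrapT => nx; have [p hp px] := IA _ Ix.
    by apply: h; exists p; rewrite /bad px.
  have ex : exists n, `[< exists2 p, bad g p & size p = n >] by exists (size p); apply/asboolP; exists p.
  case: (ex_minnP ex) => n /asboolP [p' hp' <-] hmin; exists p' => _; split=> // q hq.
  by apply: hmin; apply/asboolP; exists q.
have [f hf] := choice step.
pose G := fix G n := if n is m.+1 then f (G m) :: G m else [::].
have IG n : forall q, q \in G n -> I q.[u].
  elim: n => [//|n IH] q; rewrite inE => /orP[/eqP->|/IH//].
  by have [[_ ? _] _] := hf _ IH.
have bf n := proj1 (hf _ (IG n)); have mf n := proj2 (hf _ (IG n)).
have GP n q : q \in G n -> exists2 i, (i < n)%N & q = f (G i).
  elim: n => [//|n IH]; rewrite inE => /orP[/eqP->|/IH[i ? ->]]; first by exists n.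
  by exists i => //; lia.
have Gmem i n : (i < n)%N -> f (G i) \in G n.
  elim: n => [//|n IH]; rewrite ltnS leq_eqVlt => /orP[/eqP->|/IH h]; rewrite inE ?eqxx //.
  by rewrite h orbT.
pose a n := lead_coef (f (G n)).
have [|N hN] := noeth_seq (x := a) sA nA; first by move=> n; case: (bf n) => h _ _; apply: h.
have hsp : span A [seq lead_coef p | p <- G N] (a N).
  apply: span_le hN => // _ /mem_mkseqP [i iN ->]; apply: span_mem => //.
  by apply/mapP; exists (f (G i)) => //; apply: Gmem.
have [pA pI pn] := bf N.
have szG p : p \in G N -> polyin A p /\ (size p <= size (f (G N)))%N.
  move=> /GP [i iN ->]; split; first by case: (bf i).
  apply: mf; split=> // h; apply: pn; apply: span_le h => // _ /mapP [q /GP [j ji ->] ->].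
  by apply: span_mem => //; apply: map_f; apply: Gmem; apply: ltn_trans iN.
have [h [hA hd hx hs]] := lead_span u sA szG hsp.
have Ih : I h.[u] by apply: span_min hs => // _ /mapP [q /IG ? ->].
(* The polynomial [h] has the same leading term as [f (G N)] and its value is in the span, so the
   difference is still bad but shorter. *)
have : bad (G N) (f (G N) - h).
  split; first exact: polyinB.
    rewrite !hornerE; apply: ID => //; rewrite -mulN1r; apply: IM => //; sa.
  rewrite !hornerE => hh; apply: pn; rewrite -(subrK h.[u] (f (G N)).[u]).
  exact: spanD.
move/mf; apply/negP; rewrite -ltnNge.
have p0 : (0 < size (f (G N)))%N.
  rewrite lt0n size_poly_eq0; apply/eqP => e; apply: pn; rewrite e horner0.
  exact: span0.
rewrite -(ltn_predK p0) ltnS; apply/leq_sizeP => j hj; rewrite coefB.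
move: hj; rewrite leq_eqVlt => /orP[/eqP<-|hj]; first by rewrite hx /a lead_coefE subrr.
have hj' : (size (f (G N)) <= j)%N by rewrite -(ltn_predK p0).
by rewrite !nth_default ?subrr //; apply: leq_trans hd _.
Qed.

Lemma noeth_alg_gen (l : seq K) : noeth (alg_gen iota [set` l]).
Proof.
elim: l => [|z l IH]; last by rewrite alg_gen_cons; apply: hilbert_basis => //; sa.
suff -> : alg_gen iota [set` [::]] = range iota by apply/noeth_sf/range_subfield.
apply/seteqP; split; first by apply: alg_gen_min => //; sa.
by move=> _ [a _ <-]; sa.
Qed.
Lemma chart_finite ys yi : chart iota ys yi = alg_gen iota [set` [seq z / yi | z <- ys]].
Proof.
congr alg_gen; apply/seteqP; split=> [_ [z zy <-]|_ /mapP[z zy ->]] /=; first exact: map_f.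
by exists z.
Qed.
Lemma noeth_chart ys yi : noeth (chart iota ys yi).
Proof. by rewrite chart_finite; exact: noeth_alg_gen. Qed.

End Noetherian.
#[global] Hint Extern 1 (subalgebra _ (adj _ _)) => (apply: adj_sa; sasub) : sadb.

(** * Discrete valuation rings and normality *)

Section Valuations.
Variables (R : realType) (K : fieldType) (iota : {rmorphism R[i] -> K}).
Local Notation subalg := (subalgebra iota).
Local Notation local_ring := (local_ring iota).
Local Notation is_loc := (is_loc iota).
Local Notation subfield := (subfield iota).
Local Notation noeth := (@noeth K).
Implicit Types (A B O V F I P M G : set K) (x y z a b u pi : K) (p q : {poly K}).

(** An explicit relation instead of a monic polynomial, easier to rescale and to specialize;
    [normalP] makes the link with [normal]. *)
Definition integral A z : Prop := exists n (c : nat -> K),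
  (forall i, A (c i)) /\ z ^+ n = \sum_(i < n) c i * z ^+ i.
Definition int_closed F A : Prop := forall z, F z -> integral A z -> A z.

(** A common denominator of all powers of [z] puts A[z] inside a finitely generated module;
    [noeth_seq] applied to the [a * z ^+ i] yields the integral equation. *)
Lemma noeth_integral A a z : subalg A -> noeth A -> a != 0 ->
  (forall i, A (a * z ^+ i)) -> integral A z.
Proof.
move=> sA nA a0 h; have [N hN] := noeth_seq sA nA h.
have [c [hc e]] := span_coef sA hN; exists N, c; split=> //.
rewrite size_mkseq in e.
apply: (mulfI a0); rewrite e mulr_sumr; apply: eq_bigr => i _.
by rewrite nth_mkseq // mulrCA.
Qed.

Lemma integral_mono A B z : A `<=` B -> integral A z -> integral B z.
Proof. by move=> AB [n [c [hc e]]]; exists n, c; split=> // i; apply: AB. Qed.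

Lemma root_integral A z p : subalg A -> p \is monic -> polyin A p -> root p z -> integral A z.
Proof.
move=> sA pm pA /rootP rz; exists (size p).-1, (fun i => - p`_i).
split=> [i|]; first by have := pA i; move=> *; sa.
have sp : (0 < size p)%N by rewrite size_poly_gt0 monic_neq0.
move: rz; rewrite horner_coef -(ltn_predK sp) big_ord_recr /= -lead_coefE (eqP pm) mul1r.
move/eqP; rewrite addrC addr_eq0 => /eqP->; rewrite -sumrN.
by apply: eq_bigr => i _; rewrite mulNr.
Qed.

Lemma integral_root A z : subalg A -> integral A z ->
  exists p, [/\ p \is monic, polyin A p & root p z].
Proof.
move=> sA [n [c [hc e]]]; exists ('X^n - \poly_(i < n) c i); split.
- rewrite monicE lead_coefDl ?lead_coefXn // size_polyN size_polyXn ltnS.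
  exact: size_poly.
- apply: (polyinB sA); first by apply: (polyinXn _ sA); apply: (polyinX sA).
  by apply: (polyin_poly n sA).
- by apply/rootP; rewrite !hornerE horner_poly -e subrr.
Qed.

Lemma normalP X (F := function_field X) : (forall O, X O -> subalg O) ->
  normal X <-> forall O, X O -> int_closed F O.
Proof.
move=> sX; split=> h O XO z Fz => [/(integral_root (sX _ XO)) [p [pm pO rz]]|p pm pO rz].
  exact: (h O XO z Fz p).
by apply: h => //; apply: root_integral rz => //; apply: sX.
Qed.

Lemma common_denom A V (c : nat -> K) n : subalg A -> subalg V -> (forall i, locin A V (c i)) ->
  exists d, [/\ A d, is_unit V d & forall i, (i < n)%N -> A (d * c i)].
Proof.
move=> sA sV hc; elim: n => [|n [d [Ad ud hd]]].
  by exists 1; split; [sa|exact: (is_unit1 sV)|].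
have [a [b [Aa Ab ub cE]]] := hc n.
exists (d * b); split; [sa|exact: (is_unitM sV)|move=> i].
rewrite ltnS leq_eqVlt => /orP[/eqP->|/hd h].
  by rewrite cE (_ : _ * _ = d * a); [sa | fld].
by rewrite mulrAC; sa.
Qed.

Lemma int_closed_loc A V F : is_loc A V -> V `<=` F -> subfield F -> int_closed F A -> int_closed F V.
Proof.
move=> [sA lV AV VA] VF sF nA z Fz [n [c [hc e]]]; have sV := local_sa lV.
have [d [Ad ud hd]] := common_denom n sA sV (fun i => VA _ (hc i)).
have d0 := is_unit_neq0 ud.
suff h : A (d * z).
  have -> : z = d^-1 * (d * z) by rewrite mulKf.
  by have := AV _ h; have := is_unit_inV ud; move=> *; sa.
apply: nA; first by have := VF _ (AV _ Ad); have sF' := subfield_sa sF; move=> *; sa.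
(* Multiplying the equation of [z] by [d ^+ n] gives one for [d * z]; one factor [d] clears the
   denominator of [c i]. The default 0 covers indices on which [d] has no control. *)
exists n, (fun i => if (i < n)%N then d * c i * d ^+ (n.-1 - i) else 0); split.
  by move=> i; case: ifP => [/hd h|_]; sa.
rewrite exprMn e mulr_sumr; apply: eq_bigr => i _; rewrite ltn_ord exprMn.
have -> : d ^+ n = d * d ^+ (n.-1 - i) * d ^+ i.
  by rewrite -exprS -exprD; congr (_ ^+ _); have := ltn_ord i; lia.
by ring.
Qed.

(** The valuation is only required on [F], so that local rings of the curve, whose fraction field is
    smaller than [K], are covered as well. *)
Definition dvr_in F V pi : Prop := [/\ local_ring V, pi != 0, max_ideal V pi
  & forall z, F z -> z != 0 -> exists n : int, is_unit V (z / pi ^ n)].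
Local Notation dvr := (dvr_in setT).

Lemma dvr_of F V pi : local_ring V -> noeth V -> F `<=` locin V setT ->
  pi != 0 -> max_ideal V pi -> (forall x, max_ideal V x -> V (x / pi)) -> dvr_in F V pi.
Proof.
move=> lV nV FV pi0 mpi hpi; split=> // z Fz z0; have sV := local_sa lV.
have pV n : V (pi ^+ n) by case: mpi => *; sa.
have step x : V x -> x != 0 -> exists n : int, is_unit V (x / pi ^ n).
  move=> Vx x0.
  (* If [x] were divisible by every power of [pi], the ideals generated by the [x / pi ^+ n] would
     stabilize and [pi] would be a unit. *)
  have [n hn] : exists n, ~ V (x / pi ^+ n).
    apply: contrapT => h; have {}h n : V (x / pi ^+ n).
      by apply: contrapT => hh; apply: h; exists n.
    have [N hN] := noeth_seq sV nV h.
    case: N hN => [|N] hN; first by move/eqP: hN; rewrite expr0 divr1 (negPf x0).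
    have : span V [:: x / pi ^+ N] (x / pi ^+ N.+1).
      apply: (span_le sV _ hN) => y /mem_mkseqP [j jN ->] /=.
      exists (pi ^+ (N - j)), 0; split=> //.
      have -> : pi ^+ N = pi ^+ (N - j) * pi ^+ j by rewrite -exprD subnK.
      by rewrite addr0; field; rewrite !expf_neq0.
    move=> /= [a [_ [Va -> e]]].
    have aE : a = pi^-1.
      have xn : x / pi ^+ N != 0 by rewrite mulf_neq0 ?invr_eq0 ?expf_neq0.
      apply: (mulIf xn); rewrite addr0 in e; rewrite -e exprS; field.
      by rewrite pi0 expf_neq0.
    by case: mpi => Vp []; split; rewrite -?aE.
  elim: n hn => [|n IH] hn; first by case: hn; rewrite expr0 divr1.
  case: (pselect (V (x / pi ^+ n))) => [hVn|/IH//].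
  exists n%:Z; case: (unit_or_mx hVn) => // /hpi h; case: hn.
  by rewrite exprS (_ : _ / _ = x / pi ^+ n / pi) //; field; rewrite pi0 expf_neq0.
have [a [b [Va Vb /is_unit_setT b0 zE]]] := FV _ Fz.
have a0 : a != 0 by apply: contraNneq z0 => a0; rewrite zE a0 mul0r.
have [[m hm] [n hn]] := (step _ Va a0, step _ Vb b0).
exists (m - n); rewrite expfzDr // -invr_expz.
have -> : z / (pi ^ m * (pi ^ n)^-1) = (a / pi ^ m) / (b / pi ^ n).
  by rewrite zE; field; rewrite b0 !expfz_neq0.
exact: (is_unit_div sV).
Qed.

Section DvrTheory.
Variables (V : set K) (pi : K).
Hypothesis hV : dvr V pi.
Let lV : local_ring V. Proof. by case: hV. Qed.
Let sV : subalg V. Proof. exact: local_sa lV. Qed.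
Let pi0 : pi != 0. Proof. by case: hV. Qed.
Let mpi : max_ideal V pi. Proof. by case: hV. Qed.

Lemma dvr_pin n : max_ideal V (pi ^+ n.+1).
Proof. by rewrite exprSr; apply: (mxM sV) => //; case: mpi => *; sa. Qed.

Lemma dvr_zunit (n : int) : is_unit V (pi ^ n) -> n = 0.
Proof.
case: n => [[//|n]|n] u; first by case: (dvr_pin n).
by have := is_unitV u; rewrite NegzE -exprnN invrK => u'; case: (dvr_pin n).
Qed.

Lemma dvr_mxE : max_ideal V = [set pi * a | a in V].
Proof.
apply/seteqP; split=> [x mx|_ [a Va <-]]; last by rewrite mulrC; apply: (mxM sV).
have [->|x0] := eqVneq x 0; first by exists 0; rewrite ?mulr0 //; sa.
have [_ _ _ /(_ x I x0) [n un]] := hV.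
have xE : x = (x / pi ^ n) * pi ^ n by rewrite divfK // expfz_neq0.
case: n un xE => [[|n]|n] un xE.
- by case: mx => _ []; rewrite expr0z divr1 in un.
- exists (x / pi ^+ n.+1 * pi ^+ n); first by case: un mpi => _ Vx _ [Vp _]; sa.
  by rewrite {2}xE -exprnP exprS; ring.
- case: mx => Vx []; rewrite NegzE -exprnN invrK in un xE; split=> //.
  have -> : x^-1 = (x * pi ^+ n.+1)^-1 * pi ^+ n.+1 by field; rewrite x0 expf_neq0.
  by have := is_unit_inV un; have := mx_in (dvr_pin n); move=> *; sa.
Qed.

(** [ord] picks some uniformizer by choice; two uniformizers differ by a unit, so the exponent does
    not depend on the choice. *)
Lemma ord_uniq u (n : int) : is_unit V u -> ord V (u * pi ^ n) = n.
Proof.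
move=> uu; apply: xget_unique; first by exists pi, u; split=> //; apply: dvr_mxE.
move=> n' [pi' [u' [p0' e' u'u eq]]].
have [a Va pE] : [set pi * a | a in V] pi'.
  by rewrite -dvr_mxE e'; exists 1; [sa | rewrite mulr1].
have [b Vb pE'] : [set pi' * a | a in V] pi.
  by rewrite -e' dvr_mxE; exists 1; [sa | rewrite mulr1].
have ab : a * b = 1 by apply: (mulfI pi0); rewrite mulrA pE pE' mulr1.
have a0 : a != 0 by apply/eqP=> a0; move: ab; rewrite a0 mul0r => /eqP; rewrite eq_sym oner_eq0.
have ua : is_unit V a.
  by split=> //; rewrite (_ : a^-1 = b) //; apply: (mulfI a0); rewrite ab divff.
have uz (k : int) : is_unit V (a ^ k).
  case: k => k; first by apply: (is_unitX k sV ua).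
  by rewrite NegzE -exprnN; apply: is_unitV; apply: (is_unitX k.+1 sV ua).
apply/eqP; rewrite eq_sym -subr_eq0; apply/eqP/dvr_zunit.
rewrite expfzDr // -invr_expz.
have -> : pi ^ n / pi ^ n' = u' * a ^ n' / u.
  have ui := is_unit_neq0 uu; apply: (mulfI ui); rewrite mulrA eq -pE exprzMl ?unitfE //.
  by field; rewrite ui expfz_neq0.
by apply: (is_unit_div sV) => //; apply: (is_unitM sV).
Qed.

Lemma dvr_ordP z : z != 0 -> is_unit V (z / pi ^ ord V z).
Proof.
move=> z0; have [_ _ _ /(_ z I z0) [n un]] := hV.
suff -> : ord V z = n by [].
by have := ord_uniq n un; rewrite divfK // expfz_neq0.
Qed.

Lemma dvr_decomp z : z != 0 -> exists2 u, is_unit V u & z = u * pi ^ ord V z.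
Proof. by move=> z0; exists (z / pi ^ ord V z); [apply: dvr_ordP | rewrite divfK // expfz_neq0]. Qed.

Lemma ordM y z : y != 0 -> z != 0 -> ord V (y * z) = ord V y + ord V z.
Proof.
move=> /dvr_decomp [u uu e] /dvr_decomp [v uv e'].
rewrite {1}e {1}e' mulrACA -expfzDr //; apply: ord_uniq; exact: (is_unitM sV).
Qed.
Lemma ord_unit u : is_unit V u -> ord V u = 0.
Proof. by move=> uu; rewrite -{1}[u]mulr1 -(expr0z pi); apply: ord_uniq. Qed.
Lemma ordX z n : z != 0 -> ord V (z ^+ n) = ord V z *+ n.
Proof.
move=> z0; elim: n => [|n IH]; first by rewrite ord_unit //; apply: (is_unit1 sV).
by rewrite exprS ordM ?expf_neq0 // IH mulrS.
Qed.
Lemma ordV z : z != 0 -> ord V z^-1 = - ord V z.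
Proof.
move=> z0; have zV : z^-1 != 0 by rewrite invr_eq0.
have := ordM zV z0; rewrite mulVf // (ord_unit (is_unit1 sV)) => e.
by apply/eqP; rewrite -addr_eq0 -e.
Qed.
Lemma ord_pi : ord V pi = 1.
Proof. by rewrite -{1}[pi]mul1r -{1}(expr1z pi); apply: ord_uniq; apply: (is_unit1 sV). Qed.
Lemma ord_ge0 z : z != 0 -> V z <-> 0 <= ord V z.
Proof.
move=> z0; have [u uu e] := dvr_decomp z0; have [Vp _] := mpi.
case: (ord V z) e => n e; split=> //.
  by move=> _; rewrite e -exprnP; case: uu => *; sa.
rewrite NegzE -exprnN in e => Vz; case: (dvr_pin n) => _ []; split.
- by rewrite expf_neq0.
- by sa.
- by rewrite (_ : _^-1 = u^-1 * z); [case: uu => *; sa | rewrite e mulKf // (is_unit_neq0 uu)].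
Qed.
Lemma dvr_total z : z != 0 -> V z \/ V z^-1.
Proof.
move=> z0; case: (lerP 0 (ord V z)) => h; first by left; apply/ord_ge0.
by right; apply/ord_ge0; rewrite ?invr_eq0 // ordV // oppr_ge0 ltW.
Qed.
(** A ring that contains an element of negative order contains the inverse of [pi], hence
    everything. This is the codimension-one property of discrete valuation rings. *)
Lemma dvr_over B : subalg B -> V `<=` B -> B = V \/ B = setT.
Proof.
move=> sB VB; case: (pselect (B `<=` V)) => [BV|nBV]; first by left; apply/seteqP.
right; have [z [Bz nVz]] : exists z, B z /\ ~ V z.
  by apply: contrapT => h; apply: nBV => z Bz; apply: contrapT => nz; apply: h; exists z.
have z0 : z != 0 by apply/eqP => z0; apply: nVz; rewrite z0; sa.
have [u uu e] := dvr_decomp z0; have [Vp _] := mpi.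
have Bpi : B pi^-1.
  case: (ord V z) e => n e.
    by case: nVz; rewrite e -exprnP; case: uu => *; sa.
  rewrite NegzE -exprnN in e.
  have -> : pi^-1 = pi ^+ n * (u^-1 * z).
    by rewrite e exprS; field; rewrite pi0 expf_neq0 // (is_unit_neq0 uu).
  have := VB _ (is_unit_inV uu); have := VB _ Vp; move=> *; sa.
apply/seteqP; split=> // x _; have [->|x0] := eqVneq x 0; first by sa.
have [v [_ Vv _] ->] := dvr_decomp x0; have Bv := VB _ Vv; have Bp := VB _ Vp.
by case: (ord V x) => n; rewrite ?NegzE -?exprnP -?exprnN -?exprVn; sa.
Qed.
End DvrTheory.

Lemma valuation_int_closed F V : subalg V -> (forall z, F z -> z != 0 -> V z \/ V z^-1) ->
  int_closed F V.
Proof.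
move=> sV tot z Fz [n [c [hc e]]]; have [->|z0] := eqVneq z 0; first by sa.
case: (tot z Fz z0) => // Vz.
case: n e => [|n] e; first by move/eqP: e; rewrite expr0 big_ord0 oner_eq0.
have -> : z = \sum_(i < n.+1) c i * z^-1 ^+ (n - i).
  apply: (mulIf (expf_neq0 n z0)); rewrite -exprS e mulr_suml; apply: eq_bigr => i _.
  rewrite -mulrA; congr (_ * _).
  transitivity (z^-1 ^+ (n - i) * (z ^+ (n - i) * z ^+ i)).
    by rewrite mulrA -exprMn mulVf // expr1n mul1r.
  by rewrite -exprD subnK // -ltnS.
by apply: (sa_sum sV) => i _; have := hc i; move=> *; sa.
Qed.

Lemma dvr_in_int_closed F V pi : dvr_in F V pi -> int_closed F V.
Proof.
move=> [lV pi0 [Vp _] h]; have sV := local_sa lV.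
apply: valuation_int_closed => // z Fz z0; have [n un] := h z Fz z0.
case: n un => n; rewrite ?NegzE -?exprnP -?exprnN ?invrK => un.
  left; have -> : z = z / pi ^+ n * pi ^+ n by rewrite divfK // expf_neq0.
  by have := is_unit_in un; move=> *; sa.
right; have -> : z^-1 = (z * pi ^+ n.+1)^-1 * pi ^+ n.+1 by field; rewrite z0 expf_neq0.
by have := is_unit_inV un; move=> *; sa.
Qed.

(* Among the denominator ideals (A : c z), c in A, that avoid M, a maximal one is
   prime, and normality makes its localization a discrete valuation ring. *)
Theorem exists_dvr A z M : subalg A -> noeth A -> int_closed setT A ->
  setT `<=` locin A setT -> M `<=` A -> M 1 -> (forall x y, M x -> M y -> M (x * y)) ->
  ~ (exists a b, [/\ A a, M b, b != 0 & z = a / b]) ->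
  exists P pi, [/\ prime_ideal A P, forall b, M b -> b != 0 -> ~ P b,
    dvr (localization A P) pi & ~ localization A P z].
Proof.
move=> sA nA cA fA MA M1 MM nz.
pose J c := [set b | A b /\ A (b * (c * z))].
have hJ c : ideal A (J c).
  split; first by move=> b [].
  - by split; rewrite ?mul0r; sa.
  - by move=> x y [Ax hx] [Ay hy]; split; rewrite ?mulrDl; sa.
  - by move=> a x Aa [Ax hx]; split; [|rewrite -mulrA]; sa.
pose Q c := A c /\ forall b, M b -> b != 0 -> ~ J c b.
have Q1 : Q 1.
  split=> [|b Mb b0 [_ hb]]; first by sa.
  apply: nz; exists (b * (1 * z)), b; split=> //.
  by fld.
have [c [Ac Qc] cmax] := noeth_max sA nA hJ Q1.
have Jmul a b : A a -> J c (a * b) -> A b -> J (c * a) b.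
  by move=> Aa [_ h] Ab; split=> //; rewrite (_ : b * _ = a * b * (c * z)) //; ring.
have Jle a : A a -> J c `<=` J (c * a).
  by move=> Aa b [Ab h]; split=> //; rewrite (_ : b * _ = a * (b * (c * z))); [sa | ring].
(* By maximality [J c] is saturated with respect to [M], which lets the product argument for
   primality stay among ideals avoiding [M]. *)
have Junit m b : M m -> m != 0 -> A b -> J c (m * b) -> J c b.
  move=> Mm m0 Ab h; apply: (cmax (c * m)).
  - have Am := MA _ Mm; split=> [|d Md d0 [Ad hd]]; first by sa.
    apply: (Qc (d * m)); [exact: MM | by rewrite mulf_neq0 | split; first by sa].
    by rewrite (_ : _ * _ = d * (c * m * z)) //; ring.
  - by apply: Jle; apply: MA.
  - exact: Jmul (MA _ Mm) h Ab.
have z0' : c * z != 0.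
  apply/eqP => e; apply: (Qc 1 M1 (oner_neq0 _)); split; rewrite ?e ?mulr0; sa.
have pJ : prime_ideal A (J c).
  split.
  - by split=> [b []//|]; split; rewrite ?mul0r; sa.
  - by case: (hJ c).
  - by case: (hJ c).
  - exact: (Qc 1 M1 (oner_neq0 _)).
  - move=> a b Aa Ab hab; case: (pselect (J c a)) => [|na]; first by left.
    right; apply: (cmax (c * a)).
    + split=> [|m Mm m0 [Am hm]]; first by sa.
      apply: na; apply: (Junit m) => //; split; first by sa.
      by rewrite (_ : _ * _ = m * (c * a * z)) //; ring.
    + exact: Jle.
    + exact: Jmul hab Ab.
have [hV hm] := prime_loc sA pJ; set V := localization A (J c) in hV hm *.
have [_ lV AV VA] := hV; have sV := local_sa lV.
have [a [Ja a0]] : exists a, J c a /\ a != 0.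
  have [a [b [Aa Ab /is_unit_setT b0 e]]] := fA (c * z) I.
  exists b; split=> //; split=> //; by rewrite e mulrC divfK.
(* Otherwise multiplication by [c * z] preserves [J c], so [c * z] is integral and lies in [A],
   putting 1 in [J c]. For the [b] found here [b * (c * z)] is a unit of the localization, and [b]
   is a uniformizer. *)
have [b [Jb nb]] : exists b, J c b /\ ~ J c (b * (c * z)).
  apply: contrapT => h.
  have {}h x : J c x -> J c (x * (c * z)).
    by move=> Jx; apply: contrapT => hh; apply: h; exists x.
  have hi n : J c (a * (c * z) ^+ n).
    elim: n => [|n IH]; first by rewrite expr0 mulr1.
    by rewrite exprSr mulrA; apply: h.
  apply: (Qc 1 M1 (oner_neq0 _)); split; first by sa.
  rewrite mul1r; apply: cA => //; apply: (noeth_integral sA nA a0) => n.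
  by case: (hi n).
have [Ab Abz] := Jb.
have b0 : b != 0.
  by apply/eqP => e; apply: nb; rewrite e mul0r; split; rewrite ?mul0r; sa.
have ub : is_unit V (b * (c * z)).
  by case: (unit_or_mx (AV _ Abz)) => // /(proj1 (hm _ Abz)).
have hdiv x : max_ideal V x -> V (x / b).
  move=> mx; have [d [e [Ad Ae ue xE]]] := VA _ (mx_in mx).
  have e0 := is_unit_neq0 ue.
  have : J c d.
    apply/hm => //; have -> : d = e * x by rewrite xE mulrC divfK.
    by apply: (mxM sV) => //; apply: AV.
  move=> [_ Adz].
  have -> : x / b = (d * (c * z)) * e^-1 * (b * (c * z))^-1.
    have /andP[c0 zz0] : (c != 0) && (z != 0) by move: z0'; rewrite mulf_eq0 negb_or.
    by rewrite xE; fld.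
  have := AV _ Adz; have := is_unit_inV ue; have := is_unit_inV ub; move=> *; sa.
exists (J c), b; split=> //.
- apply: dvr_of => //; first exact: (noeth_loc hV nA).
    move=> x /fA [d [e [Ad Ae ue ->]]]; exists d, e; split=> //; exact: AV.
  exact/hm.
- move=> /VA [d [e [Ad Ae ue zE]]]; have Vz : J c e.
    by split=> //; rewrite zE (_ : _ * _ = c * d); [sa | field; case: ue].
  by have [_ []] : max_ideal V e by apply/hm.
Qed.

(** [exists_dvr] with only 1 as denominator gives a discrete valuation ring above [O] that misses a
    chosen element of [K]; the codimension hypothesis leaves no room for it except [O]. *)
Lemma prime_divisor_dvr A O : is_loc A O -> noeth A -> int_closed setT O ->
  setT `<=` locin O setT -> O <> setT ->
  (forall O', is_loc A O' -> O `<=` O' -> O' = O \/ O' = setT) -> exists pi, dvr O pi.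
Proof.
move=> hO nA cO fO nT hmin; have [sA lO AO OA] := hO; have sO := local_sa lO.
have [z nz] : exists z, ~ O z.
  apply: contrapT => h; apply: nT; apply/seteqP; split=> // z _.
  by apply: contrapT => nz; apply: h; exists z.
have [||x y -> ->||P [pi [pP _ dP nP]]] := @exists_dvr O z [set 1] sO (noeth_loc hO nA) cO fO.
- by move=> _ ->; sa.
- by [].
- by rewrite mulr1.
- by move=> [a [_ [Oa -> _ e]]]; apply: nz; rewrite e divr1.
have [hP _] := prime_loc sO pP.
have [_ lP OP PO] := hP.
case: (hmin (localization O P)) => [||<-|e]; [|exact: OP|by exists pi|by case: nP; rewrite e].
split=> //; first by apply: subset_trans OP.
move=> x /PO [a [b [Oa Ob ub ->]]].
have hh c : O c -> locin A (localization O P) c.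
  move=> /OA [d [e [Ad Ae ue ->]]]; exists d, e; split=> //; exact: is_unit_mono ue.
have sP := local_sa lP; have AP := subset_trans AO OP.
have [_ _ hb] := locin_unit sA sP AP (hh _ Ob) ub.
have := hh _ Oa; have := locin_sa sA sP; move=> *; sa.
Qed.

(** Interpolation at distinct constants, whose differences are invertible in [A]: dividing by X - c
    0 gives a shorter quotient with values in [A] at the remaining nodes. *)
Lemma polyin_interp A p (c : nat -> R[i]) : subalg A -> injective c ->
  (forall i, A p.[iota (c i)]) -> polyin A p.
Proof.
move=> sA; move: {2}(size p) (leqnn (size p)) => n.
elim: n p c => [|n IH] p c sp ic hp.
  by move: sp; rewrite leqn0 size_poly_eq0 => /eqP-> i; rewrite coef0; sa.
have [q pE] : exists q, p = q * ('X - (iota (c 0%N))%:P) + p.[iota (c 0%N)]%:P.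
  have /factor_theorem [q e] : root (p - p.[iota (c 0%N)]%:P) (iota (c 0%N)).
    by apply/rootP; rewrite !hornerE subrr.
  by exists q; rewrite -e subrK.
have hq : polyin A q.
  apply: (IH q (c \o S)).
  - have [->|q0] := eqVneq q 0; first by rewrite size_poly0.
    have : (size (q * ('X - (iota (c 0%N))%:P))%R <= n.+1)%N.
      rewrite -(addrK (p.[iota (c 0%N)]%:P) (_ * _)) -pE.
      apply: leq_trans (size_polyD _ _) _; rewrite geq_max sp size_polyN.
      by apply: leq_trans (size_polyC_leq1 _) _.
    by rewrite size_Mmonic ?monicXsubC // size_XsubC addn2.
  - by move=> i j /ic [].
  - move=> i; have := hp i.+1; rewrite {1}pE !hornerE /=.
    set d := iota (c i.+1) - iota (c 0%N) => h.
    have d0 : c i.+1 - c 0%N != 0 by rewrite subr_eq0; apply/eqP => /ic.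
    have dE : d = iota (c i.+1 - c 0%N) by rewrite rmorphB.
    have -> : q.[iota (c i.+1)] = (q.[iota (c i.+1)] * d + p.[iota (c 0%N)] - p.[iota (c 0%N)]) * iota (c i.+1 - c 0%N)^-1.
      by rewrite addrK fmorphV -dE mulfK // dE fmorph_eq0.
    by have := hp 0%N; move=> *; sa.
rewrite pE; apply: (polyinD sA); last exact: (polyinC sA).
apply: (polyinM sA) => //; apply: (polyinB sA); [exact: (polyinX sA)|apply: (polyinC sA); sa].
Qed.

End Valuations.

(** * Polynomial extensions *)

Section PolynomialExtensions.
Variables (R : realType) (K : fieldType) (iota : {rmorphism R[i] -> K}).
Local Notation subalg := (subalgebra iota).
Local Notation local_ring := (local_ring iota).
Local Notation is_loc := (is_loc iota).
Local Notation subfield := (subfield iota).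
Local Notation noeth := (@noeth K).
Implicit Types (A B O V F I P M G : set K) (x y z a b u pi : K) (p q : {poly K}).

(** Quotient and remainder must keep coefficients in [F], since the minimality arguments below range
    over polynomials with such coefficients. *)
Lemma sf_polydiv F (h g : {poly K}) : subfield F -> polyin F h -> polyin F g -> g != 0 ->
  exists e r : {poly K}, [/\ polyin F e, polyin F r, h = e * g + r & (size r < size g)%N].
Proof.
move=> sF hF gF g0; have sFa := subfield_sa sF.
move: {2}(size h) (leqnn (size h)) => n; elim: n h hF => [|n IH] h hF sh.
  exists 0, h; split; rewrite ?mul0r ?add0r //; first by move=> i; rewrite coef0; sa.
  by apply: leq_ltn_trans sh _; rewrite size_poly_gt0.
case: (ltnP (size h) (size g)) => hg.
  by exists 0, h; split; rewrite ?mul0r ?add0r // => i; rewrite coef0; sa.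
set c := lead_coef h / lead_coef g; set k := (size h - size g)%N.
have Fc : F c by apply: (sf_div sF); [exact: hF | exact: gF].
have cF : polyin F (c%:P * 'X^k).
  by apply: (polyinM sFa); [apply: (polyinC sFa) | apply: (polyinXn _ sFa); apply: (polyinX sFa)].
have [|| e [r [eF rF hE sr]]] := IH (h - c%:P * 'X^k * g).
- by apply: (polyinB sFa) => //; apply: (polyinM sFa).
- have g0' : (0 < size g)%N by rewrite size_poly_gt0.
  have le1 : (size (c%:P * 'X^k * g)%R <= size h)%N.
    rewrite -mulrA mul_polyC mulrC; apply: leq_trans (size_scale_leq _ _) _.
    by rewrite size_mulXn // /k subnK.
  have : (size (h - c%:P * 'X^k * g)%R <= (size h).-1)%N.
    have h0 : (0 < size h)%N := leq_trans g0' hg.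
    apply/leq_sizeP => j; rewrite leq_eqVlt => /orP[/eqP<-|hj].
      rewrite coefB -mulrA coefCM coefXnM ifF; last by rewrite /k; lia.
      have -> : ((size h).-1 - k = (size g).-1)%N by rewrite /k; lia.
      by rewrite -!lead_coefE /c divfK ?subrr // lead_coef_eq0.
    have hj' : (size h <= j)%N by rewrite -(ltn_predK h0).
    by rewrite coefB !nth_default ?subrr // (leq_trans le1).
  by move: sh; lia.
exists (e + c%:P * 'X^k), r; split=> //; first exact: (polyinD sFa).
by rewrite mulrDl addrAC -hE subrK.
Qed.

(** Take the shortest [g] such that g(u) clears the denominators of all powers of [z]. Dividing g(u)
    z by g(u) leaves a remainder with the same property, hence of value zero, and [z] is the
    quotient. *)
Lemma sf_adj_int_closed F u : subfield F ->
  int_closed (locin (adj F u) setT) (adj F u).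
Proof.
move=> sF z [a [q [Fa Fq /is_unit_setT q0 zE]]] [n [c [hc e]]].
have sFa := subfield_sa sF; have sA := adj_sa u sFa.
(* The n-th power of the denominator clears every power of [z]: directly below [n], through the
   integral equation from [n] on. *)
have hb i : adj F u (q ^+ n * z ^+ i).
  move: {2}i.+1 (ltnSn i) => m; elim: m i => [//|m IH] i; rewrite ltnS => im.
  case: (ltnP i n) => hi.
    have -> : q ^+ n * z ^+ i = q ^+ (n - i) * a ^+ i.
      rewrite -{1}(subnK (ltnW hi)) exprD -mulrA -exprMn; congr (_ * _ ^+ _).
      by rewrite zE mulrC divfK.
    by sa.
  have -> : z ^+ i = z ^+ (i - n) * z ^+ n by rewrite -exprD subnK.
  rewrite e mulrA mulr_sumr; apply: (sa_sum sA) => j _.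
  rewrite (_ : _ * _ = c j * (q ^+ n * z ^+ (i - n + j))); last by rewrite exprD; ring.
  have Aqz : adj F u (q ^+ n * z ^+ (i - n + j)) by apply: IH; have := ltn_ord j; lia.
  by have := hc j; move=> *; sa.
pose J (g : {poly K}) := [/\ polyin F g, g.[u] != 0 & forall i, adj F u (g.[u] * z ^+ i)].
have ex : exists m, `[< exists2 g, J g & size g = m >].
  have [p hp pE] : adj F u (q ^+ n) by sa.
  by exists (size p); apply/asboolP; exists p => //; split=> // [|i]; rewrite pE ?expf_neq0.
case: (ex_minnP ex) => m /asboolP [g [gF g0 gz] <-] gmin.
have [h hF hE] := gz 1%N; rewrite expr1 in hE.
have gn0 : g != 0 by apply: contraNneq g0 => ->; rewrite horner0.
have [d [r [dF rF hdr sr]]] := sf_polydiv sF hF gF gn0.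
have rE : r.[u] = g.[u] * (z - d.[u]).
  have := congr1 (horner^~ u) hdr; rewrite !hornerE hE => eg.
  by rewrite mulrBr eg; ring.
have r0 : r.[u] = 0.
  apply/eqP/negPn/negP => r0; have : (size g <= size r)%N; last by rewrite leqNgt sr.
  apply: gmin; apply/asboolP; exists r => //; split=> // i; rewrite rE.
  have -> : g.[u] * (z - d.[u]) * z ^+ i = g.[u] * z ^+ i.+1 - d.[u] * (g.[u] * z ^+ i).
    by rewrite exprS; ring.
  have := gz i; have := gz i.+1; have : adj F u d.[u] by exists d.
  by move=> *; sa.
exists d => //; apply/esym/eqP; rewrite -subr_eq0.
by move: rE; rewrite r0 => /esym/eqP; rewrite mulf_eq0 (negPf g0).
Qed.

(** Over the field [F] the element is a polynomial value p(u). Specializing its integral equation at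
    the integers shows that [p] takes values in [A] there, and interpolation puts its coefficients
    in [A]. *)
Theorem adj_int_closed F A u : subfield F -> subalg A -> A `<=` F -> int_closed F A ->
  transcendental_over F u -> int_closed (locin (adj F u) setT) (adj A u).
Proof.
move=> sF sA AF cA tu z Fz iz; have sFa := subfield_sa sF.
have AFu : adj A u `<=` adj F u.
  by move=> _ [p hp <-]; exists p => //; apply: polyin_mono hp.
have [p hp pE] := sf_adj_int_closed sF Fz (integral_mono AFu iz).
exists p => //; have [n [c [hc e]]] := iz.
have {}hc (j : nat) : exists a : {poly K}, polyin A a /\ a.[u] = c j by case: (hc j) => a; exists a.
have [a ha] := choice hc.
(* Transcendence of [u] lifts the equation from values to polynomials, after which [u] may be
   replaced by any constant. *)
have aP : p ^+ n = \sum_(j < n) a j * p ^+ j.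
  apply/eqP; rewrite -subr_eq0; apply/eqP/tu.
    apply: (polyinB sFa); first exact: (polyinXn _ sFa).
    apply: (polyin_sum _ sFa) => j; apply: (polyinM sFa); last exact: (polyinXn _ sFa).
    by apply: polyin_mono AF _; case: (ha j).
  apply/rootP; rewrite hornerD hornerN horner_exp pE e horner_sum.
  rewrite -sumrB big1 // => j _; rewrite hornerM horner_exp pE.
  by case: (ha j) => _ ->; rewrite subrr.
apply: (@polyin_interp _ _ iota A p (fun k => k%:R) sA).
  by move=> i j /eqP; rewrite eqr_nat => /eqP.
move=> k; apply: cA.
  by apply: (polyin_horner sFa) hp => //; sa.
exists n, (fun j => (a j).[iota k%:R]); split.
  by move=> j; case: (ha j) => h _; apply: (polyin_horner sA) h => //; sa.
rewrite -horner_exp aP !horner_sum; apply: eq_bigr => j _.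
by rewrite hornerM horner_exp.
Qed.

(** If [z] were outside [A], a maximal proper ideal of denominators (A : cz) would be prime, and [z]
    would have a denominator outside it. *)
Lemma noeth_local_global A z : subalg A -> noeth A ->
  (forall V, is_loc A V -> V z) -> A z.
Proof.
move=> sA nA h; pose J c := [set b | A b /\ A (b * (c * z))].
have hJ c : ideal A (J c).
  split; first by move=> b [].
  - by split; rewrite ?mul0r; sa.
  - by move=> x y [Ax hx] [Ay hy]; split; rewrite ?mulrDl; sa.
  - by move=> a x Aa [Ax hx]; split; [|rewrite -mulrA]; sa.
apply: contrapT => nz.
have Q1 : A 1 /\ ~ J 1 1 by split; [sa | move=> [_]; rewrite !mul1r].
have [c [Ac Qc] cmax] := noeth_max (Q := fun c => A c /\ ~ J c 1) sA nA hJ Q1.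
have [hV hm] : is_loc A (localization A (J c)) /\
    forall a, A a -> (max_ideal (localization A (J c)) a <-> J c a).
  apply: prime_loc => //; split=> //.
  - by split=> [b []//|]; split; rewrite ?mul0r; sa.
  - by case: (hJ c).
  - by case: (hJ c).
  - move=> a b Aa Ab [_ hab]; case: (pselect (J c a)) => [|na]; first by left.
    right; apply: (cmax (c * a)); last first.
    + by split=> //; rewrite (_ : b * _ = a * b * (c * z)) //; ring.
    + by move=> x [Ax hx]; split=> //; rewrite (_ : x * _ = a * (x * (c * z))); [sa | ring].
    split=> [|[_ h1]]; first by sa.
    by apply: na; split=> //; rewrite (_ : a * _ = 1 * (c * a * z)) //; ring.
have [_ lV AV VA] := hV.
have [d [e [Ad Ae ue zE]]] := VA _ (h _ hV).
have Je : J c e by split=> //; rewrite zE (_ : _ * _ = c * d); [sa | field; case: ue].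
by have [_ []] : max_ideal (localization A (J c)) e by apply/hm.
Qed.

Lemma transc_scale F x g : subfield F -> transcendental_over F x -> F g -> g != 0 ->
  transcendental_over F (g * x).
Proof.
move=> sF tx Fg g0 p pF /rootP rp; have sFa := subfield_sa sF.
suff : p \Po (g *: 'X) = 0.
  have gX : g%:P * 'X = g *: 'X :> {poly K} by rewrite mul_polyC.
  move/(congr1 (fun q => q \Po (g^-1 *: 'X))); rewrite comp_poly0 -comp_polyA.
  rewrite linearZ /= comp_polyX scalerA divff // scale1r comp_polyXr.
  by [].
apply: tx; last by apply/rootP; rewrite horner_comp !hornerE.
move=> i; rewrite coef_comp_poly; apply: (sa_sum sFa) => j _.
have := pF j; rewrite exprZn coefZ coefXn; case: eqP => _ *; sa.
Qed.

(** Reversing the coefficients of a relation for the inverse gives a relation for [x]. *)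
Lemma transc_inv F x : subalg F -> transcendental_over F x -> transcendental_over F x^-1.
Proof.
move=> sF tx p pF /rootP rp.
have x0 : x != 0.
  apply/eqP => x0; have /eqP : ('X : {poly K}) = 0.
    by apply: (tx _ (polyinX sF)); apply/rootP; rewrite hornerX.
  by rewrite polyX_eq0.
pose q := \poly_(i < size p) p`_(size p - i.+1).
have qE : q = 0.
  apply: tx; first by move=> i; rewrite coef_poly; case: ifP => _; [exact: pF|sa].
  apply/rootP; rewrite horner_poly (reindex_inj rev_ord_inj) /=.
  transitivity (p.[x^-1] * x ^+ (size p).-1); last by rewrite rp mul0r.
  rewrite horner_coef mulr_suml; apply: eq_bigr => i _.
  have e1 (k m : nat) : (m < k)%N -> (k - (k - m.+1).+1 = m)%N by lia.
  have e2 (k m : nat) : (m < k)%N -> (k.-1 = k - m.+1 + m)%N by lia.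
  rewrite e1 ?ltn_ord // (e2 _ _ (ltn_ord i)).
  by rewrite exprD exprVn; field; rewrite expf_neq0.
apply/eqP; rewrite -size_poly_eq0 -leqn0 leqNgt; apply/negP => sp.
have : q`_0 = lead_coef p by rewrite coef_poly sp lead_coefE subn1.
by rewrite qE coef0 => /esym/eqP; rewrite lead_coef_eq0 -size_poly_eq0 eqn0Ngt sp.
Qed.

End PolynomialExtensions.

(** * Derivations *)

Section Derivations.
Variables (R : realType) (K : fieldType) (iota : {rmorphism R[i] -> K}).
Local Notation subalg := (subalgebra iota).
Local Notation local_ring := (local_ring iota).
Local Notation is_loc := (is_loc iota).
Local Notation subfield := (subfield iota).
Local Notation noeth := (@noeth K).
Implicit Types (A B O V F I P M G : set K) (x y z a b u v pi : K) (p q : {poly K}).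
Implicit Types (D : K -> K).

(** [D] is a total function constrained only on [F], so extending a derivation does not change its
    type. *)
Definition der_on F D : Prop :=
  [/\ forall c, D (iota c) = 0,
      forall x y, F x -> F y -> D (x + y) = D x + D y
    & forall x y, F x -> F y -> D (x * y) = x * D y + y * D x].

Lemma der_onT D : derivation iota D <-> der_on setT D.
Proof. by split=> -[h1 h2 h3]; split=> // *; [apply: h2 | apply: h3]. Qed.
Lemma der_on_mono F B D : F `<=` B -> der_on B D -> der_on F D.
Proof. by move=> FB [h1 h2 h3]; split=> // *; [apply: h2 | apply: h3]; apply: FB. Qed.

Section OneDerivation.
Variables (F : set K) (D : K -> K).
Hypotheses (sF : subfield F) (dD : der_on F D).
Let sFa : subalg F := subfield_sa sF.
Let D0 : D 0 = 0. Proof. by case: dD => h _ _; have := h 0; rewrite rmorph0. Qed.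
Let D1 : D 1 = 0. Proof. by case: dD => h _ _; rewrite -(rmorph1 iota) h. Qed.
Let DD x y : F x -> F y -> D (x + y) = D x + D y. Proof. by case: dD => _ h _; apply: h. Qed.
Let DM x y : F x -> F y -> D (x * y) = x * D y + y * D x. Proof. by case: dD => _ _; apply. Qed.

Lemma der_onN x : F x -> D (- x) = - D x.
Proof.
move=> Fx; apply/eqP; rewrite -addr_eq0 -DD ?addNr ?D0 //; sa.
Qed.
Lemma der_onB x y : F x -> F y -> D (x - y) = D x - D y.
Proof. by move=> Fx Fy; rewrite DD ?der_onN //; sa. Qed.
Lemma der_onV x : F x -> D x^-1 = - D x / x ^+ 2.
Proof.
move=> Fx; have [->|x0] := eqVneq x 0; first by rewrite invr0 D0 oppr0 mul0r.
have Fx' : F x^-1 by apply: (sfV sF).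
have := DM Fx Fx'; rewrite divff // D1 => e; apply: (mulfI x0).
have -> : x * D x^-1 = - (x^-1 * D x).
  by apply/eqP; rewrite -addr_eq0 -e.
by field.
Qed.
Lemma der_on_div x y : F x -> F y -> y != 0 -> D (x / y) = (D x * y - x * D y) / y ^+ 2.
Proof.
move=> Fx Fy y0; rewrite DM ?der_onV //; last by apply: (sfV sF).
by field.
Qed.
Lemma der_onX x n : F x -> D (x ^+ n.+1) = n.+1%:R * x ^+ n * D x.
Proof.
move=> Fx; elim: n => [|n IH]; first by rewrite expr1 expr0 !mul1r.
rewrite exprS DM // ?IH; last by sa.
by rewrite exprS -[n.+2%:R]natr1; ring.
Qed.
Lemma der_on_sum n (f : 'I_n -> K) : (forall i, F (f i)) -> D (\sum_i f i) = \sum_i D (f i).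
Proof.
elim: n f => [|n IH] f hf; first by rewrite !big_ord0.
rewrite !big_ord_recr DD ?IH //; apply: (sa_sum sFa) => i _; exact: hf.
Qed.
Lemma der_iotaM c x : F x -> D (iota c * x) = iota c * D x.
Proof. by move=> Fx; rewrite DM //; [case: dD => -> *; rewrite mulr0 addr0 | sa]. Qed.

Let dp p := map_poly D p.
Let coef_dp p i : (dp p)`_i = D p`_i. Proof. exact: coef_map_id0. Qed.

Variables (x v : K).
(** The value at p(x) forced on an extension of [D] sending [x] to [v]. By additivity, [compat] says
    that it depends on p(x) alone. *)
Let E p := (dp p).[x] + p^`().[x] * v.
Hypothesis compat : forall p, polyin F p -> p.[x] = 0 -> E p = 0.

Let EB p q : polyin F p -> polyin F q -> E (p - q) = E p - E q.
Proof.
move=> hp hq; have -> : E (p - q) = (dp (p - q)).[x] + (p^`() - q^`()).[x] * v by rewrite -derivB.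
have -> : dp (p - q) = dp p - dp q.
  by apply/polyP => i; rewrite coefB !coef_dp coefB der_onB.
by rewrite /E !(hornerD, hornerN, hornerM); ring.
Qed.
Let ED p q : polyin F p -> polyin F q -> E (p + q) = E p + E q.
Proof.
move=> hp hq; rewrite /E derivD.
have -> : dp (p + q) = dp p + dp q.
  by apply/polyP => i; rewrite coefD !coef_dp coefD DD.
by rewrite !(hornerD, hornerN, hornerM); ring.
Qed.
Let EM p q : polyin F p -> polyin F q -> E (p * q) = p.[x] * E q + q.[x] * E p.
Proof.
move=> hp hq; rewrite /E derivM.
have -> : dp (p * q) = p * dp q + dp p * q.
  apply/polyP => i; rewrite coefD !coef_dp !coefM der_on_sum; last by move=> j; have := hp j; have := hq (i - j)%N; move=> *; sa.
  rewrite -big_split; apply: eq_bigr => j _ /=; rewrite !coef_dp DM //; ring.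
by rewrite !(hornerD, hornerN, hornerM); ring.
Qed.
Let EC a : E a%:P = D a.
Proof.
rewrite /E derivC horner0 mul0r addr0; have -> : dp a%:P = (D a)%:P; last by rewrite hornerC.
by apply/polyP => i; rewrite coef_dp !coefC; case: eqP.
Qed.
Let EX : E 'X = v.
Proof.
rewrite /E derivX hornerC mul1r; have -> : dp 'X = 0; last by rewrite horner0 add0r.
by apply/polyP => i; rewrite coef_dp coefX coef0; case: eqP; rewrite ?D0 ?D1.
Qed.

Lemma der_adjoin : exists D', [/\ der_on (locin (adj F x) setT) D',
  forall z, F z -> D' z = D z & D' x = v].
Proof.
pose good z (pq : {poly K} * {poly K}) :=
  [/\ polyin F pq.1, polyin F pq.2, pq.2.[x] != 0 & z = pq.1.[x] / pq.2.[x]].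
have ex z : exists pq, locin (adj F x) setT z -> good z pq.
  case: (pselect (locin (adj F x) setT z)) => [[a [b [[p hp pE] [q hq qE] /is_unit_setT b0 e]]]|h].
    by exists (p, q) => _; split; rewrite //= ?qE ?pE.
  by exists (0, 0).
have [f hf] := choice ex.
pose val (pq : {poly K} * {poly K}) :=
  (E pq.1 * pq.2.[x] - pq.1.[x] * E pq.2) / pq.2.[x] ^+ 2.
pose D' z := val (f z).
have gin z pq : good z pq -> locin (adj F x) setT z.
  move=> [hp hq q0 e]; exists pq.1.[x], pq.2.[x]; split; rewrite ?is_unit_setT //.
    by exists pq.1.
  by exists pq.2.
have valE z pq : good z pq -> D' z = val pq.
  move=> g; have [hp hq q0 e] := g; have [hp1 hq1 q10 e1] := hf _ (gin _ _ g).
  rewrite /D' /val; set p1 := (f z).1 in hp1 e1 *; set q1 := (f z).2 in hq1 q10 e1 *.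
  set p := pq.1 in hp e *; set q := pq.2 in hq q0 e *.
  have cross : p.[x] = p1.[x] * q.[x] / q1.[x].
    have := congr1 (fun t => t * q.[x]) e; rewrite /= divfK // => <-.
    by rewrite e1; field.
  have h0 : (p * q1 - p1 * q).[x] = 0 by rewrite !(hornerD, hornerN, hornerM) cross; field.
  (* Two fractions for the same element give a polynomial relation by cross-multiplication; [compat]
     then makes the quotient rule independent of the fraction. *)
  have := compat (polyinB sFa (polyinM sFa hp hq1) (polyinM sFa hp1 hq)) h0.
  rewrite EB; [|exact: (polyinM sFa)|exact: (polyinM sFa)].
  rewrite !EM // => eq0.
  have EpE : E p = (p1.[x] * E q + q.[x] * E p1 - p.[x] * E q1) / q1.[x].
    by apply: (mulIf q10); rewrite divfK //; apply/eqP; rewrite -subr_eq0; apply/eqP; rewrite -eq0; ring.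
  rewrite EpE cross; field; by rewrite q0 q10.
have goodF z : F z -> good z (z%:P, 1).
  move=> Fz; split; rewrite /= ?hornerC ?divr1 ?oner_neq0 //.
    exact: (polyinC sFa).
  by apply: (polyinC sFa); sa.
have goodX : good x ('X, 1).
  split; rewrite /= ?hornerC ?hornerX ?divr1 ?oner_neq0 //; first exact: (polyinX sFa).
  by apply: (polyinC sFa); sa.
have val1 p : val (p, 1) = E p.
  by rewrite /val /= !hornerC EC D1; field; rewrite oner_eq0.
have D'F z : F z -> D' z = D z by move=> Fz; rewrite (valE _ _ (goodF z Fz)) val1 EC.
exists D'; split=> //; last by rewrite (valE _ _ goodX) val1 EX.
split; first by move=> a; rewrite D'F; [case: dD | sa].
- move=> y z hy hz; have [hp hq q0 e] := hf _ hy; have [hp1 hq1 q10 e1] := hf _ hz.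
  rewrite /D'; set p := (f y).1 in hp e *; set q := (f y).2 in hq q0 e *.
  set p1 := (f z).1 in hp1 e1 *; set q1 := (f z).2 in hq1 q10 e1 *.
  have g : good (y + z) (p * q1 + p1 * q, q * q1).
    split; rewrite /= ?(hornerD, hornerM); [|exact: (polyinM sFa)|by rewrite mulf_neq0|].
      by apply: (polyinD sFa); apply: (polyinM sFa).
    by rewrite {1}e {1}e1; field; rewrite q0 q10.
  rewrite -/(D' (y + z)) (valE _ _ g) /val /= -/p -/q -/p1 -/q1.
  rewrite ED; [|exact: (polyinM sFa)|exact: (polyinM sFa)].
  by rewrite !EM // !(hornerD, hornerN, hornerM); field; rewrite q0 q10.
- move=> y z hy hz; have [hp hq q0 e] := hf _ hy; have [hp1 hq1 q10 e1] := hf _ hz.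
  rewrite /D'; set p := (f y).1 in hp e *; set q := (f y).2 in hq q0 e *.
  set p1 := (f z).1 in hp1 e1 *; set q1 := (f z).2 in hq1 q10 e1 *.
  have g : good (y * z) (p * p1, q * q1).
    split; rewrite /= ?(hornerD, hornerM); [exact: (polyinM sFa)|exact: (polyinM sFa)|by rewrite mulf_neq0|].
    by rewrite {1}e {1}e1; field; rewrite q0 q10.
  rewrite -/(D' (y * z)) (valE _ _ g) /val /= -/p -/q -/p1 -/q1.
  by rewrite !EM // !(hornerD, hornerN, hornerM) e e1; field; rewrite q0 q10.
Qed.

End OneDerivation.

Lemma der_adjoin_transc F D x v : subfield F -> der_on F D -> transcendental_over F x ->
  exists D', [/\ der_on (locin (adj F x) setT) D', forall z, F z -> D' z = D z & D' x = v].
Proof.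
move=> sF dD tx; apply: der_adjoin => // p pF /rootP px.
by rewrite (tx p pF px) deriv0 map_poly0 !horner0 mul0r addr0.
Qed.

(** For algebraic [x], characteristic zero makes the derivative of a minimal polynomial nonzero at
    [x], and the image of [x] is forced by differentiating that polynomial. *)
Lemma der_adjoin_any F D x : subfield F -> der_on F D ->
  exists2 D', der_on (locin (adj F x) setT) D' & forall z, F z -> D' z = D z.
Proof.
move=> sF dD; have sFa := subfield_sa sF.
case: (pselect (transcendental_over F x)) => [tx|ntx].
  by have [D' [h1 h2 _]] := der_adjoin_transc 0 sF dD tx; exists D'.
have ex : exists m, `[< exists p, [/\ polyin F p, p.[x] = 0, p != 0 & size p = m] >].
  apply: contrapT => h; apply: ntx => p pF /rootP px; apply/eqP/negPn/negP => p0.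
  by apply: h; exists (size p); apply/asboolP; exists p.
case: (ex_minnP ex) => m /asboolP [p [pF px p0 <-]] pmin.
have minP q : polyin F q -> q.[x] = 0 -> (size q < size p)%N -> q = 0.
  move=> qF qx sq; apply/eqP/negPn/negP => q0.
  by move: sq; rewrite ltnNge pmin //; apply/asboolP; exists q.
have dx : p^`().[x] != 0.
  apply/eqP => dpx; have : p^`() = 0.
    apply: minP => //; first by move=> i; rewrite coef_deriv; have := pF i.+1; move=> *; sa.
    by apply: lt_size_deriv.
  move=> d0; have sp : (size p <= 1)%N.
    rewrite leqNgt; apply/negP => sp.
    have := congr1 (fun q : {poly K} => q`_(size p).-2) d0; rewrite coef_deriv coef0 -mulr_natr.
    move/eqP; rewrite mulf_eq0 (negPf (natr_neq0 iota _)) orbF.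
    have -> : (size p).-2.+1 = (size p).-1 by lia.
    by rewrite -lead_coefE lead_coef_eq0 (negPf p0).
  have pc := size1_polyC sp; move: px; rewrite pc hornerC => c0.
  by move: p0; rewrite pc c0 eqxx.
have [|D' [h1 h2 _]] := @der_adjoin F D sF dD x (- (map_poly D p).[x] / p^`().[x]); last by exists D'.
move=> q qF qx; have [e [r [eF rF qE sr]]] := sf_polydiv sF qF pF p0.
have r0 : r = 0.
  by apply: minP => //; have := congr1 (horner^~ x) qE; rewrite !hornerE qx px mulr0 add0r.
rewrite qE r0 addr0 derivM.
have D00 : D 0 = 0 by case: dD => h _ _; have := h 0; rewrite rmorph0.
have -> : map_poly D (e * p) = e * map_poly D p + map_poly D e * p.
  apply/polyP => i; rewrite coefD coef_map_id0 // !coefM (der_on_sum sF dD); last first.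
    by move=> j; have := eF j; have := pF (i - j)%N; move=> *; sa.
  rewrite -big_split; apply: eq_bigr => j _ /=; rewrite !coef_map_id0 //.
  by case: dD => _ _ ->//; ring.
by rewrite !(hornerD, hornerN, hornerM) px; field.
Qed.

Definition adjoin_list F (l : seq K) : set K :=
  foldl (fun F x => locin (adj F x) setT) F l.

Lemma subfield_adj F x : subfield F -> subfield (locin (adj F x) setT).
Proof. by move=> sF; apply: subfield_locin; have sFa := subfield_sa sF; sa. Qed.
Lemma adj_sub_field F x : subfield F -> F `<=` locin (adj F x) setT.
Proof.
move=> sF; have sFa := subfield_sa sF; have sA := adj_sa x sFa.
by apply: subset_trans (locin_sub sA (setT_sa iota)); apply: (adj_base x sFa).
Qed.
Lemma adj_field_gen F x : subfield F -> locin (adj F x) setT x.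
Proof.
move=> sF; have sFa := subfield_sa sF; have sA := adj_sa x sFa.
by apply: (locin_sub sA (setT_sa iota)); apply: (adj_gen x sFa).
Qed.
Lemma adj_field_min F B x : subfield B -> F `<=` B -> B x -> locin (adj F x) setT `<=` B.
Proof. by move=> sB FB Bx; apply: (locin_min sB); apply: adj_min => //; exact: subfield_sa sB. Qed.

Lemma der_extend F D l : subfield F -> der_on F D -> adjoin_list F l = setT ->
  exists2 D', derivation iota D' & forall z, F z -> D' z = D z.
Proof.
elim: l F D => [|x l IH] F D sF dD /= e; first by exists D => //; apply/der_onT; rewrite -e.
have [D1 d1 h1] := der_adjoin_any x sF dD.
have [D2 d2 h2] := IH _ _ (subfield_adj x sF) d1 e.
by exists D2 => // z Fz; rewrite h2 ?h1 //; apply: (adj_sub_field x sF).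
Qed.

(** Uniqueness of extensions follows from this: a subfield containing the generators contains the
    field they generate. *)
Lemma subfield_agree F D1 D2 : subfield F -> der_on F D1 -> der_on F D2 ->
  subfield [set z | F z /\ D1 z = D2 z].
Proof.
move=> sF d1 d2; have sFa := subfield_sa sF; split; first split.
- by move=> a; split; [sa | case: d1 => -> _ _; case: d2 => -> _ _].
- by move=> x y [Fx ex] [Fy ey]; split; [sa | rewrite (der_onB sF d1) ?(der_onB sF d2) // ex ey].
- move=> x y [Fx ex] [Fy ey]; split; first by sa.
  by case: d1 => _ _ ->//; case: d2 => _ _ ->//; rewrite ex ey.
- move=> x [Fx ex]; split; first exact: (sfV sF).
  by rewrite (der_onV sF d1) ?(der_onV sF d2) // ex.
Qed.

Lemma der_ext_eq F x D1 D2 : subfield F ->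
  der_on (locin (adj F x) setT) D1 -> der_on (locin (adj F x) setT) D2 ->
  (forall z, F z -> D1 z = D2 z) -> D1 x = D2 x ->
  forall z, locin (adj F x) setT z -> D1 z = D2 z.
Proof.
move=> sF d1 d2 hF hx z hz; have sF' := subfield_adj x sF.
have [_ ->//] : [set z | locin (adj F x) setT z /\ D1 z = D2 z] z.
apply: (adj_field_min (subfield_agree sF' d1 d2)) hz => [y Fy|].
  by split; [apply: (adj_sub_field x sF) | apply: hF].
by split=> //; apply: (adj_field_gen x sF).
Qed.

Lemma der_preserve_gen V G D : subalg V -> der_on V D -> G `<=` V ->
  (forall g, G g -> V (D g)) -> forall a, alg_gen iota G a -> V (D a).
Proof.
move=> sV [d1 d2 d3] GV hG a ha.
suff : [set z | V z /\ V (D z)] a by case.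
have dB x y : V x -> V y -> D (x - y) = D x - D y.
  move=> Vx Vy; have -> : x - y = x + iota (- 1) * y by rewrite rmorphN1 mulN1r.
  by rewrite d2 ?d3 ?d1 ?rmorphN1; try (by sa); ring.
apply: (alg_gen_min _ _ ha); last by move=> g Gg; split; [apply: GV | apply: hG].
split; first by move=> b; split; [sa | rewrite d1; sa].
- by move=> x y [Vx hx] [Vy hy]; split; [sa | rewrite dB //; sa].
- by move=> x y [Vx hx] [Vy hy]; split; [sa | rewrite d3 //; sa].
Qed.

Lemma der_preserve_loc F A V D : subfield F -> V `<=` F -> der_on F D -> is_loc A V ->
  (forall a, A a -> V (D a)) -> forall z, V z -> V (D z).
Proof.
move=> sF VF dD [sA lV AV VA] h z /VA [a [b [Aa Ab ub ->]]]; have sV := local_sa lV.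
rewrite (der_on_div sF dD) ?(is_unit_neq0 ub) //; try by apply/VF/AV.
have := AV _ Aa; have := AV _ Ab; have := h _ Aa; have := h _ Ab.
have := is_unit_inV ub; rewrite -exprVn; move=> *; sa.
Qed.

End Derivations.

(** * Rational top forms *)

Section Forms.
Variables (R : realType) (K : fieldType) (iota : {rmorphism R[i] -> K}).
Local Notation subalg := (subalgebra iota).
Local Notation local_ring := (local_ring iota).
Local Notation is_loc := (is_loc iota).
Local Notation subfield := (subfield iota).
Local Notation noeth := (@noeth K).
Local Notation dvr := (dvr_in iota setT).
Local Notation derivation := (derivation iota).
Implicit Types (A B O V F I P M G : set K) (x y z a b u v pi : K) (p q : {poly K}) (l ys : seq K).

Lemma imin_spec (A : set int) m : (exists n, A n) -> (forall n, A n -> m <= n) ->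
  A (imin A) /\ forall n, A n -> imin A <= n.
Proof.
move=> [n0 An0] hm.
have ex : exists k : nat, `[< A (m + k%:Z) >].
  exists `|n0 - m|%N; apply/asboolP; have -> : m + `|n0 - m|%N = n0 by have := hm _ An0; lia.
  by [].
case: (ex_minnP ex) => k /asboolP Ak kmin.
suff h : A (m + k%:Z) /\ forall n, A n -> m + k%:Z <= n.
  exact: (@xgetPex _ 0 [set n | A n /\ forall m, A m -> n <= m] (ex_intro _ _ h)).
split=> // n An; have mn := hm _ An.
have := kmin `|n - m|%N; rewrite (_ : `[< _ >] = true); last first.
  by apply/asboolP; have -> : m + `|n - m|%N = n by lia.
by move=> /(_ isT); lia.
Qed.

Lemma imin_ge (A : set int) m : (exists n, A n) -> (forall n, A n -> m <= n) -> m <= imin A.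
Proof. by move=> ex hm; have [h _] := imin_spec ex hm; apply: hm. Qed.

(** The default value 0 of [imin] makes this bound valid for the empty set too, unlike a positive
    bound. *)
Lemma imin_ge0 (A : set int) : (forall n, A n -> 0 <= n) -> 0 <= imin A.
Proof.
move=> h; case: (pselect (exists n, A n)) => ex; first exact: imin_ge.
rewrite /imin xgetPN // => n [An _]; apply: ex; by exists n.
Qed.

Lemma imin_eq (A : set int) m : A m -> (forall n, A n -> m <= n) -> imin A = m.
Proof.
move=> Am hm; have [h1 h2] := imin_spec (ex_intro _ _ Am) hm.
by apply/eqP; rewrite eq_le hm // h2.
Qed.

(** The [e j] are the partial derivatives with respect to a transcendence basis [c]; the last clause
    is the chain rule. *)
Definition dual_basis d (c : 'I_d -> K) (e : 'I_d -> K -> K) : Prop :=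
  [/\ forall i, derivation (e i), forall i j, e i (c j) = (i == j)%:R
    & forall D, derivation D -> forall z, D z = \sum_j D (c j) * e j z].

Section DualBasis.
Variables (d : nat) (c : 'I_d -> K) (e : 'I_d -> K -> K).
Hypothesis dce : dual_basis c e.

Lemma form_eval_change (w : Defs.form K d) (D : 'I_d -> K -> K) : (forall i, derivation (D i)) ->
  form_eval w D = form_eval w e * \det (\matrix_(i, j) D i (c j)).
Proof.
move=> dD; rewrite /form_eval -mulrA [X in _ = _ * X]mulrC -det_mulmx; congr (_ * \det _).
apply/matrixP => i j; rewrite !mxE; have [_ _ h] := dce.
by rewrite (h _ (dD i)); apply: eq_bigr => k _; rewrite !mxE.
Qed.

Lemma form_nonzero_dual (w : Defs.form K d) : form_nonzero iota w -> form_eval w e != 0.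
Proof.
move=> [D dD]; apply: contra_neq => e0.
by rewrite form_eval_change // e0 mul0r.
Qed.

Lemma derivation_scale a D : derivation D -> derivation (fun z => a * D z).
Proof.
move=> [h1 h2 h3]; split=> [b|x y|x y]; first by rewrite h1 mulr0.
  by rewrite h2 mulrDr.
by rewrite h3; ring.
Qed.

(** A derivation preserving [V] maps regular coordinates into [V], so evaluating the form on such
    derivations multiplies its value on [e] by a determinant in [V]. Only an inequality is
    available, as the [e j] need not preserve [V]. *)
Lemma ord_form_ge (w : Defs.form K d) V pi l : dvr V pi -> is_loc (alg_gen iota [set` l]) V ->
  (forall j, V (c j)) -> form_eval w e != 0 ->
  ord V (form_eval w e) <= ord_form iota w V.
Proof.
move=> hV hl Vc w0; have [lV pi0 [Vpi _] _] := hV; have sV := local_sa lV.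
have [de _ _] := dce.
apply: imin_ge.
  (* The minimum defining [ord_form] must be over a nonempty set: a power of [pi] clears the poles
     of the [e i] on the finitely many generators of [V], which is enough to preserve [V]. *)
  have [N hN] : exists N, forall i z, z \in l -> V (pi ^+ N * e i z).
    have {hl} : forall zz : seq ('I_d * K), exists N, forall iz, iz \in zz -> V (pi ^+ N * e iz.1 iz.2).
      elim=> [|[i z] zz [N hN]]; first by exists 0%N.
      have [k hk] : exists k : nat, V (pi ^+ k * e i z).
        have [e0|e0] := eqVneq (e i z) 0; first by exists 0%N; rewrite e0 mulr0; sa.
        have := dvr_ordP hV e0; case: (ord V (e i z)) => m.
          move=> [_ h _]; exists 0%N; rewrite mul1r.
          have -> : e i z = e i z / pi ^+ m * pi ^+ m by rewrite divfK // expf_neq0.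
          by sa.
        by rewrite NegzE -exprnN invrK => -[_ h _]; exists m.+1; rewrite mulrC.
      exists (k + N)%N => iz; rewrite inE exprD => /orP[/eqP->/=|/hN h].
        by rewrite mulrAC; sa.
      by rewrite -mulrA; sa.
    move=> /(_ [seq (i, z) | i <- enum 'I_d, z <- l]) [N hN]; exists N => i z zl.
    by apply: (hN (i, z)); apply/allpairsP; exists (i, z); rewrite /= mem_enum.
  pose D i z := pi ^+ N * e i z.
  have dD i : derivation (D i) by apply: derivation_scale.
  have evE : form_eval w D = form_eval w e * (pi ^+ N) ^+ d.
    rewrite form_eval_change //; congr (_ * _).
    have -> : (\matrix_(i, j) D i (c j)) = (pi ^+ N)%:M; last by rewrite det_scalar.
    by apply/matrixP => i j; rewrite !mxE /D; have [_ -> _] := dce; rewrite mulr_natr.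
  exists (ord V (form_eval w D)), D; split=> //; last by rewrite evE mulf_neq0 ?expf_neq0.
  move=> i; split=> // z Vz; have dT : der_on iota setT (D i) by apply/der_onT.
  apply: (der_preserve_loc (subfield_setT iota) _ dT hl) Vz => // a.
  have [_ _ lV' _] := hl.
  apply: (der_preserve_gen sV (der_on_mono _ dT)) => // [g gl|g gl].
    by apply: lV'; apply: alg_gen_sub.
  exact: hN.
move=> _ [D [hD D0 ->]]; have dD i := proj1 (hD i).
have := D0; rewrite form_eval_change // mulf_eq0 negb_or => /andP[_ det0].
rewrite (ordM hV) // lerDl; apply/(ord_ge0 hV) => //.
rewrite /determinant; apply: (sa_sum sV) => s _.
apply: (saM sV); first by rewrite -signr_odd; case: odd; rewrite ?expr1 ?expr0; sa.
by apply: (sa_prod sV) => i _; rewrite !mxE; apply: (proj2 (hD i)).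
Qed.

(** Here the [e i] preserve [V] themselves, so the lower bound is attained. *)
Lemma ord_form_eq (w : Defs.form K d) V pi : dvr V pi ->
  (forall j, V (c j)) -> (forall i z, V z -> V (e i z)) -> form_eval w e != 0 ->
  ord_form iota w V = ord V (form_eval w e).
Proof.
move=> hV Vc Ve w0; have [lV pi0 [Vpi _] _] := hV; have sV := local_sa lV.
have [de _ _] := dce.
apply: imin_eq; first by exists e; split=> // i; split=> //; apply: Ve.
move=> _ [D [hD D0 ->]]; have dD i := proj1 (hD i).
have := D0; rewrite form_eval_change // mulf_eq0 negb_or => /andP[_ det0].
rewrite (ordM hV) // lerDl; apply/(ord_ge0 hV) => //.
rewrite /determinant; apply: (sa_sum sV) => s _.
apply: (saM sV); first by rewrite -signr_odd; case: odd; rewrite ?expr1 ?expr0; sa.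
by apply: (sa_prod sV) => i _; rewrite !mxE; apply: (proj2 (hD i)).
Qed.

Lemma subfield_iota F c' : subfield F -> F (iota c').
Proof. by move=> sF; have sFa := subfield_sa sF; sa. Qed.

(* Each x_k is transcendental over a field containing its predecessors: a
   derivation killing that field and sending x_k to 1 exists for each k, and these
   derivations are linearly independent. *)
Lemma independent_bound n (F : nat -> set K) (x : nat -> K) l :
  (forall k, subfield (F k)) -> (forall k j, (j < k)%N -> F k (x j)) ->
  (forall k, (k < n)%N -> transcendental_over (F k) (x k)) ->
  (forall F', subfield F' -> adjoin_list F' l = setT) -> (n <= d)%N.
Proof.
move=> sF Fx tx hl.
have hD (k : 'I_n) : exists D, [/\ derivation D, forall z, F k z -> D z = 0 & D (x k) = 1].
  have d0 : der_on iota (F k) (fun=> 0) by split=> *; rewrite ?mulr0 ?addr0.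
  have [D1 [d1 h1 v1]] := der_adjoin_transc 1 (sF k) d0 (tx k (ltn_ord k)).
  have sF1 := subfield_adj (x k) (sF k).
  have [D2 d2 h2] := der_extend sF1 d1 (hl _ sF1).
  exists D2; split=> // [z Fz|]; last by rewrite h2 ?v1 //; apply: (adj_field_gen _ (sF k)).
  by rewrite h2 ?h1 //; apply: (adj_sub_field _ (sF k)).
have [D hD'] := choice hD.
pose M : 'M[K]_n := \matrix_(k, j) D k (x j).
have detM : \det M = 1.
  rewrite -det_tr det_trig; last first.
    apply/is_trig_mxP => i j ij; rewrite !mxE; have [_ h _] := hD' j.
    by apply: h; apply: Fx.
  by apply: big1 => i _; rewrite !mxE; case: (hD' i).
(* [M] is unipotent triangular, hence of rank [n], while the chain rule factors it through a space
   of dimension [d]. *)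
have ME : M = (\matrix_(k < n, j < d) D k (c j)) *m (\matrix_(j < d, i < n) e j (x i)).
  apply/matrixP => i j; rewrite !mxE; have [_ _ h] := dce; have [dD _ _] := hD' i.
  by rewrite (h _ dD); apply: eq_bigr => k _; rewrite !mxE.
have rM : \rank M = n by apply: mxrank_unit; rewrite unitmxE detM unitr1.
by rewrite -{1}rM ME; apply: leq_trans (mxrankM_maxl _ _) (rank_leq_col _).
Qed.

Lemma transc_frac A x : subalg A -> (forall p, polyin A p -> p.[x] = 0 -> p = 0) ->
  transcendental_over (locin A setT) x.
Proof.
move=> sA h p pF /rootP px.
have [b [Ab /is_unit_setT b0 hb]] := common_denom (size p) sA (setT_sa iota) pF.
have : b *: p = 0.
  apply: h; last by rewrite hornerZ px mulr0.
  move=> i; rewrite coefZ; case: (ltnP i (size p)) => hi; first exact: hb.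
  by rewrite nth_default // mulr0; sa.
by move/eqP; rewrite scaler_eq0 (negPf b0) => /eqP.
Qed.

Lemma proj_point_chart ys O yi : proj_model iota ys O -> yi \in ys -> yi != 0 ->
  (forall z, z \in ys -> O (z / yi)) -> is_loc (chart iota ys yi) O.
Proof.
move=> hO iy i0 h; have lO := proj_local hO.
have [h1 h2 _ h4] := proj_point iy i0 lO h.
by have eO := proj_center_unique lO hO h1 (dominates_refl O) h4; rewrite -eO in h2.
Qed.

(** A strict chain of primes in one chart yields as many algebraically independent elements, to
    which [independent_bound] applies. *)
Lemma chain_bound ys m l : (forall F', subfield F' -> adjoin_list F' l = setT) ->
  chain (proj_model iota ys) m -> (m <= d)%N.
Proof.
move=> hl [c' [Xc cc]].
have [yi [iy i0 hm]] := proj1 (proj_modelP _ _ _) (Xc m (leqnn m)).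
set A := chart iota ys yi in hm.
have sA : subalg A by exact: chart_sa.
have mono i j : (i <= j)%N -> (j <= m)%N -> c' j `<=` c' i.
  elim: j => [|j IH]; first by rewrite leqn0 => /eqP-> _ z.
  rewrite leq_eqVlt => /orP[/eqP-> _ z //|ij] jm; apply: subset_trans (IH ij (ltnW jm)).
  by case: (cc j jm).
have [_ _ Am _] := hm.
have hc i : (i <= m)%N -> is_loc A (c' i).
  move=> im; apply: proj_point_chart => //; first exact: Xc.
  by move=> z zy; apply: (mono i m) => //; apply: Am; apply: chart_in.
(* In terms of primes of [A]: an element of the (i+1)-st prime outside the i-th one. *)
have step i : exists x, (i < m)%N -> [/\ A x, is_unit (c' i) x & max_ideal (c' i.+1) x].
  case: (ltnP i m) => im; last by exists 0.
  have [sub ne] := cc i im; have [_ l0 A0 h0] := hc i (ltnW im); have [_ l1 A1 h1] := hc _ im.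
  have [z [hz nz]] : exists z, c' i z /\ ~ c' i.+1 z.
    apply: contrapT => h; apply: ne; apply/seteqP; split=> // z hz.
    by apply: contrapT => nz; apply: h; exists z.
  have [a [b [Aa Ab ub zE]]] := h0 _ hz; exists b => _; split=> //.
  case: (unit_or_mx (A1 _ Ab)) => // ub'; case: nz; rewrite zE.
  by have := A1 _ Aa; have := is_unit_inV ub'; have s1 := local_sa l1; move=> *; sa.
have [x hx] := choice step.
(* The elements are adjoined from the special end of the chain, [x (m - 1)] first; the invariant is
   that [B k] meets the prime of [c' (m - k)] only in 0. *)
pose B := fix B k := if k is k'.+1 then adj (B k') (x (m - k)%N) else range iota.
have sB k : subalg (B k) by elim: k => [|k IH] /=; sa.
have BA k : (k <= m)%N -> B k `<=` A.
  elim: k => [_ _ [a _ <-]|k IH km] /=; first by sa.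
  apply: (adj_min sA); first by apply: IH; apply: ltnW.
  by case: (hx (m - k.+1)%N) => //; lia.
(* After removing powers of the new element, a unit at the more general point, the constant
   coefficient lies in the prime of the more special one, where the new element vanishes; the
   invariant makes that coefficient zero, a contradiction. *)
have key k : (k < m)%N -> (forall z, B k z -> max_ideal (c' (m - k)%N) z -> z = 0) ->
   forall p, polyin (B k) p -> max_ideal (c' (m - k.+1)%N) p.[x (m - k.+1)%N] -> p = 0.
  move=> km IH p pB mp; set j := (m - k.+1)%N in mp.
  have jm : (j < m)%N by rewrite /j; lia.
  have jS : (m - k = j.+1)%N by rewrite /j; lia.
  rewrite jS in IH; have [Ax ux mx] := hx j jm.
  have [_ l0 A0 _] := hc j (ltnW jm); have [_ l1 A1 _] := hc _ jm.
  apply/eqP/negPn/negP => p0.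
  have ex : exists r, p`_r != 0.
    by exists (size p).-1; rewrite -lead_coefE lead_coef_eq0.
  case: (ex_minnP ex) => r pr rmin; pose q := drop_poly r p.
  have pE : p = q * 'X^r.
    rewrite -{1}(poly_take_drop r p) (_ : take_poly r p = 0) ?add0r //.
    apply/polyP => i; rewrite coef_take_poly coef0; case: ifP => // ir.
    by apply/eqP/negPn/negP => /rmin; rewrite leqNgt ir.
  have qB : polyin (B k) q by move=> i; rewrite coef_drop_poly.
  have s0 := local_sa l0; have s1 := local_sa l1.
  have BkA : B k `<=` A by apply: BA; apply: ltnW.
  have Aq : A q.[x j] by exact: (polyin_horner sA BkA Ax qB).
  have mq : max_ideal (c' j) q.[x j].
    have := mp; rewrite {1}pE hornerM hornerXn => h.
    have -> : q.[x j] = (x j ^- r) * (q.[x j] * x j ^+ r).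
      by field; rewrite expf_neq0 // (is_unit_neq0 ux).
    apply: (mxM s0) => //; exact: is_unit_inV (is_unitX _ s0 ux).
  have mq1 : max_ideal (c' j.+1) q.[x j].
    case: (unit_or_mx (A1 _ Aq)) => // uq; case: mq => _ []; apply: is_unit_mono uq.
    exact: (proj1 (cc j jm)).
  have [q' hq'] : exists q', polyin (B k) q' /\ q = q' * 'X + (q`_0)%:P.
    exists (drop_poly 1 q); split; first by move=> i; rewrite coef_drop_poly.
    rewrite -{1}(poly_take_drop 1 q) addrC expr1; congr (_ + _).
    by apply/polyP => i; rewrite coef_take_poly coefC; case: i.
  have : q`_0 = 0.
    apply: IH; first exact: qB.
    have -> : q`_0 = q.[x j] - q'.[x j] * x j.
      by rewrite {2}(proj2 hq') hornerD hornerM hornerX hornerC addrAC subrr add0r.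
    apply: (mxB l1) => //; apply: (mxM s1) => //; apply: A1.
    exact: (polyin_horner sA BkA Ax (proj1 hq')).
  by rewrite coef_drop_poly add0n => e0; rewrite e0 eqxx in pr.
have claim k : (k <= m)%N -> forall z, B k z -> max_ideal (c' (m - k)%N) z -> z = 0.
  elim: k => [_ _ [a _ <-]|k IH km z].
    rewrite subn0 => -[_ nu]; apply/eqP/negPn/negP => a0; apply: nu.
    have [_ lm _ _] := hm; apply: (is_unit_iota (local_sa lm)).
    by apply: contraNneq a0 => ->; rewrite rmorph0.
  move=> [p hp <-] h.
  by rewrite (key k km (IH (ltnW km)) p hp h) horner0.
pose F k := if (k <= m)%N then locin (B k) setT else setT.
apply: (@independent_bound m F (fun k => x (m - k.+1)%N) l) => //.
- by move=> k; rewrite /F; case: ifP => _; [apply: subfield_locin | exact: subfield_setT].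
- move=> k j jk; rewrite /F; case: ifP => km //.
  have Bm : forall k', (j < k')%N -> B k' (x (m - j.+1)%N).
    elim=> [//|k' IH]; rewrite ltnS leq_eqVlt => /orP[/eqP->|h] /=.
      exact: (adj_gen _ (sB k')).
    exact: (adj_base _ (sB k')) (IH h).
  exact: (locin_sub (sB k) (setT_sa iota)) (Bm _ jk).
- move=> k km; rewrite /F (ltnW km); apply: transc_frac => // p hp p0.
  apply: (key k km (claim k (ltnW km)) p hp); rewrite p0.
  have [_ l0 _ _] := hc (m - k.+1)%N (leq_subr _ _).
  exact: mx0 (local_sa l0).
Qed.

End DualBasis.

Lemma adjoin_list_mono F F' l : subfield F -> subfield F' -> F `<=` F' ->
  adjoin_list F l `<=` adjoin_list F' l.
Proof.
elim: l F F' => [//|x l IH] F F' sF sF' FF' /=.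
apply: IH; [exact: subfield_adj | exact: subfield_adj|].
apply: (adj_field_min (subfield_adj x sF')); last exact: (adj_field_gen x sF').
by apply: subset_trans (adj_sub_field x sF').
Qed.

End Forms.

(** * Elliptic curves *)

Section EllipticCurve.
Variables (R : realType) (K : fieldType) (iota : {rmorphism R[i] -> K}).
Local Notation subalg := (subalgebra iota).
Local Notation local_ring := (local_ring iota).
Local Notation is_loc := (is_loc iota).
Local Notation subfield := (subfield iota).
Local Notation noeth := (@noeth K).
Local Notation dvr := (dvr_in iota setT).
Implicit Types (A B O V F I P M G : set K) (z u v pi : K) (p q : {poly K}) (l ys : seq K).

Lemma polyin_range p : polyin (range iota) p -> exists p0 : {poly R[i]}, p = map_poly iota p0.
Proof.
move=> hp; have h (i : nat) : exists c, iota c = p`_i by have [c _ e] := hp i; exists c.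
have [c hc] := choice h; exists (\poly_(i < size p) c i).
apply/polyP => i; rewrite coef_map /= coef_poly; case: ltnP => hi; first exact/esym/hc.
by rewrite rmorph0 nth_default.
Qed.

(** Over the complex numbers [p] splits, and a prime ideal containing the product contains a linear
    factor. *)
Lemma max_ideal_root V z (p : {poly R[i]}) : local_ring V -> V z -> p != 0 ->
  max_ideal V (map_poly iota p).[z] -> exists c, max_ideal V (z - iota c).
Proof.
move=> lV Vz p0; have sV := local_sa lV.
have [r ->] := closed_field_poly_normal p.
rewrite -mul_polyC rmorphM /= map_polyC hornerM hornerC => h.
have h1 : max_ideal V (map_poly iota (\prod_(c <- r) ('X - c%:P))).[z].
  have c0 : lead_coef p != 0 by rewrite lead_coef_eq0.
  have -> : (map_poly iota (\prod_(c <- r) ('X - c%:P))).[z] =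
    iota (lead_coef p)^-1 * (iota (lead_coef p) * (map_poly iota (\prod_(c <- r) ('X - c%:P))).[z]).
    by rewrite mulrA -rmorphM mulVf // rmorph1 mul1r.
  by apply: (mxM sV) => //; sa.
elim: r {h} h1 => [|c r IH].
  by rewrite big_nil rmorph1 hornerC => /(mxN1 sV).
rewrite big_cons rmorphM rmorphB /= map_polyX map_polyC hornerM !hornerE => h.
case: (mx_prime lV _ _ h) => [||h'|/IH//]; last by exists c.
  by sa.
rewrite rmorph_prod horner_prod; apply: (sa_prod sV) => d _.
by rewrite rmorphB /= map_polyX map_polyC !hornerE; sa.
Qed.

Lemma algebraic_const f (p : {poly R[i]}) : p != 0 -> root (map_poly iota p) f -> range iota f.
Proof.
move=> p0 /rootP r; have [|c /mx_setT/eqP] := @max_ideal_root setT f p (local_setT iota) I p0.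
  by rewrite r; exact: (mx0 (setT_sa iota)).
by rewrite subr_eq0 => /eqP->; exists c.
Qed.

(* A global regular function acts on the finite-dimensional space of sections,
   hence is an eigenvalue of a complex matrix. *)
Lemma regular_const X L n (s : n.-tuple K) f : sections_basis iota X L s ->
  subalg (function_field X) -> (forall O, X O -> subalg O) ->
  (exists2 z, z \in s & z != 0) -> function_field X f -> (forall O, X O -> O f) -> range iota f.
Proof.
move=> [hs _] sF sX [z /tnthP[i0 zE] z0] Ff Of.
have ss (i : 'I_n) : global_sections X L s`_i.
  apply/hs; exists (fun j => (j == i)%:R); rewrite (bigD1 i) //= eqxx rmorph1 mul1r.
  rewrite big1 ?addr0 // => j /negPf->; by rewrite rmorph0 mul0r.
have fs (i : 'I_n) : exists c : 'I_n -> R[i], f * s`_i = \sum_(j < n) iota (c j) * s`_j.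
  apply/hs; have [h1 h2] := ss i; split; first by sa.
  move=> O XO; rewrite -mulrA; have := h2 _ XO; have := Of _ XO; have sO := sX _ XO.
  by move=> *; sa.
have [c hc] := choice fs.
pose C : 'M[R[i]]_n := \matrix_(j, i) c i j.
apply: (@algebraic_const f (char_poly C)); first exact: monic_neq0 (char_poly_monic C).
rewrite map_char_poly -eigenvalue_root_char; apply/eigenvalueP.
(* The vector of basis sections is itself an eigenvector for the eigenvalue [f]. *)
exists (\row_i s`_i).
  apply/rowP => i; rewrite !mxE hc; apply: eq_bigr => j _.
  by rewrite !mxE mulrC.
apply/eqP => /rowP /(_ i0); rewrite !mxE => e; case/eqP: z0.
by rewrite zE (tnth_nth 0).
Qed.

(** Being constant modulo [pi] passes from generators to the whole algebra, and a constant lying in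
    the maximal ideal is 0. *)
Lemma max_ideal_gen V G pi : local_ring V -> G `<=` V -> V `<=` locin (alg_gen iota G) V ->
  max_ideal V pi -> (forall g, G g -> exists c, exists2 v, V v & g - iota c = pi * v) ->
  pi != 0 -> forall z, max_ideal V z -> V (z / pi).
Proof.
move=> lV GV VG mpi hG pi0; have sV := local_sa lV.
have key z : alg_gen iota G z -> exists c, exists2 v, V v & z - iota c = pi * v.
  apply: (alg_gen_min (A := [set z | exists c, exists2 v, V v & z - iota c = pi * v])) => //.
  have Vpi := mx_in mpi; split.
  - by move=> c; exists c, 0; rewrite ?subrr ?mulr0 //; sa.
  - move=> x y [c [v Vv e]] [d [w Vw e']]; exists (c - d), (v - w); first by sa.
    by rewrite rmorphB mulrBr -e -e'; ring.
  - move=> x y [c [v Vv e]] [d [w Vw e']].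
    exists (c * d), (v * (iota d + pi * w) + iota c * w); first by sa.
    have -> : x = iota c + pi * v by rewrite -e addrC subrK.
    have -> : y = iota d + pi * w by rewrite -e' addrC subrK.
    by rewrite rmorphM; ring.
move=> z mz; have [a [b [Aa Ab ub zE]]] := VG _ (mx_in mz).
have GV' : alg_gen iota G `<=` V by apply: alg_gen_min.
have ma : max_ideal V a.
  have -> : a = b * z by rewrite zE mulrC divfK // (is_unit_neq0 ub).
  by apply: (mxM sV) => //; apply: GV'.
have [c [v Vv e]] := key _ Aa.
have c0 : c = 0.
  have : max_ideal V (iota c).
    have -> : iota c = a - v * pi by rewrite mulrC -e; ring.
    by apply: (mxB lV) => //; apply: (mxM sV).
  by move=> [_ nu]; apply/eqP/negPn/negP => /(is_unit_iota sV).
have aE : a = pi * v by rewrite -e c0 rmorph0 subr0.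
have -> : z / pi = v / b by rewrite zE aE; fld.
by have := is_unit_inV ub; move=> *; sa.
Qed.

Variables (a b : R[i]) (x y : K).
Hypotheses (disc : 4 * a ^+ 3 + 27 * b ^+ 2 != 0) (tx : transcendental_over (range iota) x)
  (weq : y ^+ 2 = x ^+ 3 + iota a * x + iota b).
Let E := proj_model iota [:: 1; x; y].
Let kx := locin (adj (range iota) x) setT.
Definition curve_field := locin (adj kx y) setT.
Local Notation FE := curve_field.

Let sk : subfield (range iota) := range_subfield iota.
Let skx : subfield kx := subfield_adj x sk.

Lemma curve_subfield : subfield FE. Proof. exact: subfield_adj. Qed.
Let sFE := curve_subfield.
Let saFE : subalg FE := subfield_sa sFE.
Lemma curve_x : FE x.
Proof. by apply: (adj_sub_field y skx); apply: (adj_field_gen x sk). Qed.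
Lemma curve_y : FE y. Proof. exact: (adj_field_gen y skx). Qed.
Let Fx := curve_x. Let Fy := curve_y.
Let two0 : 2%:R != 0 :> K. Proof. exact: natr_neq0 iota 1. Qed.

Lemma curve_y0 : y != 0.
Proof.
apply/eqP => y0; pose f : {poly R[i]} := 'X^3 + a%:P * 'X + b%:P.
have f0 : f != 0.
  apply/eqP => /(congr1 (fun q : {poly R[i]} => q`_3)) /eqP.
  by rewrite /f !coefD coefXn coefCM coefX coefC /= mulr0 !addr0 coef0 oner_eq0.
have : map_poly iota f = 0.
  apply: tx; first by move=> i; rewrite coef_map; exists f`_i.
  apply/rootP; rewrite /f !rmorphD rmorphM /= map_polyXn map_polyX !map_polyC.
  by rewrite !hornerE -weq y0 expr0n.
by move/eqP; rewrite map_poly_eq0 (negPf f0).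
Qed.
Let y0 := curve_y0.
Lemma curve_x0 : x != 0.
Proof.
apply/eqP => x0; have /eqP : ('X : {poly K}) = 0; last by rewrite polyX_eq0.
apply: tx; last by apply/rootP; rewrite hornerX.
by have s := subfield_sa sk; exact: (polyinX s).
Qed.
Let x0 := curve_x0.

Lemma curve_function_field : function_field E = FE.
Proof.
rewrite (@function_field_proj _ _ iota [:: 1; x; y] 1) ?oner_neq0 ?inE ?eqxx //.
apply/seteqP; split.
  apply: (locin_min sFE); apply: (chart_min saFE) => z; rewrite !inE divr1.
  by move=> /or3P[] /eqP->; sa.
have sC := chart_sa iota [:: 1; x; y] 1.
have sL := subfield_locin sC; have saL := subfield_sa sL.
have hin z : z \in [:: 1; x; y] -> locin (chart iota [:: 1; x; y] 1) setT z.
  move=> zi; apply: (locin_sub sC (setT_sa iota)); rewrite -[z]divr1.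
  exact: chart_in.
apply: (adj_field_min sL); last by apply: hin; rewrite !inE eqxx !orbT.
apply: (adj_field_min sL); last by apply: hin; rewrite !inE eqxx !orbT.
by move=> _ [c _ <-]; sa.
Qed.

(** The vector field dual to the invariant differential dx/2y. The value at [x] is chosen, and that
    at [y] is forced by the Weierstrass equation. *)
Lemma curve_der : exists D, [/\ der_on iota FE D, D x = 2 * y & D y = 3 * x ^+ 2 + iota a].
Proof.
have d0 : der_on iota (range iota) (fun=> 0) by split=> *; rewrite ?mulr0 ?addr0.
have [D1 [d1 _ D1x]] := der_adjoin_transc (2 * y) sk d0 tx.
have [D d h] := der_adjoin_any y skx d1; exists D.
have Dx : D x = 2 * y by rewrite h ?D1x //; apply: (adj_field_gen x sk).
split=> //; have := congr1 D weq.
have [dc dD dM] := d.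
rewrite (der_onX sFE d 1 Fy) dD; try by sa.
rewrite dD; try by sa.
rewrite (der_onX sFE d 2 Fx) (der_iotaM sFE d) // dc Dx => e.
have yy : 2 * y != 0 by rewrite mulf_neq0.
by apply: (mulfI yy); move: e; rewrite expr1 addr0 => ->; ring.
Qed.

Variable D : K -> K.
Hypotheses (dD : der_on iota FE D) (Dx : D x = 2 * y) (Dy : D y = 3 * x ^+ 2 + iota a).

(** Derivations of the curve form a line: one is determined by its value at [x], since y ≠ 0 fixes
    its value at [y]. *)
Lemma curve_der_unique D' : der_on iota FE D' -> forall z, FE z -> D' z = D' x / (2 * y) * D z.
Proof.
move=> d'; set k := _ / _; have yy : 2 * y != 0 by rewrite mulf_neq0.
have d1 : der_on iota FE (fun z => k * D z).
  have [h1 h2 h3] := dD; split=> [c|u v Fu Fv|u v Fu Fv]; first by rewrite h1 mulr0.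
    by rewrite h2 // mulrDr.
  by rewrite h3 //; ring.
have kxFE := adj_sub_field y skx.
apply: (der_ext_eq skx d' d1).
  apply: (der_ext_eq sk (der_on_mono kxFE d') (der_on_mono kxFE d1)).
    by move=> _ [c _ <-]; case: d' => -> _ _; case: d1 => -> _ _.
  by rewrite Dx /k divfK.
have [dc dDD dM] := d'; have := congr1 D' weq.
rewrite (der_onX sFE d' 1 Fy) dDD; try by sa.
rewrite dDD; try by sa.
rewrite (der_onX sFE d' 2 Fx) (der_iotaM sFE d') // dc => e.
apply: (mulfI yy); rewrite /k Dy; move: e; rewrite expr1 addr0 => ->.
by field; rewrite y0 two0.
Qed.

Let xi := x / y.
Let zeta := y^-1.
Let eq_inf : zeta * (1 - iota a * xi * zeta - iota b * zeta ^+ 2) = xi ^+ 3.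
Proof.
have x3 : x ^+ 3 = y ^+ 2 - iota a * x - iota b by rewrite weq; ring.
transitivity (x ^+ 3 / y ^+ 3); last by rewrite /xi; field.
by rewrite x3 /xi /zeta; field.
Qed.

Lemma curve_point_cases O : E O ->
  (O x /\ O y) \/ (max_ideal O (x / y) /\ max_ideal O y^-1).
Proof.
move=> hO; have lO := proj_local hO; have sO := local_sa lO.
have [yi [iy i0 [_ _ cO _]]] := proj1 (proj_modelP _ _ _) hO.
have hin z : z \in [:: 1; x; y] -> O (z / yi) by move=> zi; apply: cO; apply: chart_in.
have i1 := hin 1 _; have ix := hin x _; have iyy := hin y _.
move: i1 ix iyy; rewrite !inE !eqxx !orbT => /(_ isT) i1 /(_ isT) ix /(_ isT) iyy.
move: iy i0 i1 ix iyy {hin}; rewrite !inE => /or3P[] /eqP -> i0.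
- by rewrite !divr1; left.
- rewrite div1r => i1 _ iyy; case: (unit_or_mx i1) => [[_ _ ]|m1].
    rewrite invrK => Ox; left; split=> //; rewrite -[y](divfK x0).
    by sa.
  (* The chart [x ≠ 0] adds no point: dividing the Weierstrass equation by [x ^+ 3] excludes a point
     where 1/x vanishes. *)
  have : max_ideal O 1; last by move/(mxN1 sO).
  have -> : 1 = (y / x) ^+ 2 * x^-1 - (iota a * x^-1 + iota b * x^-1 ^+ 2) * x^-1 :> K.
    transitivity (x ^+ 3 / x ^+ 3); first by field.
    rewrite {1}(_ : x ^+ 3 = y ^+ 2 - iota a * x - iota b); last by rewrite weq; ring.
    by field.
  by apply: (mxB lO); apply: (mxM sO) => //; sa.
- rewrite div1r => i1 ix _; case: (unit_or_mx i1) => [[_ _ ]|m1].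
    rewrite invrK => Oy; left; split=> //; rewrite -[x](divfK y0); sa.
  right; split=> //.
  have m3 : max_ideal O (xi ^+ 3).
    by rewrite -eq_inf mulrC; apply: (mxM sO) => //; rewrite /xi /zeta; sa.
  by have := m3; rewrite exprS => /(mx_prime lO ix) [|//|]; [sa|];
    rewrite exprS => /(mx_prime lO ix) [|//|//]; rewrite expr1.
Qed.

Lemma curve_point_sub O : E O -> O `<=` FE.
Proof. by move=> hO z Oz; rewrite -curve_function_field; exists O. Qed.

Let point_loc O yi : E O -> yi \in [:: 1; x; y] -> yi != 0 ->
  (forall z, z \in [:: 1; x; y] -> O (z / yi)) -> is_loc (chart iota [:: 1; x; y] yi) O.
Proof. exact: proj_point_chart. Qed.

Let uniformizer_int_closed O pi : E O -> pi != 0 -> max_ideal O pi ->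
  (forall z, max_ideal O z -> O (z / pi)) -> int_closed FE O.
Proof.
move=> hO pi0 mpi h; have [yi [iy i0 hl]] := proj1 (proj_modelP _ _ _) hO.
have [sA lO AO OA] := hl; have sO := local_sa lO.
apply: (@dvr_in_int_closed _ _ iota FE O pi); apply: dvr_of => //.
  by apply: (noeth_loc hl); apply: noeth_chart.
rewrite -curve_function_field (function_field_proj iota iy i0) => z [c [d [Ac Ad ud ->]]].
by exists c, d; split=> //; apply: AO.
Qed.

Let preserve O yi : E O -> is_loc (chart iota [:: 1; x; y] yi) O ->
  (forall z, z \in [:: 1; x; y] -> O (D (z / yi))) -> forall z, O z -> O (D z).
Proof.
move=> hO hl h; have [sA lO AO OA] := hl; have sO := local_sa lO.
apply: (der_preserve_loc sFE (curve_point_sub hO) dD hl) => z.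
apply: (der_preserve_gen sO (der_on_mono (curve_point_sub hO) dD)) => _ [w wi <-].
  by apply: AO; apply: chart_in.
exact: h.
Qed.

(** The generic point: when no nonzero function vanishes, every nonzero function is inverted. *)
Let field_point O : E O -> is_loc (chart iota [:: 1; x; y] 1) O ->
  (forall z, chart iota [:: 1; x; y] 1 z -> max_ideal O z -> z = 0) -> int_closed FE O.
Proof.
move=> hO hl h; have [sA lO AO OA] := hl; have sO := local_sa lO.
apply: (valuation_int_closed sO) => z Fz z0; right.
move: Fz z0; rewrite -curve_function_field (@function_field_proj _ _ iota _ 1) ?oner_neq0 ?inE ?eqxx //.
move=> [c [d [Ac Ad ud ->]]] z0; rewrite invf_div.
have c0 : c != 0 by apply: contraNneq z0 => ->; rewrite mul0r.
have uc : is_unit O c by case: (unit_or_mx (AO _ Ac)) => // /(h _ Ac) e; rewrite e eqxx in c0.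
by have := AO _ Ad; have := is_unit_inV uc; move=> *; sa.
Qed.

Let chart1_form z : chart iota [:: 1; x; y] 1 z -> exists p q,
  [/\ polyin (range iota) p, polyin (range iota) q & z = p.[x] + q.[x] * y].
Proof.
have s := range_sa iota.
apply: (alg_gen_min (A := [set z | exists p q,
  [/\ polyin (range iota) p, polyin (range iota) q & z = p.[x] + q.[x] * y]])).
  split.
  - move=> c; exists (iota c)%:P, 0; split; first by apply: (polyinC s); exists c.
      by move=> i; rewrite coef0; sa.
    by rewrite hornerC horner0 mul0r addr0.
  - move=> _ _ [p [q [hp hq ->]]] [p' [q' [hp' hq' ->]]].
    exists (p - p'), (q - q'); split; [exact: (polyinB s)|exact: (polyinB s)|].
    by rewrite !(hornerD, hornerN); ring.
  - move=> _ _ [p [q [hp hq ->]]] [p' [q' [hp' hq' ->]]].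
    pose f := 'X ^+ 3 + (iota a)%:P * 'X + (iota b)%:P : {poly K}.
    have hf : polyin (range iota) f.
      have hX := polyinX s; apply: (polyinD s); first apply: (polyinD s).
      - exact: (polyinXn _ s).
      - by apply: (polyinM s) => //; apply: (polyinC s); sa.
      - by apply: (polyinC s); sa.
    exists (p * p' + q * q' * f), (p * q' + q * p'); split.
    + by apply: (polyinD s); apply: (polyinM s) => //; apply: (polyinM s).
    + by apply: (polyinD s); apply: (polyinM s).
    + have -> : forall u v u' v' : K, (u + v * y) * (u' + v' * y) =
          u * u' + v * v' * y ^+ 2 + (u * v' + v * u') * y by move=> *; ring.
      have <- : f.[x] = y ^+ 2.
        by rewrite weq /f 2!hornerD hornerXn hornerM hornerX !hornerC.
      by rewrite !(hornerD, hornerM).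
move=> _ [w wi <-]; rewrite divr1; move: wi; rewrite /= !inE => /or3P[] /eqP->.
- exists 1%:P, 0; rewrite horner0 hornerC mul0r addr0; split=> //.
    by apply: (polyinC s); sa.
  by move=> i; rewrite coef0; sa.
- exists 'X, 0; rewrite hornerX horner0 mul0r addr0; split=> //; first exact: (polyinX s).
  by move=> i; rewrite coef0; sa.
- exists 0, 1%:P; rewrite horner0 hornerC mul1r add0r; split=> //.
    by move=> i; rewrite coef0; sa.
  by apply: (polyinC s); sa.
Qed.

Let closed_point O z : local_ring O -> O x -> O y -> chart iota [:: 1; x; y] 1 z ->
  max_ideal O z -> z != 0 ->
  exists x1 y1, [/\ max_ideal O (x - iota x1), max_ideal O (y - iota y1)
    & y1 ^+ 2 = x1 ^+ 3 + a * x1 + b].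
Proof.
move=> lO Ox Oy /chart1_form [p [q [hp hq zE]]] mz z0; have sO := local_sa lO.
have [p0 pE] := polyin_range hp; have [q0 qE] := polyin_range hq.
have Op : O p.[x] by apply: (polyin_horner sO _ Ox hp) => _ [c _ <-]; sa.
have Oq : O q.[x] by apply: (polyin_horner sO _ Ox hq) => _ [c _ <-]; sa.
pose f : {poly R[i]} := 'X ^+ 3 + a%:P * 'X + b%:P.
have fE : (map_poly iota f).[x] = y ^+ 2.
  by rewrite weq !rmorphD rmorphM /= map_polyXn map_polyX !map_polyC 2!hornerD hornerXn hornerM hornerX !hornerC.
have [r r0 mr] : exists2 r : {poly R[i]}, r != 0 & max_ideal O (map_poly iota r).[x].
  (* The norm of z = p + q y down to k[x] vanishes wherever [z] does. If it is zero because the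
     conjugate p - q y is, then z = 2 p is itself a polynomial in [x]. *)
  pose r := p0 ^+ 2 - q0 ^+ 2 * f.
  have rE : (map_poly iota r).[x] = (p.[x] - q.[x] * y) * z.
    rewrite /r rmorphB /= rmorphXn rmorphM rmorphXn /= -pE -qE hornerD hornerN horner_exp hornerM horner_exp fE zE; ring.
  have [e|ne] := eqVneq (p.[x] - q.[x] * y) 0; last first.
    exists r; last by rewrite rE; apply: (mxM sO) => //; sa.
    apply: contraNneq (mulf_neq0 ne z0); rewrite -rE => ->.
    by rewrite rmorph0 horner0.
  have e' : z = 2 * p.[x].
    by rewrite zE; have /eqP := e; rewrite subr_eq0 => /eqP <-; ring.
  exists (2 *: p0).
    by apply: contraNneq z0; rewrite e' pE => /(congr1 (map_poly iota)); rewrite linearZ /= => h; move/(congr1 (horner^~ x)): h; rewrite hornerZ rmorph_nat rmorph0 horner0 => ->.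
  by rewrite linearZ /= hornerZ rmorph_nat -pE -e'.
have [x1 mx1] := max_ideal_root lO Ox r0 mr.
pose y2 := sqrtC (x1 ^+ 3 + a * x1 + b).
have y2E : y2 ^+ 2 = x1 ^+ 3 + a * x1 + b by rewrite sqrtCK.
have : max_ideal O ((y - iota y2) * (y + iota y2)).
  have -> : (y - iota y2) * (y + iota y2) = (x ^+ 2 + x * iota x1 + iota x1 ^+ 2 + iota a) * (x - iota x1).
    transitivity (y ^+ 2 - iota (y2 ^+ 2)); first by rewrite rmorphXn /=; ring.
    by rewrite weq y2E !rmorphD rmorphXn rmorphM /=; ring.
  by apply: (mxM sO) => //; sa.
case/(mx_prime lO); [sa|sa|move=> h; exists x1, y2; split=> //|move=> h; exists x1, (- y2)].
by rewrite rmorphN opprK sqrrN.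
Qed.

Let affine_point O : E O -> O x -> O y -> [/\ int_closed FE O, forall z, O z -> O (D z)
  & exists rho, O rho /\ is_unit O (D rho)].
Proof.
move=> hO Ox Oy; have lO := proj_local hO; have sO := local_sa lO.
have hl : is_loc (chart iota [:: 1; x; y] 1) O.
  apply: point_loc => //; rewrite ?inE ?eqxx ?oner_neq0 // => z; rewrite !inE divr1.
  by move=> /or3P[] /eqP-> //; sa.
have [sA _ AO OA] := hl.
have u2 : is_unit O 2 by rewrite -(rmorph_nat iota); apply: (is_unit_iota sO); rewrite pnatr_eq0.
(* A Bezout identity between the cubic and its derivative expresses the discriminant, a nonzero
   constant; both cannot vanish at a point. *)
have slope : max_ideal O y -> is_unit O (3 * x ^+ 2 + iota a).
  move=> my; case: (@unit_or_mx _ O (3 * x ^+ 2 + iota a)) => //; first by sa.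
  move=> ms; have : max_ideal O (iota (4 * a ^+ 3 + 27 * b ^+ 2)); last first.
    by case=> _ []; apply: (is_unit_iota sO).
  have -> : iota (4 * a ^+ 3 + 27 * b ^+ 2) =
     (6 * iota a * x ^+ 2 - 9 * iota b * x + 4 * iota a ^+ 2) * (3 * x ^+ 2 + iota a)
     - (18 * iota a * x - 27 * iota b) * y * y.
    have -> : (18 * iota a * x - 27 * iota b) * y * y =
        (18 * iota a * x - 27 * iota b) * (x ^+ 3 + iota a * x + iota b) by rewrite -weq; ring.
    have -> : iota (4 * a ^+ 3 + 27 * b ^+ 2) = 4 * iota a ^+ 3 + 27 * iota b ^+ 2.
      by rewrite rmorphD; congr (_ + _); rewrite rmorphM rmorph_nat rmorphXn.
    ring.
  by apply: (mxB lO); apply: (mxM sO) => //; sa.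
split.
- case: (pselect (exists z, [/\ chart iota [:: 1; x; y] 1 z, max_ideal O z & z != 0])).
    move=> [z [cz mz z0]].
    have [x1 [y1 [mx1 my1 e1]]] := closed_point lO Ox Oy cz mz z0.
    have ident : (y - iota y1) * (y + iota y1) = (x ^+ 2 + x * iota x1 + iota x1 ^+ 2 + iota a) * (x - iota x1).
      transitivity (y ^+ 2 - iota (y1 ^+ 2)); first by rewrite rmorphXn /=; ring.
      by rewrite weq e1 !rmorphD rmorphXn rmorphM /=; ring.
    have GO : [set z / 1 | z in [set` [:: 1; x; y]]] `<=` O.
      by move=> _ [w wi <-]; apply: AO; apply: chart_in.
    (* At a closed point the uniformizer is x - x1 where y ≠ 0, and [y] at a point of order two;
       [ident] expresses the other coordinate. *)
    case: (unit_or_mx Oy) => uy.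
      have up : is_unit O (y + iota y1).
        have -> : y + iota y1 = 2 * y - (y - iota y1) by ring.
        by apply: (unitDmx lO); [apply: (is_unitM sO) | apply: (mxN lO)].
      have pi0 : x - iota x1 != 0.
        apply/eqP => /eqP; rewrite subr_eq0 => /eqP e.
        have /eqP : 'X - (iota x1)%:P = 0 :> {poly K}; last by rewrite polyXsubC_eq0.
        apply: tx; last by apply/rootP; rewrite !hornerE e subrr.
        have s := range_sa iota.
        by apply: (polyinB s); [exact: (polyinX s) | apply: (polyinC s); sa].
      apply: (uniformizer_int_closed hO pi0 mx1).
      apply: (max_ideal_gen lO GO OA mx1) => // _ [w wi <-].
      rewrite divr1; move: wi; rewrite /= !inE => /or3P[] /eqP->.
      + by exists 1, 0; rewrite ?rmorph1 ?subrr ?mulr0 //; sa.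
      + by exists x1, 1; rewrite ?mulr1 //; sa.
      + exists y1, ((x ^+ 2 + x * iota x1 + iota x1 ^+ 2 + iota a) / (y + iota y1)).
          by have := is_unit_inV up; move=> *; sa.
        by rewrite mulrA (mulrC (x - _)) -ident mulfK // (is_unit_neq0 up).
    have us := slope uy.
    have y10 : y1 = 0.
      apply/eqP/negPn/negP => /(is_unit_iota sO) h.
      have : max_ideal O (iota y1); last by case.
      by have -> : iota y1 = y - (y - iota y1) by [ring]; apply: (mxB lO).
    have ut : is_unit O (x ^+ 2 + x * iota x1 + iota x1 ^+ 2 + iota a).
      have -> : x ^+ 2 + x * iota x1 + iota x1 ^+ 2 + iota a =
        3 * x ^+ 2 + iota a - (2 * x + iota x1) * (x - iota x1) by ring.
      by apply: (unitDmx lO) => //; apply: (mxN lO); apply: (mxM sO) => //; sa.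
    apply: (uniformizer_int_closed hO y0 uy).
    apply: (max_ideal_gen lO GO OA uy) => // _ [w wi <-].
    rewrite divr1; move: wi; rewrite /= !inE => /or3P[] /eqP->.
    + by exists 1, 0; rewrite ?rmorph1 ?subrr ?mulr0 //; sa.
    + exists x1, (y / (x ^+ 2 + x * iota x1 + iota x1 ^+ 2 + iota a)).
        by have := is_unit_inV ut; move=> *; sa.
      rewrite mulrA; apply: (mulIf (is_unit_neq0 ut)); rewrite divfK ?(is_unit_neq0 ut) //.
      by rewrite mulrC -ident y10 rmorph0; ring.
    + by exists 0, 1; rewrite ?rmorph0 ?subr0 ?mulr1 //; sa.
  move=> h; apply: field_point => // z cz mz; apply/eqP/negPn/negP => z0.
  by apply: h; exists z.
- apply: (preserve hO hl) => z; rewrite divr1 !inE => /or3P[] /eqP->.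
  + by case: dD => h _ _; rewrite -(rmorph1 iota) h; sa.
  + by rewrite Dx; sa.
  + by rewrite Dy; sa.
- case: (unit_or_mx Oy) => uy.
    by exists x; split=> //; rewrite Dx; apply: (is_unitM sO).
  by exists y; split=> //; rewrite Dy; apply: slope.
Qed.

(** At infinity [xi] and [zeta] vanish, so this value is a unit: the invariant differential has
    neither zero nor pole there. *)
Let D_xi : D xi = - 1 + 2 * iota a * xi * zeta + 3 * iota b * zeta ^+ 2.
Proof.
rewrite /xi (der_on_div sFE dD) // Dx Dy.
have -> : 2 * y * y - x * (3 * x ^+ 2 + iota a) = 2 * y ^+ 2 - 3 * x ^+ 3 - iota a * x by ring.
have -> : x ^+ 3 = y ^+ 2 - iota a * x - iota b by rewrite weq; ring.
by rewrite /zeta; field.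
Qed.
Let D_zeta : D zeta = - (3 * xi ^+ 2 + iota a * zeta ^+ 2).
Proof. by rewrite /zeta (der_onV sFE dD) // Dy /xi; field. Qed.

Let infinite_point O : E O -> max_ideal O xi -> max_ideal O zeta ->
  [/\ int_closed FE O, forall z, O z -> O (D z) & exists rho, O rho /\ is_unit O (D rho)].
Proof.
move=> hO mxi mze; have lO := proj_local hO; have sO := local_sa lO.
have Oxi := mx_in mxi; have Oze := mx_in mze.
have hl : is_loc (chart iota [:: 1; x; y] y) O.
  apply: point_loc => //; rewrite ?inE ?eqxx ?orbT // => z; rewrite !inE.
  by move=> /or3P[] /eqP->; rewrite ?div1r ?divff //; sa.
have [sA _ AO OA] := hl.
have uD : is_unit O (D xi).
  rewrite D_xi -addrA; apply: (unitDmx lO).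
    by rewrite -(rmorphN1 iota); apply: (is_unit_iota sO); rewrite oppr_eq0 oner_eq0.
  by apply: (mxD lO); [|rewrite expr2 mulrA]; apply: (mxM sO) => //; sa.
have ue : is_unit O (1 - iota a * xi * zeta - iota b * zeta ^+ 2).
  rewrite -addrA; apply: (unitDmx lO); first exact: (is_unit1 sO).
  by apply: (mxB lO); [apply: (mxN lO)|rewrite expr2 mulrA]; apply: (mxM sO) => //; sa.
have xi0 : xi != 0 by rewrite /xi mulf_neq0 ?invr_eq0.
split.
- apply: (uniformizer_int_closed hO xi0 mxi).
  have GO : [set z / y | z in [set` [:: 1; x; y]]] `<=` O.
    by move=> _ [w wi <-]; apply: AO; apply: chart_in.
  apply: (max_ideal_gen lO GO OA mxi) => // _ [w wi <-].
  move: wi; rewrite /= !inE => /or3P[] /eqP->.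
  + exists 0, (xi ^+ 2 / (1 - iota a * xi * zeta - iota b * zeta ^+ 2)).
      by have := is_unit_inV ue; move=> *; sa.
    rewrite rmorph0 subr0 div1r mulrA -exprS -eq_inf mulfK //; exact: is_unit_neq0 ue.
  + by exists 0, 1; rewrite ?rmorph0 ?subr0 ?mulr1 //; sa.
  + by exists 1, 0; rewrite ?divff // ?rmorph1 ?subrr ?mulr0 //; sa.
- apply: (preserve hO hl) => z; rewrite !inE => /or3P[] /eqP->.
  + by rewrite div1r -/zeta D_zeta; sa.
  + by case: uD.
  + by rewrite divff //; case: dD => h _ _; rewrite -(rmorph1 iota) h; sa.
- by exists xi.
Qed.

(** Smoothness and triviality of the canonical bundle in one statement: [D] is regular everywhere
    and vanishes nowhere, and [rho] serves as a local coordinate. *)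
Theorem curve_point O : E O -> [/\ int_closed FE O, forall z, O z -> O (D z)
  & exists rho, O rho /\ is_unit O (D rho)].
Proof.
move=> hO; case: (curve_point_cases hO) => -[h1 h2].
  exact: affine_point.
exact: infinite_point.
Qed.

End EllipticCurve.

(** * The cone *)

Section Products.
Variables (R : realType) (K : fieldType) (iota : {rmorphism R[i] -> K}).
Local Notation subalg := (subalgebra iota).
Local Notation local_ring := (local_ring iota).
Local Notation is_loc := (is_loc iota).
Local Notation subfield := (subfield iota).
Implicit Types (A B O V F I P M G : set K) (x y z u v pi : K) (p q : {poly K}) (l ys : seq K).

Lemma product_point (X1 X2 : set (set K)) O1 O2 V : local_ring V -> X1 O1 -> X2 O2 ->
  dominates V O1 -> dominates V O2 ->
  product iota X1 X2 (locin (alg_gen iota (O1 `|` O2)) V) /\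
  is_loc (alg_gen iota (O1 `|` O2)) (locin (alg_gen iota (O1 `|` O2)) V).
Proof.
move=> lV h1 h2 d1 d2; have sV := local_sa lV; have sA := alg_gen_sa iota (O1 `|` O2).
have AV : alg_gen iota (O1 `|` O2) `<=` V.
  by apply: alg_gen_min => // x [/(proj1 d1)|/(proj1 d2)].
split; last exact: is_loc_locin.
exists O1, O2, (alg_gen iota (O1 `|` O2) `&` max_ideal V); split=> //.
- exact: (prime_mx sA lV AV).
- by move=> x [mx|mx]; split; [apply: alg_gen_sub; left; apply: mx_in mx | apply: (proj2 d1)
    | apply: alg_gen_sub; right; apply: mx_in mx | apply: (proj2 d2)].
- by rewrite (localization_mx AV).
Qed.

Lemma productP (X1 X2 : set (set K)) O : product iota X1 X2 O ->
  exists O1 O2, [/\ X1 O1, X2 O2, is_loc (alg_gen iota (O1 `|` O2)) O,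
    dominates O O1 & dominates O O2].
Proof.
move=> [O1 [O2 [P [h1 h2 pP mP ->]]]]; exists O1, O2.
have sA := alg_gen_sa iota (O1 `|` O2); have [hO hm] := prime_loc sA pP.
have [_ _ AO _] := hO.
split=> //; split=> x h.
- by apply: AO; apply: alg_gen_sub; left.
- by apply/hm; [apply: alg_gen_sub; left; apply: mx_in h | apply: mP; left].
- by apply: AO; apply: alg_gen_sub; right.
- by apply/hm; [apply: alg_gen_sub; right; apply: mx_in h | apply: mP; right].
Qed.

Lemma open_in_generization X U O O' : open_in X U -> U O -> X O' -> O `<=` O' -> U O'.
Proof.
by move=> [_ h] UO XO' OO'; have [f [fO hf]] := h _ UO; apply: hf => // z /fO /OO'.
Qed.

Lemma line_bundle_unit X L O O' : line_bundle X L -> X O -> X O' -> O `<=` O' ->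
  is_unit O' (L O / L O').
Proof.
move=> hL XO XO' OO'; have [_ _ [U [oU UO hU]]] := hL _ XO.
by apply: hU; apply: open_in_generization oU UO XO' OO'.
Qed.

(* The kernel of A[u] -> A -> A/m, u |-> c. *)
Definition eval_ideal A (m : set K) u c : set K :=
  [set z | exists p, [/\ polyin A p, m p.[c] & z = p.[u]]].

(** Transcendence makes evaluation at [c] well defined on A[u]; the last clause is what it gives on
    a chosen representative. *)
Lemma eval_prime A m u c : subalg A -> (forall p, polyin A p -> p.[u] = 0 -> p = 0) ->
  A c -> prime_ideal A m ->
  prime_ideal (adj A u) (eval_ideal A m u c) /\
  forall p, polyin A p -> eval_ideal A m u c p.[u] -> m p.[c].
Proof.
move=> sA tu Ac [[mA m0] mD mM m1 mp].
have ev p : polyin A p -> A p.[c] by apply: (polyin_horner sA _ Ac) => x.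
have key p : polyin A p -> eval_ideal A m u c p.[u] -> m p.[c].
  move=> hp [q [hq mq e]]; suff -> : p = q by [].
  apply/eqP; rewrite -subr_eq0; apply/eqP/tu; first exact: (polyinB sA).
  by rewrite hornerD hornerN e subrr.
split=> //; split.
- split=> [_ [p [hp _ ->]]|]; first by exists p.
  by exists 0; rewrite !horner0; split=> // i; rewrite coef0; sa.
- move=> _ _ [p [hp mp' ->]] [q [hq mq ->]]; exists (p + q); rewrite !hornerD.
  by split=> //; [exact: (polyinD sA) | exact: mD].
- move=> _ _ [p hp <-] [q [hq mq ->]]; exists (p * q); rewrite !hornerM.
  by split=> //; [exact: (polyinM sA) | apply: mM => //; apply: ev].
- have h1 : polyin A 1%:P by apply: (polyinC sA); sa.
  by move=> h; apply: m1; rewrite -(hornerC 1 c); apply: key; rewrite ?hornerC.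
- move=> _ _ [p hp <-] [q hq <-]; rewrite -hornerM => h.
  have := key _ (polyinM sA hp hq) h; rewrite hornerM => /(mp _ _ (ev _ hp) (ev _ hq)) [h'|h'].
    by left; exists p.
  by right; exists q.
Qed.

End Products.

Section Cone.
Variables (R : realType) (K : fieldType) (iota : {rmorphism R[i] -> K}).
Local Notation subalg := (subalgebra iota).
Local Notation local_ring := (local_ring iota).
Local Notation is_loc := (is_loc iota).
Local Notation subfield := (subfield iota).
Local Notation noeth := (@noeth K).
Local Notation dvr := (dvr_in iota setT).
Implicit Types (B O V F I P M G : set K) (z v pi : K) (p q : {poly K}) (l ys : seq K).

Variables (E : set (set K)) (A : set K -> K) (t : K) (n : nat) (s : n.+1.-tuple K) (w : K).
Local Notation P1 := (projective_line iota t).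
Local Notation S := (product iota P1 E).
Local Notation L := (box_tensor P1 E (tensor_power (twisting_sheaf [:: 1; t]) 2)
                           (tensor_power A 2)).
Local Notation C := (projective_cone iota s w).
Local Notation FE := (function_field E).
Local Notation FS := (function_field S).

Hypothesis hE : elliptic_curve iota E.
Hypothesis ht : transcendental_over FE t.
Hypothesis hA : line_bundle E A.
Hypothesis aA : ample iota E A.
Hypothesis hs : complete_embedding iota S L s.
Hypothesis hw : transcendental_over FS w.
Hypothesis hC : function_field C = setT.

(** [gen b] is the homogeneous coordinate generating O(1) on a standard chart of P^1 and [tau b] is
    the affine coordinate of that chart. *)
Let gen (b : bool) : K := if b then t else 1.
Let tau (b : bool) : K := if b then t^-1 else t.

(** * Points of the elliptic curve *)

Lemma E_proj : exists ys yi, [/\ E = proj_model iota ys, yi \in ys & yi != 0].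
Proof.
have [a [b [x [y [_ _ _ ->]]]]] := hE; exists [:: 1; x; y], 1.
by rewrite inE eqxx oner_neq0.
Qed.
Lemma E_local O : E O -> local_ring O.
Proof. by have [ys [_ [-> _ _]]] := E_proj; exact: proj_local. Qed.
Lemma sfE : subfield FE.
Proof.
by have [ys [yi [-> iy i0]]] := E_proj; rewrite (function_field_proj iota iy i0); apply: subfield_locin; sa.
Qed.
Let sFE := sfE.
Let saFE : subalg FE := subfield_sa sfE.
Lemma E_sub O : E O -> O `<=` FE. Proof. by move=> hO z Oz; exists O. Qed.
Lemma E_noeth O : E O -> noeth O.
Proof.
have [ys [_ [-> _ _]]] := E_proj => /proj_modelP [yi [_ _ hl]].
by apply: (noeth_loc hl); apply: noeth_chart.
Qed.
Lemma E_frac O : E O -> FE `<=` locin O setT.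
Proof.
have [ys [_ [-> _ _]]] := E_proj => /proj_modelP [yi [iy i0 [_ _ cO _]]].
rewrite (function_field_proj iota iy i0) => z [c [d [Ac Ad ud ->]]].
by exists c, d; split=> //; apply: cO.
Qed.
Lemma E_over O V : E O -> local_ring V -> O `<=` V ->
  [/\ E (locin O V), locin O V `<=` V & dominates V (locin O V)].
Proof. by have [ys [_ [-> _ _]]] := E_proj; exact: proj_over. Qed.
Lemma E_generic : E FE.
Proof.
have [ys [yi [-> iy i0]]] := E_proj; rewrite (function_field_proj iota iy i0).
by case: (proj_point iy i0 (local_setT iota) (fun _ _ => I)).
Qed.

Lemma A_neq0 O : E O -> A O != 0.
Proof. by move=> /hA []. Qed.

Lemma t0 : t != 0.
Proof.
apply/eqP => t0; have /eqP : ('X : {poly K}) = 0; last by rewrite polyX_eq0.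
by apply: ht; [exact: (polyinX saFE) | apply/rootP; rewrite hornerX].
Qed.
Let t_n0 := t0.
Lemma gen_neq0 b : gen b != 0. Proof. by case: b; rewrite /gen ?oner_neq0. Qed.
Lemma tau_transc b : transcendental_over FE (tau b).
Proof. by case: b => //; exact: (transc_inv saFE ht). Qed.

(** * Points of the surface and generators of L *)

Lemma P1_twist O : P1 O -> exists b, [/\ twisting_sheaf [:: 1; t] O = gen b,
  O (tau b) & is_loc (chart iota [:: 1; t] (gen b)) O].
Proof.
move=> hO; have lO := proj_local hO; have sO := local_sa lO.
have [yi [iy i0 [_ _ cO _]]] := proj1 (proj_modelP _ _ _) hO.
have ex : exists g, [set g | [/\ g \in [:: 1; t], g != 0 & forall z, z \in [:: 1; t] -> O (z / g)]] g.
  by exists yi; split=> // z hz; apply: cO; apply: chart_in.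
have := xgetPex 0 ex; rewrite -/(twisting_sheaf [:: 1; t] O).
set g := twisting_sheaf _ _ => -[gi g0 hg].
have hl := proj_point_chart hO gi g0 hg.
move: gi hl hg; rewrite !inE => /orP[] /eqP -> hl hg.
  by exists false; split=> //; rewrite -[tau _]divr1; apply: hg; rewrite !inE eqxx orbT.
by exists true; split=> //; rewrite /tau -div1r; apply: hg; rewrite !inE eqxx.
Qed.

(** Presents a point of the product as a localization of a polynomial ring over a local ring of E,
    the form in which normality and derivations are understood. *)
Lemma S_point O : S O -> exists b O2, [/\ E O2, dominates O O2, O (tau b),
  is_loc (adj O2 (tau b)) O & L O = gen b ^+ 2 * A O2 ^+ 2].
Proof.
move=> /productP [O1 [O2 [h1 h2 hl d1 d2]]]; have [_ lO _ OA] := hl; have sO := local_sa lO.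
have [b [hb tO1 hc]] := P1_twist h1.
have s2 := local_sa (E_local h2).
have tO : O (tau b) by apply: (proj1 d1).
exists b, O2; split=> //; last first.
  rewrite /box_tensor /tensor_power (center_proj lO h1 d1) hb.
  have [ys [_ [eE _ _]]] := E_proj; rewrite {1}eE (center_proj lO _ d2) //.
  by rewrite -eE.
have sA := adj_sa (tau b) s2.
have AO : adj O2 (tau b) `<=` O := adj_min sO (proj1 d2) tO.
have saL := locin_sa sA sO.
apply: (is_loc_trans hl sA AO); apply: (alg_gen_min saL) => z [O1z|O2z]; last first.
  by apply: (locin_sub sA sO); apply: (adj_base (tau b) s2).
have [_ lO1 cO1 O1c] := hc; have [c [d [cc cd ud ->]]] := O1c _ O1z.
have sub : chart iota [:: 1; t] (gen b) `<=` adj O2 (tau b).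
  apply: (chart_min sA) => y; have := adj_gen (tau b) s2; rewrite !inE.
  case: b {hb tO1 tO hc sA AO saL O1c cO1 cc cd} => hg /orP[] /eqP->; rewrite /gen ?divr1 ?div1r ?divff //; sa.
exists c, d; split=> //; [exact: sub|exact: sub|].
by apply: is_unit_mono ud; case: d1.
Qed.

(** [V] need not dominate [O2], so its center on E may be a generization of [O2]; the generators of
    L at the two points still differ by a unit. *)
Lemma S_over V O2 b : local_ring V -> E O2 -> O2 `<=` V -> V (tau b) ->
  exists O, [/\ S O, O `<=` V, dominates V O, O2 `<=` O /\ O (tau b)
    & is_unit O (L O / (gen b ^+ 2 * A O2 ^+ 2))].
Proof.
move=> lV h2 O2V Vt; have sV := local_sa lV.
have gi : gen b \in [:: 1; t] by case: b {Vt}; rewrite /gen !inE eqxx ?orbT.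
have hg z : z \in [:: 1; t] -> V (z / gen b).
  by rewrite !inE => /orP[] /eqP ->; move: Vt; rewrite /gen /tau; case: (b) => Vt;
    rewrite ?divr1 ?div1r ?divff //; sa.
have [P1O1 hl1 O1V d1] := proj_point gi (gen_neq0 b) lV hg.
set O1 := locin _ V in P1O1 hl1 O1V d1.
have [EO2' O2'V d2] := E_over h2 lV O2V; set O2' := locin O2 V in EO2' O2'V d2.
have [SO hl] := product_point lV P1O1 EO2' d1 d2.
have sA := alg_gen_sa iota (O1 `|` O2').
have AV : alg_gen iota (O1 `|` O2') `<=` V by apply: (alg_gen_min sV) => x [/O1V|/O2'V].
set O := locin _ V in SO hl.
have dVO : dominates V O := locin_dom sA lV AV.
have [OV _] := dVO; have [_ lO AO _] := hl; have sO := local_sa lO.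
have s2 := local_sa (E_local h2); have lO2' := E_local EO2'; have [_ lO1 c1 _] := hl1.
have O1O : O1 `<=` O by move=> z hz; apply: AO; apply: alg_gen_sub; left.
have O2'O : O2' `<=` O by move=> z hz; apply: AO; apply: alg_gen_sub; right.
have O2O2' : O2 `<=` O2' by apply: (locin_sub s2 sV).
have dom (Q : set K) : local_ring Q -> Q `<=` O -> dominates V Q -> dominates O Q.
  move=> lQ QO [QV mQ]; split=> // z mz; split; first by apply: QO; case: mz.
  by move/(is_unit_mono OV); case: (mQ _ mz).
have dO1 := dom _ lO1 O1O d1; have dO2 := dom _ lO2' O2'O d2.
have gO1 z : z \in [:: 1; t] -> O1 (z / gen b) by move=> hz; apply: c1; apply: chart_in.
exists O; split=> //.
  split; first by apply: subset_trans O2'O.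
  apply: O1O; move: gO1; rewrite /tau /gen; case: (b) => gO1.
    by rewrite -div1r; apply: gO1; rewrite !inE eqxx.
  by rewrite -[t]divr1; apply: gO1; rewrite !inE eqxx orbT.
have [b' [hb' tO1' hc']] := P1_twist P1O1.
rewrite /box_tensor /tensor_power (center_proj lO P1O1 dO1) hb'.
have [ys [_ [eE _ _]]] := E_proj; rewrite {1}eE (center_proj lO _ dO2); last by rewrite -eE.
have [A0 _ _] := hA h2; have [A0' _ _] := hA EO2'.
have ug : is_unit O (gen b' / gen b).
  have gi' : gen b' \in [:: 1; t] by case: (b'); rewrite /gen !inE eqxx ?orbT.
  split; first by rewrite mulf_neq0 ?invr_eq0 ?gen_neq0.
    by apply: O1O; apply: gO1.
  by rewrite invf_div; apply: O1O; case: hc' => _ _ h _; apply: h; apply: chart_in.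
have uA : is_unit O (A O2' / A O2).
  rewrite -invf_div; apply: is_unitV; apply: (is_unit_mono O2'O).
  exact: (line_bundle_unit hA h2 EO2' O2O2').
have -> : gen b' ^+ 2 * A O2' ^+ 2 / (gen b ^+ 2 * A O2 ^+ 2) =
   (gen b' / gen b) ^+ 2 * (A O2' / A O2) ^+ 2.
  by field; rewrite A0 gen_neq0.
by apply: (is_unitM sO); apply: (is_unitX _ sO).
Qed.

Lemma S_proj : proj_model iota s = S. Proof. by case: hs. Qed.
Lemma section_in O z : S O -> z \in (s : seq K) -> O (z / L O).
Proof.
move=> SO /tnthP[j ->]; rewrite (tnth_nth 0); have [[hb _] _ _] := hs.
have [_ h] : global_sections S L s`_j; last exact: h.
apply/hb; exists (fun k => (k == j)%:R); rewrite (bigD1 j) //= eqxx rmorph1 mul1r.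
by rewrite big1 ?addr0 // => k /negPf->; rewrite rmorph0 mul0r.
Qed.
Lemma section_unit O : S O -> exists2 z, z \in (s : seq K) & is_unit O (z / L O).
Proof. by have [_ h _] := hs; exact: h. Qed.
Lemma L_neq0 O : S O -> L O != 0.
Proof. by move=> /section_unit [z _ [h _ _]]; apply: contraNneq h => ->; rewrite invr0 mulr0. Qed.
Lemma S_local O : S O -> local_ring O.
Proof. by rewrite -S_proj; exact: proj_local. Qed.

Lemma S_generic : exists O, [/\ S O, FE `<=` O & O t].
Proof.
have [O [SO _ _ [h1 h2] _]] := @S_over setT FE false (local_setT iota) E_generic (fun _ _ => I) I.
by exists O.
Qed.
Lemma S_pivot : exists2 sa, sa \in (s : seq K) & sa != 0.
Proof.
have [O [SO _ _]] := S_generic; have [z zs [h _ _]] := section_unit SO.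
by exists z => //; apply: contraNneq h => ->; rewrite mul0r.
Qed.
Lemma sfS : subfield FS.
Proof.
have [sa sas sa0] := S_pivot; rewrite -S_proj (function_field_proj iota sas sa0).
by apply: subfield_locin; sa.
Qed.
Let sFS := sfS.
Let saFS : subalg FS := subfield_sa sfS.
Lemma FE_FS : FE `<=` FS.
Proof. by have [O [SO h _]] := S_generic => z /h Oz; exists O. Qed.
Lemma tau_FS b : FS (tau b).
Proof.
have FSt : FS t by have [O [SO _ h]] := S_generic; exists O.
by case: b; rewrite /tau //; apply: (sfV sFS).
Qed.
Lemma gen_FS b : FS (gen b).
Proof.
have FSt : FS t by exact: (tau_FS false).
by case: b; rewrite /gen //; sa.
Qed.
Lemma FS_gen b : FS = locin (adj FE (tau b)) setT.
Proof.
apply/seteqP; split; last exact: (adj_field_min sFS FE_FS (tau_FS b)).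
move=> z [O SO]; have [b' [O2 [h2 _ _ [_ _ _ h] _]]] := S_point SO => /h.
have sF := subfield_adj (tau b) sFE; have sFa := subfield_sa sF.
apply: (locin_min sF); apply: (adj_min sFa).
  by apply: subset_trans (E_sub h2) (adj_sub_field (tau b) sFE).
have ht' := adj_field_gen (tau b) sFE.
have [<- //|] := eqVneq b b'.
have := sfV sF ht'; case: b b' {h ht' sF sFa} => -[] //=; rewrite /tau ?invrK //.
Qed.
Lemma section_FS z : z \in (s : seq K) -> FS z.
Proof.
move=> zs; have [O [SO _ _]] := S_generic.
have [b [O2 [h2 _ _ _ LE]]] := S_point SO.
have FA : FS (A O2) by apply: FE_FS; case: (hA h2).
have FO := section_in SO zs; have Fz : FS (z / L O) by exists O.
rewrite -(divfK (L_neq0 SO) z) {2}LE; have := gen_FS b; move=> *; sa.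
Qed.

Lemma w_neq0 : w != 0.
Proof.
apply/eqP => w0; have /eqP : ('X : {poly K}) = 0; last by rewrite polyX_eq0.
by apply: hw; [exact: (polyinX saFS) | apply/rootP; rewrite hornerX].
Qed.
Let w0 := w_neq0.

Lemma K_gen : locin (adj FS w) setT = setT.
Proof.
apply/seteqP; split=> // z _; have [sa' sas sa0] := S_pivot.
have : function_field C z by rewrite hC.
rewrite /projective_cone (@function_field_proj _ _ iota _ sa') ?mem_rcons ?inE ?sas ?orbT //.
have sF := subfield_adj w sFS; have sFa := subfield_sa sF.
apply: (locin_min sF); apply: (chart_min sFa) => y; rewrite mem_rcons inE.
have Fsa : locin (adj FS w) setT sa' by apply: (adj_sub_field w sFS); apply: section_FS.
move=> /orP[/eqP->|ys]; apply: (sf_div sF) => //.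
  exact: (adj_field_gen w sFS).
by apply: (adj_sub_field w sFS); apply: section_FS.
Qed.

(* A local ring V containing all s_i / sa lies over a point of S, and sa generates
   L there. *)
Lemma local_chart V sa' : local_ring V -> sa' \in (s : seq K) -> sa' != 0 ->
  (forall z, z \in (s : seq K) -> V (z / sa')) ->
  exists O, [/\ S O, O `<=` V, dominates V O, is_loc (chart iota s sa') O & is_unit O (sa' / L O)].
Proof.
move=> lV sas sa0 h; have [hO hl OV dV] := proj_point sas sa0 lV h.
rewrite S_proj in hO; exists (locin (chart iota s sa') V); split=> //.
set O := locin _ _ in hO hl OV dV *.
have [_ lO cO _] := hl; have sO := local_sa lO; have L0 := L_neq0 hO.
have [z zs uz] := section_unit hO.
split; [by rewrite mulf_neq0 ?invr_eq0 | exact: section_in |].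
have z0 : z != 0 by case: uz => [h' _ _]; apply: contraNneq h' => ->; rewrite mul0r.
have -> : (sa' / L O)^-1 = (z / L O)^-1 * (z / sa') by field; rewrite z0 sa0 L0.
have := is_unit_inV uz; have := cO _ (chart_in sa' zs); move=> *; sa.
Qed.

(** * Charts of the total space of the dual of L *)

Lemma E_normal O : E O -> int_closed FE O.
Proof.
have [a [b [x [y [disc tx weq ->]]]]] := hE => hO.
have [D [dD Dx Dy]] := curve_der tx weq.
have [h _ _] := curve_point disc tx weq dD Dx Dy hO.
by rewrite curve_function_field.
Qed.

(** A local generator of L divided by [w]: the fibre coordinate of the dual line bundle, vanishing
    on the zero section. *)
Definition ucoord b (O2 : set K) : K := gen b ^+ 2 * A O2 ^+ 2 / w.
Definition base_ring b (O2 : set K) : set K := adj O2 (tau b).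
Definition total_ring b (O2 : set K) : set K := adj (base_ring b O2) (ucoord b O2).

Section Chart.
Variables (b : bool) (O2 : set K).
Hypothesis h2 : E O2.
Local Notation u := (ucoord b O2).
Local Notation Rg := (base_ring b O2).
Local Notation RU := (total_ring b O2).
Let s2 : subalg O2 := local_sa (E_local h2).

Lemma scale_FS : FS (gen b ^+ 2 * A O2 ^+ 2).
Proof.
have FA : FS (A O2) by apply: FE_FS; case: (hA h2).
by have := gen_FS b; move=> *; sa.
Qed.
Lemma scale_neq0 : gen b ^+ 2 * A O2 ^+ 2 != 0.
Proof. by rewrite mulf_neq0 ?expf_neq0 ?gen_neq0 //; case: (hA h2). Qed.
Lemma base_sa : subalg Rg. Proof. exact: (adj_sa _ s2). Qed.
Let sR := base_sa.
Lemma total_sa : subalg RU. Proof. exact: (adj_sa _ sR). Qed.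
Let sRU := total_sa.
Lemma base_FS : Rg `<=` FS.
Proof.
apply: (adj_min saFS); last exact: tau_FS.
exact: subset_trans (E_sub h2) FE_FS.
Qed.
Lemma ucoord_transc : transcendental_over FS u.
Proof. exact: (transc_scale sFS (transc_inv saFS hw) scale_FS scale_neq0). Qed.
Lemma ucoord_neq0 : u != 0.
Proof. by rewrite mulf_neq0 ?invr_eq0 // scale_neq0. Qed.
Lemma total_noeth : noeth RU.
Proof. exact: (hilbert_basis sR (hilbert_basis s2 (E_noeth h2))). Qed.
Lemma base_noeth : noeth Rg.
Proof. exact: (hilbert_basis s2 (E_noeth h2)). Qed.
Lemma K_ucoord : locin (adj FS u) setT = setT.
Proof.
have sF := subfield_adj u sFS.
apply/seteqP; split=> // z _; have : locin (adj FS w) setT z by rewrite K_gen.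
apply: (adj_field_min sF (adj_sub_field u sFS)).
have Fu := adj_field_gen u sFS; have Fg := adj_sub_field u sFS scale_FS.
have -> : w = gen b ^+ 2 * A O2 ^+ 2 / u.
  by rewrite /ucoord invf_div mulrC divfK // scale_neq0.
exact: (sf_div sF).
Qed.
(** Two polynomial extensions, by [tau b] over the function field of E and by the fibre coordinate
    over that of S, starting from a normal local ring of E. *)
Lemma total_closed : int_closed setT RU.
Proof.
have h : int_closed FS Rg.
  by rewrite (FS_gen b); exact: (adj_int_closed sFE s2 (E_sub h2) (E_normal h2) (@tau_transc b)).
move=> z _ hz; have Fz : locin (adj FS u) setT z by rewrite K_ucoord.
exact: (adj_int_closed sFS sR base_FS h ucoord_transc Fz hz).
Qed.
Lemma base_frac : FS `<=` locin Rg setT.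
Proof.
have sF := subfield_locin sR; rewrite [FS](FS_gen b).
apply: (adj_field_min sF); last first.
  by apply: (locin_sub sR (setT_sa iota)); apply: (adj_gen _ s2).
move=> z /(E_frac h2) [c [d [Oc Od ud ->]]]; exists c, d; split=> //; exact: (adj_base _ s2).
Qed.
Lemma base_total : Rg `<=` RU. Proof. exact: (adj_base _ sR). Qed.
Lemma ucoord_total : RU u. Proof. exact: (adj_gen _ sR). Qed.
Lemma total_frac : setT `<=` locin RU setT.
Proof.
have sF := subfield_locin sRU => z0 _; have : locin (adj FS u) setT z0 by rewrite K_ucoord.
apply: (adj_field_min sF); last exact: (locin_sub sRU (setT_sa iota) ucoord_total).
move=> z /base_frac [c [d [Oc Od ud ->]]]; exists c, d; split=> //; exact: base_total.
Qed.

(** Regularity is known only at points of S; the base ring is recovered as the intersection of its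
    localizations, each of which lies over such a point. *)
Lemma section_base z : z \in (s : seq K) -> Rg (z / (gen b ^+ 2 * A O2 ^+ 2)).
Proof.
move=> zs; apply: (noeth_local_global sR base_noeth) => V [_ lV RV _].
have [||O [SO OV _ _ uL]] := @S_over V O2 b lV h2.
- by apply: subset_trans RV; apply: (adj_base _ s2).
- by apply: RV; apply: (adj_gen _ s2).
have sV := local_sa lV.
have -> : z / (gen b ^+ 2 * A O2 ^+ 2) = (z / L O) * (L O / (gen b ^+ 2 * A O2 ^+ 2)).
  by rewrite mulrA divfK // L_neq0.
have := OV _ (section_in SO zs); have := OV _ (is_unit_in uL); move=> *; sa.
Qed.

Lemma affine_cone_coord z : z \in (s : seq K) -> exists2 r, Rg r & z / w = u * r.
Proof.
move=> zs; exists (z / (gen b ^+ 2 * A O2 ^+ 2)); first exact: section_base.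
have := scale_neq0; rewrite mulf_eq0 negb_or !expf_eq0 /= => /andP[g0 A0].
by rewrite /ucoord; field; rewrite g0 A0.
Qed.

(** Functions on the affine cone are constant along the zero section, which is thus contracted to
    the vertex. *)
Lemma affine_cone_total z : chart iota s w z -> exists c, exists2 r, RU r & z = iota c + u * r.
Proof.
apply: (alg_gen_min (A := [set z | exists c, exists2 r, RU r & z = iota c + u * r])).
  split.
  - by move=> c; exists c, 0; rewrite ?mulr0 ?addr0 //; sa.
  - move=> _ _ [c [r hr ->]] [d [r' hr' ->]]; exists (c - d), (r - r'); first by sa.
    by rewrite rmorphB; ring.
  - move=> _ _ [c [r hr ->]] [d [r' hr' ->]].
    exists (c * d), (r * (iota d + u * r') + iota c * r').
      by have := ucoord_total; move=> *; sa.
    by rewrite rmorphM; ring.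
move=> _ [z' zs <-]; have [r hr e] := affine_cone_coord zs.
by exists 0, r; [exact: base_total | rewrite rmorph0 add0r].
Qed.

(** Away from the zero section the blowup is an isomorphism: there a section generating L is a unit
    times [w], and [u] is recovered from the cone coordinates. *)
Lemma cone_point V : is_loc RU V -> is_unit V u -> C V.
Proof.
move=> hl uu; have [_ lV RV _] := hl; have sV := local_sa lV.
have O2V : O2 `<=` V.
  by apply: subset_trans RV; apply: subset_trans base_total; apply: (adj_base _ s2).
have tV : V (tau b) by apply: RV; apply: base_total; apply: (adj_gen _ s2).
have [O [SO OV dO [O2O tO] uL]] := S_over lV h2 O2V tV.
have lO := S_local SO; have sO := local_sa lO; have L0 := L_neq0 SO.
have [sa' sas us] := section_unit SO.
have sa0 : sa' != 0 by case: us => h _ _; apply: contraNneq h => ->; rewrite mul0r.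
have Oz z : z \in (s : seq K) -> O (z / sa').
  move=> zs; have := section_in SO zs; have := is_unit_inV us.
  have -> : z / sa' = z / L O * (sa' / L O)^-1 by field; rewrite L0 sa0.
  by move=> *; sa.
have unit_eq : sa' / w = (sa' / L O) * (L O / (gen b ^+ 2 * A O2 ^+ 2)) * u.
  have := scale_neq0; rewrite mulf_eq0 negb_or !expf_eq0 /= => /andP[g0 A0].
  by rewrite /ucoord; field; rewrite L0 w0 g0 A0.
have uw : is_unit V (sa' / w).
  rewrite unit_eq; apply: (is_unitM sV) => //; apply: (is_unitM sV).
    exact: is_unit_mono us.
  exact: is_unit_mono uL.
have wV : V (w / sa') by rewrite -invf_div; apply: is_unit_inV uw.
have hz z : z \in rcons s w -> V (z / sa').
  by rewrite mem_rcons inE => /orP[/eqP->//|/Oz/OV].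
have sas' : sa' \in rcons s w by rewrite mem_rcons inE sas orbT.
have [CV _ _ _] := proj_point sas' sa0 lV hz.
suff hl' : is_loc (chart iota (rcons s w) sa') V by rewrite (is_locE hl').
have sB := chart_sa iota (rcons s w) sa'.
have BV := chart_min sV hz.
apply: (is_loc_trans hl sB BV).
have sL := locin_sa sB sV.
have OB : O `<=` locin (chart iota (rcons s w) sa') V.
  have hO : is_loc (chart iota s sa') O by apply: proj_point_chart => //; rewrite S_proj.
  have [_ _ _ h] := hO; move=> z /h [c [d [cc cd ud ->]]].
  have sub : chart iota s sa' `<=` chart iota (rcons s w) sa'.
    apply: (chart_min sB) => y ys; apply: chart_in; by rewrite mem_rcons inE ys orbT.
  exists c, d; split=> //; [exact: sub|exact: sub|exact: is_unit_mono ud].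
apply: (adj_min sL); first apply: (adj_min sL).
- exact: subset_trans OB.
- exact: OB.
have -> : u = (L O / sa') * (L O / (gen b ^+ 2 * A O2 ^+ 2))^-1 * (w / sa')^-1.
  have := scale_neq0; rewrite mulf_eq0 negb_or !expf_eq0 /= => /andP[g0 A0].
  by rewrite /ucoord; field; rewrite L0 w0 g0 A0 sa0.
apply: (saM sL); last first.
  have Bw : chart iota (rcons s w) sa' (w / sa') by apply: chart_in; rewrite mem_rcons inE eqxx.
  apply: is_unit_inV; apply: (locin_unit sB sV BV); first exact: (locin_sub sB sV).
  by rewrite -invf_div; apply: is_unitV.
apply: (saM sL); apply: OB; last exact: is_unit_inV uL.
by rewrite -invf_div; apply: is_unit_inV us.
Qed.

End Chart.

(** * The zero section, the vertex and regularity near it *)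

Lemma prime0 B : subalg B -> prime_ideal B [set 0].
Proof.
move=> sB; split.
- by split=> // _ ->; sa.
- by move=> _ _ -> ->; rewrite addr0.
- by move=> c _ _ ->; rewrite mulr0.
- by move/eqP; rewrite oner_eq0.
- by move=> c d _ _ /eqP; rewrite mulf_eq0 => /orP[] /eqP ->; [left|right].
Qed.

Lemma poly_at0 p z : exists q, p.[z] = p`_0 + z * q.[z] /\ forall B, polyin B p -> polyin B q.
Proof.
exists (drop_poly 1 p); split; last by move=> B hp j; rewrite coef_drop_poly.
rewrite -{1}(poly_take_drop 1 p) hornerD hornerM hornerXn expr1 mulrC; congr (_ + _).
suff -> : take_poly 1 p = (p`_0)%:P by rewrite hornerC.
by apply/polyP => j; rewrite coef_take_poly coefC; case: j.
Qed.

(* The exceptional divisor of the blowup of the vertex. *)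
Definition zero_section : set K :=
  localization (adj FS w^-1) (eval_ideal FS [set 0] w^-1 0).
Local Notation ZS := zero_section.
Let sL : subalg (adj FS w^-1) := adj_sa w^-1 saFS.

Lemma zs_loc_mx : is_loc (adj FS w^-1) ZS /\
  forall p, polyin FS p -> (max_ideal ZS p.[w^-1] <-> p`_0 = 0).
Proof.
have F0 : FS 0 by sa.
have [|pP hP] := eval_prime saFS _ F0 (prime0 saFS) (u := w^-1).
  by move=> p hp e; apply: (transc_inv saFS hw) => //; apply/rootP.
have [h1 h2] := prime_loc sL pP; split=> // p hp.
have Ap : adj FS w^-1 p.[w^-1] by exists p.
rewrite h2 //; split=> [h|e]; first by rewrite -horner_coef0; exact: hP.
by exists p; rewrite horner_coef0.
Qed.
Lemma zs_loc : is_loc (adj FS w^-1) ZS. Proof. by case: zs_loc_mx. Qed.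
Lemma zs_mx p : polyin FS p -> (max_ideal ZS p.[w^-1] <-> p`_0 = 0).
Proof. by case: zs_loc_mx => _; apply. Qed.
Lemma zs_local : local_ring ZS. Proof. by case: zs_loc. Qed.
Let lZ := zs_local.
Let sZ : subalg ZS := local_sa zs_local.
Lemma FS_zs : FS `<=` ZS.
Proof. by have [_ _ h _] := zs_loc; apply: subset_trans h; apply: (adj_base w^-1 saFS). Qed.
Lemma FS_zs_unit z : FS z -> z != 0 -> is_unit ZS z.
Proof. by move=> Fz z0; split=> //; apply: FS_zs => //; apply: (sfV sFS). Qed.
Lemma FS_zs_mx z : FS z -> max_ideal ZS z -> z = 0.
Proof. by move=> Fz [_ nu]; apply/eqP/negPn/negP => /(FS_zs_unit Fz). Qed.
Lemma zs_w : max_ideal ZS w^-1.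
Proof.
have h := polyinX saFS; have := proj2 (zs_mx h); rewrite hornerX; apply.
by rewrite coefX.
Qed.

Lemma zs_dvr_w : dvr ZS w^-1.
Proof.
apply: dvr_of => //.
- by apply: (noeth_loc zs_loc); apply: (hilbert_basis saFS); exact: (noeth_sf sFS).
- have sF := subfield_locin sZ => z _; have : locin (adj FS w) setT z by rewrite K_gen.
  have h := locin_sub sZ (setT_sa iota).
  apply: (adj_field_min sF); first by apply: subset_trans h; exact: FS_zs.
  by rewrite -(invrK w); apply: (sfV sF); apply: h; case: zs_w.
- by rewrite invr_eq0.
- exact: zs_w.
move=> z mz; have [_ _ AZ ZA] := zs_loc; have [c [d [[p hp pE] Ad ud zE]]] := ZA _ (mx_in mz).
have [q [qE hq]] := poly_at0 p w^-1.
have : max_ideal ZS p.[w^-1].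
  have -> : p.[w^-1] = d * z by rewrite zE pE mulrC divfK // (is_unit_neq0 ud).
  by apply: (mxM sZ) => //; apply: AZ.
move/(zs_mx hp) => p0; rewrite p0 add0r in qE.
have -> : z / w^-1 = q.[w^-1] * d^-1.
  by rewrite zE -pE qE; fld.
have : ZS q.[w^-1] by apply: AZ; exists q => //; exact: hq.
by have := is_unit_inV ud; move=> *; sa.
Qed.

Section ZeroSectionChart.
Variables (b : bool) (O2 : set K).
Hypothesis h2 : E O2.
Local Notation u := (ucoord b O2).
Local Notation Rg := (base_ring b O2).
Local Notation RU := (total_ring b O2).
Let sR : subalg Rg := base_sa b h2.
Let sRU : subalg RU := total_sa b h2.
Let scF := scale_FS b h2.
Let sc0 := scale_neq0 b h2.

Lemma ucoord_zs : max_ideal ZS u.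
Proof. by apply: (mxM sZ); [apply: FS_zs | exact: zs_w]. Qed.
Lemma total_zs : RU `<=` ZS.
Proof.
apply: (adj_min sZ); last by case: ucoord_zs.
by apply: subset_trans FS_zs; exact: base_FS.
Qed.
Lemma zs_total : is_loc RU ZS.
Proof.
apply: (is_loc_trans zs_loc sRU total_zs).
have sl := locin_sa sRU sZ; have FR : FS `<=` locin RU ZS.
  move=> z /(base_frac b h2) [c [d [Rc Rd /is_unit_setT d0 ->]]]; exists c, d; split=> //.
  - exact: base_total.
  - exact: base_total.
  - by apply: FS_zs_unit => //; apply: base_FS Rd.
apply: (adj_min sl) => //.
have -> : w^-1 = (gen b ^+ 2 * A O2 ^+ 2)^-1 * u by rewrite /ucoord mulKf.
apply: (saM sl); first by apply: FR; apply: (sfV sFS).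
by apply: (locin_sub sRU sZ); apply: ucoord_total.
Qed.
(** [u] and [w^-1] differ by a nonzero element of the function field of S, a unit along the zero
    section; each chart may use its own fibre coordinate. *)
Lemma zs_dvr : dvr ZS u.
Proof.
have [_ _ _ h] := zs_dvr_w; split=> //; [exact: ucoord_neq0 | exact: ucoord_zs|].
move=> z _ z0; have [m um] := h z I z0; exists m.
have -> : z / u ^ m = (z / w^-1 ^ m) / (gen b ^+ 2 * A O2 ^+ 2) ^ m.
  by rewrite /ucoord exprzMl ?unitfE // ?invr_eq0 //; field; rewrite !expfz_neq0 ?invr_eq0.
apply: (is_unit_div sZ) => //; apply: FS_zs_unit; last by rewrite expfz_neq0.
by case: m {um} => m; rewrite ?NegzE -?exprnP -?exprnN -?exprVn; have := sfV sFS scF; move=> *; sa.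
Qed.
Lemma ord_ucoord : ord ZS u = 1. Proof. exact: ord_pi zs_dvr. Qed.
Lemma poly_zs_unit p : polyin Rg p -> p`_0 != 0 -> is_unit ZS p.[u].
Proof.
move=> hp p0; have [q [-> hq]] := poly_at0 p u.
apply: (unitDmx lZ); first by apply: FS_zs_unit => //; apply: base_FS (hp _).
by rewrite mulrC; apply: (mxM sZ); [apply: total_zs; exists q => //; exact: hq | exact: ucoord_zs].
Qed.
(** A denominator without constant term would be a multiple of [u] and not a unit, so [V] is
    contained in [ZS]; nothing lies strictly between [V] and the whole field. *)
Lemma dvr_zero_section V pi : dvr V pi -> is_loc RU V -> max_ideal V u -> V = ZS.
Proof.
move=> hV hl mu; have [_ lV RV VR] := hl; have sV := local_sa lV.
have VZ : V `<=` ZS.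
  move=> z /VR [c [d [Rc [q hq qE] ud ->]]].
  have q0 : q`_0 != 0.
    apply/eqP => q0; have [r [rE hr]] := poly_at0 q u.
    have : max_ideal V d; last by case.
    rewrite -qE rE q0 add0r mulrC; apply: (mxM sV) => //; apply: RV; exists r => //; exact: hr.
  have := total_zs Rc; have := is_unit_inV (poly_zs_unit hq q0); rewrite qE; move=> *; sa.
case: (dvr_over hV sZ VZ) => [->//|e].
by have := zs_w; rewrite e => /mx_setT/eqP; rewrite invr_eq0 (negPf w0).
Qed.
End ZeroSectionChart.

Local Notation A0 := (chart iota s w).
Local Notation VX := (cone_vertex iota s w).
Let sA0 : subalg A0 := chart_sa iota s w.

Lemma affine_cone_zs : A0 `<=` ZS.
Proof.
move=> z /(affine_cone_total false E_generic) [c [r hr ->]].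
have := total_zs E_generic hr; have := mx_in (ucoord_zs false E_generic); move=> *; sa.
Qed.

(** The ideal of the vertex, generated by the s_i / w, is exactly what vanishes on the zero
    section. *)
Lemma vertex_eq : VX = locin A0 ZS.
Proof.
rewrite -(localization_mx affine_cone_zs) /cone_vertex -/A0; congr localization.
have sec z : z \in (s : seq K) -> max_ideal ZS (z / w).
  move=> zs; apply: (mxM sZ); [exact: FS_zs (section_FS zs) | exact: zs_w].
have nth_s (i : nat) : s`_i = 0 \/ s`_i \in (s : seq K).
  by case: (ltnP i (size s)) => h; [right; apply: mem_nth | left; apply: nth_default].
have nthA i : A0 (s`_i / w).
  by case: (nth_s i) => [->|h]; [rewrite mul0r; sa | apply: chart_in].
have nthZ i : max_ideal ZS (s`_i / w).
  by case: (nth_s i) => [->|h]; [rewrite mul0r; exact: (mx0 sZ) | apply: sec].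
pose I0 := [set z | exists2 c : nat -> K, forall i, A0 (c i) & z = \sum_(i < size s) c i * (s`_i / w)].
have I0A z : I0 z -> A0 z.
  by move=> [c hc ->]; apply: (sa_sum sA0) => j _; apply: (saM sA0).
have I0Z z : I0 z -> max_ideal ZS z.
  move=> [c hc ->]; apply: (big_ind (max_ideal ZS)); first exact: (mx0 sZ).
    by move=> x y; apply: (mxD lZ).
  by move=> j _; apply: (mxM sZ) => //; apply: affine_cone_zs.
have I00 : I0 0.
  by exists (fun=> 0); [move=> j; sa | rewrite big1 // => j _; rewrite mul0r].
have I0B x y : I0 x -> I0 y -> I0 (x - y).
  move=> [c hc ->] [d hd ->]; exists (fun j => c j - d j).
    by move=> j; have := hc j; have := hd j; move=> *; sa.
  by rewrite -sumrB; apply: eq_bigr => j _; rewrite mulrBl.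
have I0M x y : A0 x -> I0 y -> I0 (x * y).
  move=> Ax [d hd ->]; exists (fun j => x * d j).
    by move=> j; have := hd j; move=> *; sa.
  by rewrite mulr_sumr; apply: eq_bigr => j _; rewrite mulrA.
apply/seteqP; split=> z; first by move=> h; split; [apply: I0A | apply: I0Z].
move=> [Az mz].
(* The affine cone ring is the sum of the constants and the vertex ideal, and only the constant 0
   vanishes on the zero section. *)
have [c hz] : exists c, I0 (z - iota c).
  have : [set z | A0 z /\ exists c, I0 (z - iota c)] z; last by case.
  apply: alg_gen_min Az.
    split.
    - by move=> c; split; [sa | exists c; rewrite subrr].
    - move=> x y [Ax [c hx]] [Ay [d hy]]; split; first by sa.
      exists (c - d); have -> : x - y - iota (c - d) = (x - iota c) - (y - iota d).
        by rewrite rmorphB; ring.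
      exact: I0B.
    - move=> x y [Ax [c hx]] [Ay [d hy]]; split; first by sa.
      exists (c * d); have -> : x * y - iota (c * d) = x * (y - iota d) - iota (- d) * (x - iota c).
        by rewrite rmorphM rmorphN; ring.
      by apply: I0B; apply: I0M => //; sa.
  move=> _ [y ys <-]; split; first exact: chart_in.
  exists 0; rewrite rmorph0 subr0; have ys' : y \in (s : seq K) by [].
  exists (fun j => (j == index y s)%:R); first by move=> j; case: eqP => _; sa.
  have hi : (index y s < size s)%N by rewrite index_mem.
  rewrite (bigD1 (Ordinal hi)) //= eqxx mul1r nth_index // big1 ?addr0 // => j.
  by rewrite -val_eqE /= => /negPf ->; rewrite mul0r.
have c0 : iota c = 0.
  apply: FS_zs_mx; first by sa.
  have -> : iota c = z - (z - iota c) by ring.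
  by apply: (mxB lZ) => //; apply: I0Z.
by rewrite c0 subr0 in hz.
Qed.

Lemma cone_chart : chart iota (rcons s w) w = A0.
Proof.
apply/seteqP; split.
  apply: (chart_min sA0) => y; rewrite mem_rcons inE => /orP[/eqP->|ys].
    by rewrite divff //; sa.
  exact: chart_in.
have sB := chart_sa iota (rcons s w) w.
by apply: (chart_min sB) => y ys; apply: chart_in; rewrite mem_rcons inE ys orbT.
Qed.

Lemma affine_cone_point V : local_ring V -> A0 `<=` V ->
  [/\ C (locin A0 V), is_loc A0 (locin A0 V), locin A0 V `<=` V & dominates V (locin A0 V)].
Proof.
move=> lV AV; rewrite -cone_chart; apply: proj_point => //.
  by rewrite mem_rcons inE eqxx.
move=> z; rewrite mem_rcons inE => /orP[/eqP->|zs].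
  by rewrite divff //; have sV := local_sa lV; sa.
by apply: AV; apply: chart_in.
Qed.

Lemma vertex_point : [/\ C VX, is_loc A0 VX, VX `<=` ZS & dominates ZS VX].
Proof. by rewrite vertex_eq; exact: (affine_cone_point lZ affine_cone_zs). Qed.

Lemma center_zs : center C ZS = VX.
Proof. by have [h _ _ d] := vertex_point; apply: center_proj. Qed.

Lemma dvr_prime_divisor V pi : dvr V pi -> C V -> prime_divisor C V.
Proof.
move=> hV CV; split=> //.
  rewrite hC => e; have [_ pi0 mpi _] := hV; rewrite e in mpi.
  by move: pi0; rewrite (mx_setT mpi) eqxx.
move=> O' CO' VO'; rewrite hC; apply: (dvr_over hV) => //.
exact: local_sa (proj_local CO').
Qed.

(** A function invertible at the vertex has the form k + u r with k a nonzero constant; after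
    scaling it is a polynomial in [u] with constant term 1. *)
Lemma vertex_unit b O2 V z : E O2 -> is_loc (total_ring b O2) V ->
  (forall p, polyin (base_ring b O2) p -> p`_0 = 1 -> is_unit V p.[ucoord b O2]) ->
  VX z -> V z.
Proof.
move=> h2 hl hu; have [_ lV RV _] := hl; have sV := local_sa lV.
rewrite vertex_eq => -[c [d [Ac Ad ud ->]]].
have A0V : A0 `<=` V.
  move=> y /(affine_cone_total b h2) [k [r hr ->]]; have := RV _ hr.
  by have := RV _ (ucoord_total b h2); move=> *; sa.
suff : V d^-1 by have := A0V _ Ac; move=> *; sa.
have [k [r [q hq qE] dE]] := affine_cone_total b h2 Ad.
have k0 : iota k != 0.
  apply/eqP => k0; rewrite k0 add0r in dE; case: (ucoord_zs b h2).
  have : max_ideal ZS d; last by case.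
  rewrite dE mulrC; apply: (mxM sZ); last exact: ucoord_zs.
  by apply: (total_zs h2); exists q.
have sR := base_sa b h2.
have : is_unit V ((1 + 'X * ((iota k)^-1 *: q)).[ucoord b O2]).
  apply: hu; last by rewrite coefD coefC coefXM addr0.
  apply: (polyinD sR); first by apply: (polyinC sR); sa.
  apply: (polyinM sR); first exact: (polyinX sR).
  by move=> j; rewrite coefZ; apply: (saM sR) => //; rewrite -fmorphV; sa.
move/is_unit_inV; rewrite hornerD hornerM hornerX hornerZ hornerC qE.
have -> : d^-1 = iota k^-1 * (1 + ucoord b O2 * ((iota k)^-1 * r))^-1.
  rewrite fmorphV -invfM; congr (_^-1); rewrite dE; field; exact: k0.
by move=> *; sa.
Qed.

(* An algebraic Hartogs argument along the exceptional divisor: a function which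
   is regular in codimension one near the vertex has a leading coefficient, with
   respect to the fibre coordinate, that is regular on the base chart. *)
Lemma near_vertex b O2 U O psi : E O2 -> open_in C U -> U O -> O `<=` VX -> psi != 0 ->
  (forall V pi, dvr V pi -> is_loc (total_ring b O2) V -> is_unit V (ucoord b O2) ->
     U V -> VX `<=` V -> V psi) ->
  exists c, base_ring b O2 c /\ max_ideal ZS (psi / ucoord b O2 ^ ord ZS psi - c).
Proof.
move=> h2 oU UO OVX psi0 hV.
set u := ucoord b O2 in hV *; set Rg := base_ring b O2 in hV *.
have sR := base_sa b h2; have sRU := total_sa b h2; have u0 := ucoord_neq0 b h2.
set j := ord ZS psi; pose z := psi / u ^ j.
have uz : is_unit ZS z := dvr_ordP (zs_dvr b h2) psi0.
(* These denominators are units along the zero section, and inverting them keeps the points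
   specializing to the vertex in the sense of [vertex_unit]. Constant term 1 makes the leading
   coefficient lie in the base ring without division. *)
pose M := [set m | exists p, [/\ polyin Rg p, p`_0 = 1 & m = p.[u]]].
have [c [d [[p hp pE] [q [hq q0 qE]] d0 zE]]] :
    exists c d, [/\ total_ring b O2 c, M d, d != 0 & z = c / d].
  apply: contrapT => hno.
  have [|||P [pi [pP PM dP nP]]] := @exists_dvr _ _ iota (total_ring b O2) z M sRU
    (@total_noeth b O2 h2) (@total_closed b O2 h2) (@total_frac b O2 h2) _ _ _ hno.
  - by move=> _ [p [hp _ ->]]; exists p.
  - by exists 1%:P; rewrite hornerC coefC; split=> //; apply: (polyinC sR); sa.
  - move=> _ _ [p [hp p0 ->]] [q [hq q0 ->]]; exists (p * q); rewrite hornerM.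
    by split=> //; [exact: (polyinM sR) | rewrite coefM big_ord1 p0 q0 mulr1].
  set V := localization _ P in dP nP.
  have [hl hm] := prime_loc sRU pP; have [_ lV RV _] := hl; have sV := local_sa lV.
  (* Otherwise [V] would be the zero section, where [z] is a unit, contradicting that [V] misses
     [z]. *)
  have uu : is_unit V u.
    case: (unit_or_mx (RV _ (ucoord_total b h2))) => // mu.
    by case: nP; rewrite (dvr_zero_section h2 dP hl mu); case: uz.
  have CV := cone_point h2 hl uu.
  have VXV : VX `<=` V.
    move=> y; apply: (vertex_unit h2 hl).
    move=> p hp p0; have Rp : total_ring b O2 p.[u] by exists p.
    case: (unit_or_mx (RV _ Rp)) => // /(hm _ Rp); case/PM => //; first by exists p.
    have /(_ _) := @poly_zs_unit b O2 h2 p hp; rewrite p0 oner_eq0 => /(_ isT); exact: is_unit_neq0.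
  have UV : U V := open_in_generization oU UO CV (subset_trans OVX VXV).
  case: nP; rewrite /z; have := hV _ _ dP hl uu UV VXV.
  have uj : is_unit V (u ^ j).
    case: (j) => k; rewrite ?NegzE -?exprnP -?exprnN; [|apply: is_unitV]; exact: (is_unitX _ sV uu).
  by have := is_unit_inV uj; move=> *; sa.
(* The fraction is p(u)/q(u) with q(0) = 1, so its restriction to the zero section is p(0). *)
exists p`_0; split; first exact: hp.
rewrite -/z zE qE -pE -/u.
have uq : is_unit ZS q.[u] by apply: (poly_zs_unit h2 hq); rewrite q0 oner_neq0.
have [r [rE hr]] := poly_at0 (p - (p`_0)%:P * q) u.
have -> : p.[u] / q.[u] - p`_0 = (q.[u]^-1 * r.[u]) * u.
  have : p.[u] - p`_0 * q.[u] = u * r.[u].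
    by move: rE; rewrite coefB coefCM q0 mulr1 subrr add0r hornerD hornerN hornerM hornerC.
  move=> e; rewrite -mulrA [r.[u] * u]mulrC -e; field; exact: is_unit_neq0 uq.
apply: (mxM sZ); last exact: ucoord_zs.
have : ZS r.[u].
  apply: (total_zs h2); exists r => //; apply: hr; apply: (polyinB sR) => //.
  by apply: (polyinM sR) => //; apply: (polyinC sR).
by have := is_unit_inV uq; move=> *; sa.
Qed.

(** * Centers on the blowup and points of the affine cone *)

Lemma chart_of V sa' : local_ring V -> sa' \in (s : seq K) -> sa' != 0 ->
  (forall z, z \in (s : seq K) -> V (z / sa')) ->
  exists b O2, [/\ E O2, base_ring b O2 `<=` V,
    is_unit (locin (base_ring b O2) V) (sa' / (gen b ^+ 2 * A O2 ^+ 2))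
    & chart iota s sa' `<=` locin (base_ring b O2) V].
Proof.
move=> lV sas sa0 h; have [O [SO OV dO [_ lO cO _] uO]] := local_chart lV sas sa0 h.
have [b [O2 [h2 d2 tO hl LE]]] := S_point SO; exists b, O2.
have [sR _ RO OR] := hl.
have OL : O `<=` locin (base_ring b O2) V.
  by move=> z /OR [c [d [Rc Rd ud ->]]]; exists c, d; split=> //; exact: is_unit_mono ud.
split=> //; first by apply: subset_trans OV.
  by rewrite -LE; apply: is_unit_mono uO.
by apply: subset_trans OL.
Qed.

Lemma valuation_pivot V l : subalg V -> (forall z, z != 0 -> V z \/ V z^-1) ->
  has (fun z => z != 0) l -> exists p : K, [/\ p \in l, p != 0 & forall z, z \in l -> V (z / p)].
Proof.
move=> sV tot; elim: l => [//|y l IH] /=; case: (boolP (has _ l)) => [/IH [p [pl p0 hp]] _|].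
  have [->|y0] := eqVneq y 0.
    exists p; split=> // [|z]; rewrite inE ?pl ?orbT // => /orP[/eqP->|/hp //].
    by rewrite mul0r; sa.
  case: (tot (y / p)) => [|h|h]; first by rewrite mulf_neq0 ?invr_eq0.
    exists p; split=> // [|z]; rewrite inE ?pl ?orbT // => /orP[/eqP->//|/hp //].
  exists y; split=> // [|z]; rewrite inE ?eqxx // => /orP[/eqP->|/hp hz].
    by rewrite divff //; sa.
  have -> : z / y = z / p * (y / p)^-1 by field; rewrite y0 p0.
  by sa.
rewrite orbF => /hasPn h y0; exists y; split=> // [|z]; rewrite inE ?eqxx //.
move=> /orP[/eqP->|/h]; first by rewrite divff //; sa.
by rewrite negbK => /eqP->; rewrite mul0r; sa.
Qed.

(** Properness of the blowup over the affine cone: a section of least valuation selects the chart,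
    and makes [u] a unit times one of the coordinates s_i / w. *)
Lemma dvr_chart V pi : dvr V pi -> A0 `<=` V ->
  exists b O2, E O2 /\ total_ring b O2 `<=` V.
Proof.
move=> hV AV; have [lV _ _ _] := hV; have sV := local_sa lV.
have [||sa' [sas sa0 h]] := valuation_pivot (l := s) sV.
- by move=> z z0; apply: (dvr_total hV).
- by have [z zs z0] := S_pivot; apply/hasP; exists z.
have [b [O2 [h2 RV us _]]] := chart_of lV sas sa0 h; exists b, O2; split=> //.
apply: (adj_min sV) => //.
have sR := base_sa b h2; have [_ LV] := locin_dom sR lV RV.
have us' := is_unit_mono (locin_le sV RV) us.
have -> : ucoord b O2 = (sa' / (gen b ^+ 2 * A O2 ^+ 2))^-1 * (sa' / w).
  by rewrite /ucoord; have g0 := gen_neq0 b; have A0' := A_neq0 h2; fld.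
have := is_unit_inV us'; have := AV _ (chart_in w sas); move=> *; sa.
Qed.

(** If no s_i / w is invertible, each function on the cone has the same constant value modulo the
    maximal ideals of [V] and of [ZS], so both define the vertex. An invertible one makes [u]
    invertible. *)
Lemma unit_chart V : local_ring V -> A0 `<=` V ->
  V = locin A0 V -> V = VX \/ exists b O2, [/\ E O2, is_loc (total_ring b O2) V & is_unit V (ucoord b O2)].
Proof.
move=> lV AV VE; have sV := local_sa lV.
case: (pselect (exists2 z, z \in (s : seq K) & is_unit V (z / w))) => [[sa' sas us]|h]; last first.
  left; rewrite VE vertex_eq.
  have key z : A0 z -> exists c, max_ideal V (z - iota c) /\ max_ideal ZS (z - iota c).
    have mw y : y \in (s : seq K) -> max_ideal V (y / w).
      move=> ys; split; first by apply: AV; apply: chart_in.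
      by move=> uy; apply: h; exists y.
    move=> Az.
    have : [set z | A0 z /\ exists c, max_ideal V (z - iota c) /\ max_ideal ZS (z - iota c)] z; last by case.
    apply: alg_gen_min Az.
      split.
      - move=> c; split; [sa | exists c; rewrite subrr; split; [exact: (mx0 sV) | exact: (mx0 sZ)]].
      - move=> x y [Ax [c [hx hx']]] [Ay [d [hy hy']]]; split; first by sa.
        exists (c - d); have -> : x - y - iota (c - d) = (x - iota c) - (y - iota d).
          by rewrite rmorphB; ring.
        by split; [apply: (mxB lV) | apply: (mxB lZ)].
      - move=> x y [Ax [c [hx hx']]] [Ay [d [hy hy']]]; split; first by sa.
        exists (c * d); have -> : x * y - iota (c * d) = x * (y - iota d) + iota d * (x - iota c).
          by rewrite rmorphM; ring.
        have Vx := AV _ Ax; have Zx := affine_cone_zs Ax.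
        by split; [apply: (mxD lV); apply: (mxM sV) => // | apply: (mxD lZ); apply: (mxM sZ) => //]; sa.
    move=> _ [y ys <-]; split; first exact: chart_in.
    exists 0; rewrite rmorph0 subr0; split; first exact: mw.
    by apply: (mxM sZ); [exact: FS_zs (section_FS ys) | exact: zs_w].
  have transfer (V1 V2 : set K) z c : local_ring V1 -> local_ring V2 -> max_ideal V1 (z - iota c) ->
      max_ideal V2 (z - iota c) -> is_unit V1 z -> is_unit V2 z.
    move=> l1 l2 m1 m2 u1; have s1 := local_sa l1; have s2 := local_sa l2.
    have c0 : c != 0.
      by apply/eqP => c0; rewrite c0 rmorph0 subr0 in m1; case: m1.
    rewrite -(subrK (iota c) z) addrC; apply: (unitDmx l2) => //.
    exact: (is_unit_iota s2).
  apply/seteqP; split=> _ [c [d [Ac Ad ud ->]]]; exists c, d; split=> //.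
    by have [k [m1 m2]] := key _ Ad; exact: (transfer V ZS d k lV lZ m1 m2 ud).
  by have [k [m1 m2]] := key _ Ad; exact: (transfer ZS V d k lZ lV m2 m1 ud).
right; have sa0 : sa' != 0 by case: us => h _ _; apply: contraNneq h => ->; rewrite mul0r.
have hz z : z \in (s : seq K) -> V (z / sa').
  move=> zs; have -> : z / sa' = z / w * (sa' / w)^-1 by fld.
  by have := is_unit_inV us; have := AV _ (chart_in w zs); move=> *; sa.
have [b [O2 [h2 RV usc cl]]] := chart_of lV sas sa0 hz; exists b, O2.
have sR := base_sa b h2; have sRU := total_sa b h2.
have usc' := is_unit_mono (locin_le sV RV) usc.
have uE : ucoord b O2 = (sa' / (gen b ^+ 2 * A O2 ^+ 2))^-1 * (sa' / w).
  by rewrite /ucoord; have g0 := gen_neq0 b; have A0' := A_neq0 h2; fld.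
have uu : is_unit V (ucoord b O2).
  by rewrite uE; apply: (is_unitM sV) => //; apply: is_unitV.
have RUV : total_ring b O2 `<=` V by apply: (adj_min sV) => //; case: uu.
split=> //.
have hA0 : is_loc A0 V by rewrite VE; exact: is_loc_locin.
apply: (is_loc_trans hA0 sRU RUV).
have sl := locin_sa sRU sV.
have LL : locin (base_ring b O2) V `<=` locin (total_ring b O2) V.
  move=> _ [c [d [Rc Rd ud ->]]]; exists c, d; split=> //; exact: base_total.
apply: (alg_gen_min sl) => _ [z zs <-].
have -> : z / w = z / sa' * (sa' / (gen b ^+ 2 * A O2 ^+ 2)) * ucoord b O2.
  by rewrite uE; have g0 := gen_neq0 b; have A0' := A_neq0 h2; fld.
have h1 := LL _ (cl _ (chart_in sa' zs)); have h3 := LL _ (is_unit_in usc).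
have h4 := locin_sub sRU sV (ucoord_total b h2).
by sa.
Qed.

(** * Dimension of the cone and vanishing of sections on the two factors *)

Lemma E_regular_const f : FE f -> (forall O, E O -> O f) -> range iota f.
Proof.
move=> Ff hf; have [m m0 [k [s' [hb hu _]]]] := aA.
apply: (regular_const hb) => //; first by move=> O /E_local /local_sa.
have [z zs [h _ _]] := hu _ E_generic; exists z => //.
by apply: contraNneq h => ->; rewrite mul0r.
Qed.

Lemma E_nonconst : exists2 x, FE x & ~ range iota x.
Proof.
have [a [b [x [y [disc tx weq eE]]]]] := hE; exists x.
  by rewrite eE curve_function_field; apply: curve_x.
move=> [c _ e]; have /eqP : 'X - (iota c)%:P = 0 :> {poly K}; last by rewrite polyXsubC_eq0.
apply: tx; last by apply/rootP; rewrite hornerD hornerN hornerX hornerC e subrr.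
have sk := range_sa iota.
by apply: (polyinB sk); [exact: (polyinX sk) | apply: (polyinC sk); sa].
Qed.

Lemma E_closed_point : exists O2 z, [/\ E O2, max_ideal O2 z & z != 0].
Proof.
have [x Fx nx] := E_nonconst.
have [O2 h2 nO] : exists2 O2, E O2 & ~ O2 x.
  apply: contrapT => h; apply: nx; apply: E_regular_const => // O hO.
  by apply: contrapT => nO; apply: h; exists O.
have [c [d [Oc Od /is_unit_setT d0 xE]]] := E_frac h2 Fx.
exists O2, d; split=> //; have s2 := local_sa (E_local h2).
case: (unit_or_mx Od) => // ud; case: nO; rewrite xE.
by have := is_unit_inV ud; move=> *; sa.
Qed.

Lemma chain3 : chain C 3.
Proof.
have [O2 [z [h2 mz z0]]] := E_closed_point.
have l2 := E_local h2; have s2 := local_sa l2.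
set Rg := base_ring false O2; set RU := total_ring false O2; set u := ucoord false O2.
have sR : subalg Rg := base_sa false h2; have sRU : subalg RU := total_sa false h2.
have tt p : polyin O2 p -> p.[tau false] = 0 -> p = 0.
  move=> hp e; apply: (@tau_transc false) => //; last by apply/rootP.
  by apply: polyin_mono hp; exact: E_sub.
have tu p : polyin Rg p -> p.[u] = 0 -> p = 0.
  move=> hp e; apply: (@ucoord_transc false O2 h2) => //; last by apply/rootP.
  by apply: polyin_mono hp; exact: base_FS.
have O0 : O2 0 by sa.
have R1 : Rg 1 by sa.
have pm : prime_ideal O2 (max_ideal O2).
  have e : max_ideal O2 = O2 `&` max_ideal O2.
    by apply/seteqP; split=> y; [move=> h; split=> //; case: h | case].
  by rewrite e; apply: (prime_mx s2 l2).
pose I2 := eval_ideal O2 [set 0] (tau false) 0; pose I3 := eval_ideal O2 (max_ideal O2) (tau false) 0.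
have [pI2 kI2] := eval_prime s2 tt O0 (prime0 s2); rewrite -/I2 in pI2 kI2.
have [pI3 kI3] := eval_prime s2 tt O0 pm; rewrite -/I3 in pI3 kI3.
(* The chain runs in the section u = 1: there [u] is a unit, so [cone_point] places the points on
   the cone. It then cuts by [tau = 0] and by a closed point of E. *)
pose Q1 := eval_ideal Rg [set 0] u 1; pose Q2 := eval_ideal Rg I2 u 1; pose Q3 := eval_ideal Rg I3 u 1.
have [pQ1 kQ1] := eval_prime sR tu R1 (prime0 sR); rewrite -/Q1 in pQ1 kQ1.
have [pQ2 kQ2] := eval_prime sR tu R1 pI2; rewrite -/Q2 in pQ2 kQ2.
have [pQ3 kQ3] := eval_prime sR tu R1 pI3; rewrite -/Q3 in pQ3 kQ3.
have notu (m Q : set K) : prime_ideal Rg m -> (forall p, polyin Rg p -> Q p.[u] -> m p.[1]) -> ~ Q u.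
  move=> [_ _ _ m1 _] k Qu; apply: m1; have := k 'X (polyinX sR).
  by rewrite !hornerX; apply.
have ptC (m Q : set K) : prime_ideal Rg m -> prime_ideal RU Q ->
    (forall p, polyin Rg p -> Q p.[u] -> m p.[1]) -> C (localization RU Q).
  move=> pm' pQ k; have [hl hm] := prime_loc sRU pQ; apply: (cone_point h2 hl).
  have [_ _ RV _] := hl; have RUu : RU u := ucoord_total false h2.
  by case: (unit_or_mx (RV _ RUu)) => // /(hm _ RUu) /(notu _ _ pm' k).
have anti (Q Q' : set K) z' : prime_ideal RU Q -> prime_ideal RU Q' -> Q `<=` Q' -> RU z' ->
    Q' z' -> ~ Q z' -> localization RU Q' `<=` localization RU Q /\ localization RU Q' <> localization RU Q.
  move=> pQ pQ' QQ' Rz Qz nQz; split.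
    by move=> _ [c [d [Rc Rd nd ->]]]; exists c, d; split=> // /QQ'.
  move=> e; have [hl hm] := prime_loc sRU pQ; have [hl' hm'] := prime_loc sRU pQ'.
  have [_ lV RV _] := hl; have : max_ideal (localization RU Q') z' by apply/hm'.
  by rewrite e => /(hm _ Rz).
have le23 : Q2 `<=` Q3.
  move=> _ [p [hp [q [hq q0 qE]] ->]]; exists p; split=> //; exists q; split=> //.
  by rewrite q0; exact: (mx0 s2).
have le12 : Q1 `<=` Q2.
  move=> _ [p [hp p0 ->]]; exists p; split=> //; rewrite p0; by case: pI2 => -[].
have C0 : C setT.
  have [sa' sas sa0] := S_pivot.
  have sas' : sa' \in rcons s w by rewrite mem_rcons inE sas orbT.
  have [h _ _ _] := proj_point sas' sa0 (local_setT iota) (fun _ _ => I).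
  by rewrite -hC /projective_cone (function_field_proj iota sas' sa0).
exists (fun i => match i with 0%N => setT | 1%N => localization RU Q1
  | 2%N => localization RU Q2 | _ => localization RU Q3 end).
have ru1 : RU (u - 1) by have := ucoord_total false h2; move=> *; sa.
have rt : RU (tau false) by apply: base_total => //; exact: (adj_gen _ s2).
have O2R : O2 `<=` Rg := adj_base _ s2.
have rz : RU z by apply: base_total => //; apply: O2R; case: mz.
split.
  move=> [|[|[|[|//]]]] _; first exact: C0.
  - exact: ptC (prime0 sR) pQ1 kQ1.
  - exact: ptC pI2 pQ2 kQ2.
  - exact: ptC pI3 pQ3 kQ3.
have constQ (m Q : set K) c : (forall p, polyin Rg p -> Q p.[u] -> m p.[1]) -> Rg c -> Q c -> m c.
  by move=> k Rc Qc; have := k c%:P; rewrite !hornerC; apply=> //; apply: (polyinC sR).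
move=> [|[|[|//]]] _.
- split=> // e; have [hl hm] := prime_loc sRU pQ1.
  have h : Q1 (u - 1).
    exists ('X - 1%:P); rewrite !(hornerD, hornerN, hornerX, hornerC) subrr; split=> //.
    by apply: (polyinB sR); [exact: (polyinX sR) | apply: (polyinC sR)].
  have := proj2 (hm _ ru1) h; rewrite e => /mx_setT e1.
  have /eqP : ('X - 1%:P) = 0 :> {poly K}; last by rewrite polyXsubC_eq0.
  apply: tu; last by rewrite !(hornerD, hornerN, hornerX, hornerC).
  by apply: (polyinB sR); [exact: (polyinX sR) | apply: (polyinC sR)].
- apply: (anti _ _ (tau false)) => //.
    exists (tau false)%:P; rewrite !hornerC; split=> //.
      by apply: (polyinC sR); exact: (adj_gen _ s2).
    by exists 'X; rewrite !hornerX; split=> //; exact: (polyinX s2).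
  move=> h; have := constQ _ _ _ kQ1 (adj_gen _ s2) h; move/eqP.
  by rewrite /tau (negPf t_n0).
- apply: (anti _ _ z) => //.
    exists z%:P; rewrite !hornerC; split=> //; first by apply: (polyinC sR); apply: O2R; case: mz.
    by exists z%:P; rewrite !hornerC; split=> //; apply: (polyinC s2); case: mz.
  have Oz := mx_in mz; move=> h; have := constQ _ _ _ kQ2 (O2R _ Oz) h.
  move=> hz; have := kI2 z%:P; rewrite !hornerC => /(_ (polyinC s2 Oz) hz) /eqP.
  by rewrite (negPf z0).
Qed.

(** No sections of O(-m-1) on P^1: the left side has only positive powers of [z] and the right side
    none, as seen after multiplying by [z ^+ size q]. *)
Lemma transc_no_pole F p q (m : nat) z : subfield F -> transcendental_over F z -> z != 0 ->
  polyin F p -> polyin F q -> z ^+ m.+1 * p.[z] = q.[z^-1] -> p = 0.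
Proof.
move=> sF tz z0 hp hq e; have sFa := subfield_sa sF.
pose r := \poly_(i < (size q).+1) q`_(size q - i).
have hr : polyin F r by apply: (polyin_poly _ sFa) => i; exact: hq.
have rE : r.[z] = z ^+ size q * q.[z^-1].
  rewrite horner_poly (reindex_inj rev_ord_inj) /= big_ord_recr /= subSS subKn //.
  rewrite nth_default // mul0r addr0 horner_coef mulr_sumr; apply: eq_bigr => i _.
  rewrite subSS subKn; last exact: ltnW.
  have -> : z ^+ size q = z ^+ (size q - i) * z ^+ i by rewrite -exprD subnK // ltnW.
  by rewrite exprVn; field; rewrite expf_neq0.
have : 'X^((size q).+1 + m) * p - r = 0.
  apply: tz; first by apply: (polyinB sFa) => //; apply: (polyinM sFa) => //; apply: (polyinXn _ sFa); exact: (polyinX sFa).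
  apply/rootP; rewrite hornerD hornerN hornerM hornerXn rE -e; apply/eqP; rewrite subr_eq0; apply/eqP.
  by rewrite addSnnS exprD mulrA.
move/eqP; rewrite subr_eq0 => /eqP rp; apply/polyP => i; rewrite coef0.
have := congr1 (fun g : {poly K} => g`_((size q).+1 + m + i)) rp.
rewrite coefXnM ltnNge leq_addr /= addKn => ->.
by rewrite coef_poly ltnNge -addnA leq_addr.
Qed.

Lemma E_sections : exists m (s' : seq K) (z0 : K), [/\ (0 < m)%N, z0 \in s', z0 != 0, E = proj_model iota s'
  & forall z, z \in s' -> FE z /\ forall O2, E O2 -> O2 (z / A O2 ^+ m)].
Proof.
have [m m0 [k [s' [[hb _] hu hp]]]] := aA; exists m, s'.
have [z zs [h _ _]] := hu _ E_generic; exists z; split=> //.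
  by apply: contraNneq h => ->; rewrite mul0r.
move=> z' /tnthP[j ->]; rewrite (tnth_nth 0).
have [h1 h2] : global_sections E (tensor_power A m) s'`_j; last by split.
apply/hb; exists (fun k => (k == j)%:R); rewrite (bigD1 j) //= eqxx rmorph1 mul1r.
by rewrite big1 ?addr0 // => k' /negPf->; rewrite rmorph0 mul0r.
Qed.

(** The hypothesis makes [a] a section of the power -e of [A]. Its m-th power times e sections of
    the m-th power is a regular function, hence constant; varying one of these sections makes all
    their ratios constant. *)
Lemma no_negative_sections a e : FE a -> a != 0 -> (0 < e)%N ->
  ~ (forall O2, E O2 -> O2 (a * A O2 ^+ e)).
Proof.
move=> Fa a0 e0 h; have [m [s' [z0 [m0 zs z00 eE hz]]]] := E_sections.
have key z : z \in s' -> range iota (a ^+ m * z0 ^+ e.-1 * z).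
  move=> zs'; have [Fz hz'] := hz _ zs'; have [Fz0 hz0] := hz _ zs.
  apply: E_regular_const; first by sa.
  move=> O2 h2; have s2 := local_sa (E_local h2).
  have -> : a ^+ m * z0 ^+ e.-1 * z = (a * A O2 ^+ e) ^+ m * (z0 / A O2 ^+ m) ^+ e.-1 * (z / A O2 ^+ m).
    have A0' := A_neq0 h2.
    have -> : (a * A O2 ^+ e) ^+ m = a ^+ m * ((A O2 ^+ m) ^+ e.-1 * A O2 ^+ m).
      by rewrite -exprSr prednK // exprMn -!exprM mulnC.
    have : A O2 ^+ m != 0 by rewrite expf_neq0.
    move: (A O2 ^+ m) => B B0; rewrite expr_div_n; field.
    by rewrite B0 expf_neq0.
  by have := h _ h2; have := hz' _ h2; have := hz0 _ h2; move=> *; sa.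
have sk := range_subfield iota; have ska := subfield_sa sk.
have nz : a ^+ m * z0 ^+ e.-1 != 0 by rewrite mulf_neq0 ?expf_neq0.
have [x Fx nx] := E_nonconst; apply: nx; move: Fx.
rewrite eE (function_field_proj iota zs z00).
apply: (locin_min sk); apply: (chart_min ska) => z zs'.
have -> : z / z0 = (a ^+ m * z0 ^+ e.-1 * z) / (a ^+ m * z0 ^+ e.-1 * z0).
  by move: nz; set B := _ * z0 ^+ _ => nz; fld.
by apply: (sf_div sk); apply: key.
Qed.

Lemma zs_neqT : ZS <> setT.
Proof. by move=> e; have := zs_w; rewrite e => /mx_setT/eqP; rewrite invr_eq0 (negPf w0). Qed.

(** Were it one, no other codimension-one point would specialize to it, so [t^-1] would satisfy
    [near_vertex]; its leading coefficient would then be a polynomial in [t]. *)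
Lemma vertex_not_divisor : ~ prime_divisor C VX.
Proof.
move=> [CV nT hmin]; rewrite hC in nT hmin.
have oC : open_in C C by split=> // O CO; exists [::].
have tt : transcendental_over FE t := ht.
have t1 : t^-1 != 0 by rewrite invr_eq0.
have uT : is_unit ZS t^-1 by apply: FS_zs_unit => //; exact: (tau_FS true).
have [|c [[p hp pE]]] := near_vertex E_generic oC CV (fun _ => id) t1 (b := false).
  move=> V pi hV hl uu CV' VXV; case: (hmin _ CV' VXV) => [e|->//].
  have [_ _ VZ _] := vertex_point; rewrite -e in VZ.
  case: (dvr_over hV sZ VZ) => [e'|/zs_neqT//].
  by have [_ []] := ucoord_zs false E_generic; rewrite e'.
rewrite (ord_unit zs_dvr_w uT) expr0z divr1 => h.
have Fc : FS c by rewrite -pE; apply: (polyin_horner saFS FE_FS (tau_FS false) hp).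
have /eqP : t^-1 - c = 0 by apply: FS_zs_mx => //; have := tau_FS true; move=> *; sa.
rewrite subr_eq0 => /eqP tc.
have p0 : p = 0.
  have h1 : polyin FE 1%:P by apply: (polyinC saFE); sa.
  apply: (transc_no_pole (m := 0) (q := 1%:P) sFE tt t_n0) => //.
  by rewrite hornerC expr1 pE -tc divff.
by move: t1; rewrite tc -pE p0 horner0 eqxx.
Qed.

(** * Top forms on the charts of the total space *)

Definition coords (x y z : K) (j : 'I_3) : K := nth 0 [:: x; y; z] j.
Definition ders (D0 D1 D2 : K -> K) (j : 'I_3) : K -> K := nth D0 [:: D0; D1; D2] j.
Lemma ord3_ind (P : 'I_3 -> Prop) : P ord0 -> P (inord 1) -> P (inord 2) -> forall j, P j.
Proof.
move=> h0 h1 h2 [m hm]; case: m hm => [|[|[|//]]] hm.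
- by rewrite (_ : Ordinal hm = ord0) //; apply: val_inj.
- by rewrite (_ : Ordinal hm = inord 1) //; apply: val_inj; rewrite /= inordK.
- by rewrite (_ : Ordinal hm = inord 2) //; apply: val_inj; rewrite /= inordK.
Qed.

Section DualDerivations.
Variables (x y : K) (D0 : K -> K) (a0 b0 : R[i]).
Hypotheses (disc : 4 * a0 ^+ 3 + 27 * b0 ^+ 2 != 0) (tx : transcendental_over (range iota) x)
  (weq : y ^+ 2 = x ^+ 3 + iota a0 * x + iota b0)
  (eE : E = proj_model iota [:: 1; x; y])
  (dD0 : der_on iota FE D0) (D0x : D0 x = 2 * y) (D0y : D0 y = 3 * x ^+ 2 + iota a0).

Let FEE : FE = curve_field iota x y.
Proof. by rewrite eE curve_function_field. Qed.
Let Fx : FE x. Proof. by rewrite FEE; apply: curve_x. Qed.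
Let Fy : FE y. Proof. by rewrite FEE; apply: curve_y. Qed.
Let y0 : y != 0. Proof. exact: curve_y0 tx weq. Qed.
Let yy0 : 2 * y != 0. Proof. by rewrite mulf_neq0 // (natr_neq0 iota 1). Qed.

Lemma der_FE D rho z : derivation iota D -> FE rho -> D0 rho != 0 -> FE z ->
  D z = D rho / D0 rho * D0 z.
Proof.
move=> /der_onT dD Fr r0 Fz.
have h z' : FE z' -> D z' = D x / (2 * y) * D0 z'.
  rewrite FEE => Fz'; apply: (curve_der_unique tx weq) => //.
  - by rewrite -FEE.
  - by apply: der_on_mono dD.
rewrite (h _ Fz) (h _ Fr); have h2 : 2%:R != 0 :> K := natr_neq0 iota 1; fld.
Qed.

(** Partial derivatives are built up the tower from E to S to K: [D0 / D0 rho] or 0 on E, then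
    prescribed values on the two transcendental generators. *)
Lemma dual3 v rho tt : FE rho -> D0 rho != 0 -> transcendental_over FE tt ->
  FS = locin (adj FE tt) setT -> transcendental_over FS v -> locin (adj FS v) setT = setT ->
  exists e, dual_basis iota (coords v rho tt) e.
Proof.
move=> Fr r0 ttr FSE tv KE.
have FSt : FS tt by rewrite FSE; exact: (adj_field_gen _ sFE).
have mk D c d : der_on iota FE D -> exists D', [/\ derivation iota D',
    forall z, FE z -> D' z = D z, D' tt = c & D' v = d].
  move=> dD; have [D1 [d1 h1 v1]] := der_adjoin_transc c sFE dD ttr.
  rewrite -FSE in d1; have [D2 [d2 h2 v2]] := der_adjoin_transc d sFS d1 tv.
  rewrite KE in d2; exists D2; split=> //; first exact/der_onT.
    by move=> z Fz; rewrite h2 ?h1 //; exact: FE_FS.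
  by rewrite h2.
have d0 : der_on iota FE (fun=> 0) by split=> *; rewrite ?mulr0 ?addr0.
have d1 : der_on iota FE (fun z => (D0 rho)^-1 * D0 z).
  have [h1 h2 h3] := dD0; split=> [c|p q Fp Fq|p q Fp Fq]; first by rewrite h1 mulr0.
    by rewrite h2 // mulrDr.
  by rewrite h3 //; ring.
have [e0 [de0 e0F e0t e0v]] := mk _ 0 1 d0.
have [e1 [de1 e1F e1t e1v]] := mk _ 0 0 d1.
have [e2 [de2 e2F e2t e2v]] := mk _ 1 0 d0.
exists (ders e0 e1 e2); split.
- by apply: ord3_ind; rewrite /ders ?inordK.
- apply: ord3_ind; apply: ord3_ind; rewrite /ders /coords -val_eqE /= ?inordK //= ?e0F ?e1F ?e2F //.
  by rewrite mulVf.
move=> D dD z.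
pose D' z := D v * e0 z + D rho * e1 z + D tt * e2 z.
have dD' : der_on iota setT D'.
  have [p1 p2 p3] := de0; have [q1 q2 q3] := de1; have [r1 r2 r3] := de2.
  split=> [c|p q _ _|p q _ _]; rewrite /D'; first by rewrite p1 q1 r1 !mulr0 !addr0.
    by rewrite p2 q2 r2; ring.
  by rewrite p3 q3 r3; ring.
have -> : \sum_j D (coords v rho tt j) * ders e0 e1 e2 j z = D' z.
  by rewrite /D' !big_ord_recl big_ord0 addr0 addrA.
have dT := proj1 (der_onT _ D) dD.
have : locin (adj FS v) setT z by rewrite KE.
have dT' := dT; have dD'' := dD'; rewrite -KE in dT' dD''.
apply: (der_ext_eq sFS dT' dD''); last by rewrite /D' e0v e1v e2v; ring.
rewrite FSE; apply: (der_ext_eq sFE); [by apply: der_on_mono dT|by apply: der_on_mono dD'| |].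
  move=> z' Fz'; rewrite /D' e0F // e1F // e2F // (der_FE dD Fr r0 Fz') !mulr0 add0r addr0.
  by rewrite mulrA.
by rewrite /D' e0t e1t e2t; ring.
Qed.

Lemma dual_wxt : exists e, dual_basis iota (coords w x t) e.
Proof.
apply: dual3 => //; rewrite ?D0x //; first exact: (FS_gen false).
exact: K_gen.
Qed.

Hypothesis curve_pts : forall O2, E O2 -> (forall z, O2 z -> O2 (D0 z)) /\
  exists rho, O2 rho /\ is_unit O2 (D0 rho).

Variable e0 : 'I_3 -> K -> K.
Hypothesis dual_e0 : dual_basis iota (coords w x t) e0.

(** The coefficient of [f] with respect to dw/w ∧ dx/2y ∧ dt. *)
Definition form_coeff (f : Defs.form K 3) : K := form_eval f e0 * w * (2 * y).
Lemma form_coeff_neq0 f : form_nonzero iota f -> form_coeff f != 0.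
Proof. by move=> hf; apply: mulf_neq0 => //; apply: mulf_neq0 => //; exact: (form_nonzero_dual dual_e0 hf). Qed.

Section FormChart.
Variables (b : bool) (O2 : set K).
Hypothesis h2 : E O2.
Local Notation u := (ucoord b O2).
Local Notation Rg := (base_ring b O2).
Local Notation RU := (total_ring b O2).
Let s2 : subalg O2 := local_sa (E_local h2).
Let sR : subalg Rg := base_sa b h2.
Let sRU : subalg RU := total_sa b h2.

(** Smoothness of a chart, with coordinates [u], [rho] and [tau]. Changing from dw/w to du gives
    1/u, and dt = - t^2 d(1/t) on the second chart gives the factor [gen b ^+ 2], the canonical
    bundle of P^1. *)
Lemma dual_chart : exists rho e, [/\ O2 rho, is_unit O2 (D0 rho),
  dual_basis iota (coords u rho (tau b)) e,
  forall V j z, is_loc RU V -> V z -> V (e j z)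
  & forall f, exists2 k, is_unit O2 k &
      form_eval f e = k * (form_coeff f * gen b ^+ 2 / u)].
Proof.
have [pres [rho [Or ur]]] := curve_pts h2; have r0 := is_unit_neq0 ur.
have Fr := E_sub h2 Or.
have [e de] := dual3 Fr r0 (@tau_transc b) (FS_gen b) (@ucoord_transc b O2 h2) (@K_ucoord b O2 h2).
have [der_e ec _] := de.
have e_u j : e j u = (j == ord0)%:R by have := ec j ord0.
have e_r j : e j rho = (j == inord 1)%:R by have := ec j (inord 1); rewrite /coords inordK.
have e_t j : e j (tau b) = (j == inord 2)%:R by have := ec j (inord 2); rewrite /coords inordK.
have e_F j z : FE z -> e j z = (j == inord 1)%:R / D0 rho * D0 z.
  by move=> Fz; rewrite (der_FE (der_e j) Fr r0 Fz) e_r.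
exists rho, e; split=> //.
- move=> V j z hl Vz; have [_ lV RV _] := hl; have sV := local_sa lV.
  have dT := proj1 (der_onT _ _) (der_e j).
  have [d1 d2 d3] := dT.
  have dB (z1 z2 : K) : e j (z1 - z2) = e j z1 - e j z2 by rewrite (der_onB (subfield_setT iota) dT).
  apply: (der_preserve_loc (subfield_setT iota) _ dT hl) Vz => // {}z.
  have O2V : O2 `<=` V.
    by apply: subset_trans RV; apply: subset_trans (@base_total b O2 h2); exact: (adj_base _ s2).
  have sT : subalg [set z | V z /\ V (e j z)].
    split.
    - by move=> c; split; [sa | rewrite d1; sa].
    - by move=> p q [Vp hp] [Vq hq]; split; [sa | rewrite dB; sa].
    - by move=> p q [Vp hp] [Vq hq]; split; [sa | rewrite d3 //; sa].
  suff h : RU `<=` [set z | V z /\ V (e j z)] by move=> /h [].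
  apply: (adj_min sT); first apply: (adj_min sT).
  + move=> z' Oz; split; first exact: O2V.
    have := O2V _ (pres _ Oz); have := O2V _ (is_unit_inV ur).
    by rewrite e_F; [move=> *; sa | exact: (E_sub h2)].
  + by split; [apply: RV; apply: base_total => //; exact: (adj_gen _ s2) | rewrite e_t; sa].
  + by split; [apply: RV; apply: ucoord_total => // | rewrite e_u; sa].
move=> f.
have u0 := ucoord_neq0 b h2; have g0 := gen_neq0 b; have A0' := A_neq0 h2.
(* The sign comes from dw/w = - du/u + ..., cancelled on the chart at infinity by that of d(1/t). *)
exists ((if b then 1 else -1) / D0 rho).
  apply: (is_unit_div s2) => //; case: (b); first exact: (is_unit1 s2).
  by rewrite -(rmorphN1 iota); apply: (is_unit_iota s2); rewrite oppr_eq0 oner_eq0.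
rewrite (form_eval_change dual_e0 f der_e).
have dT j := proj1 (der_onT _ _) (der_e j).
have ex j : e j x = (j == inord 1)%:R / D0 rho * (2 * y) by rewrite e_F // D0x.
have et j : e j t = (j == inord 2)%:R * (if b then - t ^+ 2 else 1).
  move: (e_t j); rewrite /tau; case: (b) => h; last by rewrite h mulr1.
  rewrite -{1}(invrK t) (der_onV (subfield_setT iota) (dT j)) // h.
  by fld.
have eA j : j != inord 1 -> e j (A O2) = 0.
  by move=> /negPf h; rewrite e_F ?h ?mul0r //; case: (hA h2).
(* The derivative along the fibre kills the local generator of L, and w is that generator divided by
   [u]. *)
have ew0 : e ord0 w = - w / u.
  have scT := subfield_setT iota.
  have wE : w = gen b ^+ 2 * A O2 ^+ 2 / u by rewrite /ucoord; fld.
  have eg : e ord0 (gen b ^+ 2 * A O2 ^+ 2) = 0.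
    have [_ _ d3] := dT ord0; rewrite d3 // (der_onX scT (dT ord0) 1) // eA; last by rewrite -val_eqE /= inordK.
    have -> : e ord0 (gen b ^+ 2) = 0.
      rewrite (der_onX scT (dT ord0) 1) //; have -> : e ord0 (gen b) = 0; last by rewrite mulr0.
      rewrite /gen; case: (b); first by rewrite et -val_eqE /= inordK // mul0r.
      by have [h _ _] := dT ord0; rewrite -(rmorph1 iota) h.
    by rewrite !mulr0 addr0.
  rewrite {1}wE (der_on_div scT (dT ord0)) // eg e_u eqxx /= wE; fld.
have detE : \det (\matrix_(i, j) e i (coords w x t j)) =
    (- w / u) * (2 * y / D0 rho) * (if b then - t ^+ 2 else 1).
  rewrite det_trig; last first.
    apply/is_trig_mxP => i j; rewrite mxE; move: i j; apply: ord3_ind; apply: ord3_ind;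
      rewrite /coords /= ?inordK //= ?ex ?et -?val_eqE /= ?inordK //= ?mul0r //.
  rewrite !big_ord_recl big_ord0 mulr1 !mxE mulrA; congr (_ * _ * _).
  - by rewrite /coords /= ew0.
  - rewrite /coords /= ex -val_eqE /= inordK //=; by rewrite mul1r mulrC.
  - by rewrite /coords /= et -val_eqE /= inordK //= mul1r.
by move: u0; rewrite detE /form_coeff /gen; set uu := ucoord b O2 => uu0; case: (b); fld.
Qed.

Lemma ord_form_chart f V pi : dvr V pi -> is_loc RU V -> form_coeff f != 0 ->
  ord_form iota f V = ord V (form_coeff f * gen b ^+ 2 / u).
Proof.
move=> hV hl f0; have [rho [e [Or ur de pres fe]]] := dual_chart.
have [lV pi0 _ _] := hV; have sV := local_sa lV; have [_ _ RV _] := hl.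
have [k uk fE] := fe f.
have O2V : O2 `<=` V.
  by apply: subset_trans RV; apply: subset_trans (@base_total b O2 h2); exact: (adj_base _ s2).
have uk' := is_unit_mono O2V uk.
have n0 : form_coeff f * gen b ^+ 2 / u != 0.
  by apply: mulf_neq0; [apply: mulf_neq0 => //; rewrite expf_neq0 ?gen_neq0 | rewrite invr_eq0 ucoord_neq0].
have k0 := is_unit_neq0 uk.
have Vc : forall j, V (coords u rho (tau b) j).
  apply: ord3_ind; rewrite /coords ?inordK //=.
  - by apply: RV; exact: ucoord_total.
  - exact: O2V.
  - by apply: RV; apply: base_total => //; exact: (adj_gen _ s2).
have Ve j z : V z -> V (e j z) by move=> Vz; apply: (pres V j z hl).
have fe0 : form_eval f e != 0 by rewrite fE mulf_neq0.
by rewrite (ord_form_eq de hV Vc Ve fe0) fE (ordM hV) // (ord_unit hV uk') add0r.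
Qed.

(** For a divisor over the chart, not only on it: forms regular on a smooth chart pull back to
    regular forms. *)
Lemma ord_form_chart_ge f V pi l : dvr V pi -> is_loc (alg_gen iota [set` l]) V -> RU `<=` V ->
  form_coeff f != 0 -> ord V (form_coeff f * gen b ^+ 2 / u) <= ord_form iota f V.
Proof.
move=> hV hl RV f0; have [rho [e [Or ur de pres fe]]] := dual_chart.
have [lV pi0 _ _] := hV; have sV := local_sa lV.
have [k uk fE] := fe f.
have O2V : O2 `<=` V.
  by apply: subset_trans RV; apply: subset_trans (@base_total b O2 h2); exact: (adj_base _ s2).
have uk' := is_unit_mono O2V uk.
have n0 : form_coeff f * gen b ^+ 2 / u != 0.
  by apply: mulf_neq0; [apply: mulf_neq0 => //; rewrite expf_neq0 ?gen_neq0 | rewrite invr_eq0 ucoord_neq0].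
have k0 := is_unit_neq0 uk.
have <- : ord V (form_eval f e) = ord V (form_coeff f * gen b ^+ 2 / u).
  by rewrite fE (ordM hV) // (ord_unit hV uk') add0r.
apply: (ord_form_ge de hV hl); last by rewrite fE mulf_neq0.
apply: ord3_ind; rewrite /coords ?inordK //=.
- by apply: RV; exact: ucoord_total.
- exact: O2V.
- by apply: RV; apply: base_total => //; exact: (adj_gen _ s2).
Qed.

End FormChart.

Lemma cone_chain_bound m : chain C m -> (m <= 3)%N.
Proof.
apply: (chain_bound (l := [:: x; y; t; w]) dual_e0) => F' sF'.
apply/seteqP; split=> // z _.
have : adjoin_list (range iota) [:: x; y; t; w] z.
  by rewrite /= -/(curve_field iota x y) -FEE -(FS_gen false) K_gen.
apply: (adjoin_list_mono (range_subfield iota) sF') => _ [c _ <-].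
exact: (subfield_iota c sF').
Qed.

Lemma cone_dimension3 : dimension C 3.
Proof. by split; [exact: chain3 | exact: cone_chain_bound]. Qed.
Lemma cone_dimension d : dimension C d -> d = 3%N.
Proof.
move=> [hd hmax]; apply/eqP; rewrite eqn_leq (cone_chain_bound hd) /=.
exact: hmax chain3.
Qed.

(** * Pluricanonical forms near the vertex and the canonical property *)

Lemma ord_chart_pow V pi phi h (k : nat) : dvr V pi -> phi != 0 -> h != 0 ->
  (0 <= ord V phi + ord V h *+ k) <-> V (phi * h ^+ k).
Proof.
move=> hV p0 h0; have hk := expf_neq0 k h0.
rewrite -(ordX hV) // -(ordM hV) //; split=> [|/(ord_ge0 hV)]; first by move/(ord_ge0 hV); apply; rewrite mulf_neq0.
by apply; rewrite mulf_neq0.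
Qed.

Lemma coeff_neq0 f b O2 : E O2 -> form_coeff f != 0 -> form_coeff f * gen b ^+ 2 / ucoord b O2 != 0.
Proof.
move=> h2 f0; apply: mulf_neq0; first by apply: mulf_neq0 => //; rewrite expf_neq0 ?gen_neq0.
by rewrite invr_eq0 ucoord_neq0.
Qed.

(* A pluricanonical form regular in codimension one near the vertex is regular
   along the exceptional divisor: its leading coefficient is a section of
   O(2j - 2k) in the P^1 direction, so that j >= k. *)
Lemma pluricanonical_zs f k U O phi : form_coeff f != 0 -> open_in C U -> U O -> O `<=` VX ->
  phi != 0 -> (forall V, U V -> prime_divisor C V -> 0 <= ord V phi + ord_form iota f V *+ k) ->
  0 <= ord ZS phi + ord_form iota f ZS *+ k.
Proof.
move=> f0 oU UO OVX phi0 hphi; set H := form_coeff f in f0.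
have hV b V pi : dvr V pi -> is_loc (total_ring b FE) V -> is_unit V (ucoord b FE) -> U V ->
    V (phi * (H * gen b ^+ 2) ^+ k).
  move=> dV hl uu UV; have CV := cone_point E_generic hl uu; have [lV _ _ _] := dV; have sV := local_sa lV.
  have := hphi _ UV (dvr_prime_divisor dV CV).
  rewrite (ord_form_chart E_generic dV hl f0) -/H (ord_chart_pow _ dV phi0 (coeff_neq0 b E_generic f0)) -/H.
  rewrite expr_div_n mulrA => h; have uk := is_unitX k sV uu.
  have -> : phi * (H * gen b ^+ 2) ^+ k = phi * (H * gen b ^+ 2) ^+ k / ucoord b FE ^+ k * ucoord b FE ^+ k.
    by rewrite divfK // (is_unit_neq0 uk).
  by have := is_unit_in uk; move=> *; sa.
set psi := phi * H ^+ k.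
have psi0 : psi != 0 by rewrite mulf_neq0 ?expf_neq0.
set j := ord ZS psi.
(* With [j] the order of phi H^k, the conclusion reads j - k >= 0, because the form has the
   additional factor 1/u along the zero section. *)
have jk : k%:Z <= j.
  rewrite leNgt; apply/negP => jk.
  have [|c [[p hp pE] hc]] := near_vertex E_generic oU UO OVX psi0 (b := false).
    by move=> V pi dV hl uu UV _; have := hV _ _ _ dV hl uu UV; rewrite /gen expr1n mulr1.
  have psi0' : psi * t ^+ (2 * k) != 0 by rewrite mulf_neq0 ?expf_neq0.
  have tF : FS t := tau_FS false.
  have ut : is_unit ZS t by exact: FS_zs_unit.
  have [|c' [[q hq qE] hc']] := near_vertex E_generic oU UO OVX psi0' (b := true).
    move=> V pi dV hl uu UV _; have := hV _ _ _ dV hl uu UV.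
    by rewrite /gen exprMn -exprM mulrA.
  have oE : ord ZS (psi * t ^+ (2 * k)) = j.
    by rewrite (ordM zs_dvr_w) ?expf_neq0 // (ord_unit zs_dvr_w (is_unitX _ sZ ut)) addr0.
  rewrite oE in hc'; rewrite -/j in hc.
  have [m mE] : exists m : nat, k%:Z - j = m.+1%:Z.
    exists `|k%:Z - j|.-1; move: jk; lia.
  have uu := ucoord_neq0 false E_generic.
  (* The canonical bundle of P^1 contributes t^(2k) and the fibre coordinate t^(-2j); a positive
     exponent remains when j < k. *)
  have eqz : psi * t ^+ (2 * k) / ucoord true FE ^ j = t ^+ (2 * m.+1) * (psi / ucoord false FE ^ j).
    have -> : ucoord true FE = t ^+ 2 * ucoord false FE by rewrite /ucoord /gen expr1n mul1r !mulrA.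
    have -> : t ^+ (2 * m.+1) = t ^+ (2 * k) / (t ^+ 2) ^ j.
      apply: (mulIf (expfz_neq0 j (expf_neq0 2 t_n0))); rewrite divfK ?expfz_neq0 ?expf_neq0 //.
      rewrite !exprM exprnP -expfzDr ?expf_neq0 // -mE subrK //.
    have -> : (t ^+ 2 * ucoord false FE) ^ j = (t ^+ 2) ^ j * ucoord false FE ^ j.
      by apply: exprzMl; rewrite unitfE ?expf_neq0.
    have := expfz_neq0 j (expf_neq0 2 t_n0); have := expfz_neq0 j uu.
    move: ((t ^+ 2) ^ j) (ucoord false FE ^ j) (t ^+ (2 * k)) => T1 T2 T3 T10 T20; fld.
  rewrite eqz in hc'.
  have Fc : FS c by rewrite -pE; apply: (polyin_horner saFS FE_FS (tau_FS false) hp).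
  have Fc' : FS c' by rewrite -qE; apply: (polyin_horner saFS FE_FS (tau_FS true) hq).
  have ce : t ^+ (2 * m.+1) * c - c' = 0.
    apply: FS_zs_mx; first by sa.
    have -> : t ^+ (2 * m.+1) * c - c' = (t ^+ (2 * m.+1) * (psi / ucoord false FE ^ j) - c')
       - t ^+ (2 * m.+1) * (psi / ucoord false FE ^ j - c) by ring.
    by apply: (mxB lZ) => //; apply: (mxM sZ) => //; case: ut => *; sa.
  (* The leading coefficients satisfy t^(2(m+1)) p(t) = q(1/t), a section of negative degree on
     P^1. *)
  have p0 : p = 0.
    apply: (transc_no_pole (m := (2 * m.+1).-1) (q := q) sFE ht t_n0) => //.
    rewrite prednK // -[t]/(tau false) pE -[tau false]/t qE.
    by apply/eqP; rewrite -subr_eq0 ce.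
  have : is_unit ZS (psi / ucoord false FE ^ j) := dvr_ordP (zs_dvr false E_generic) psi0.
  by rewrite -pE p0 horner0 subr0 in hc; case: hc.
rewrite (ord_form_chart E_generic zs_dvr_w (zs_total false E_generic) f0) -/H.
rewrite (ord_chart_pow _ zs_dvr_w phi0 (coeff_neq0 false E_generic f0)) -/H /gen expr1n mulr1.
rewrite expr_div_n mulrA -/psi.
have u0 := ucoord_neq0 false E_generic.
apply/(ord_ge0 zs_dvr_w); first by rewrite mulf_neq0 ?invr_eq0 ?expf_neq0.
rewrite (ordM zs_dvr_w) ?invr_eq0 ?expf_neq0 // (ordV zs_dvr_w) ?expf_neq0 // (ordX zs_dvr_w) //.
by rewrite (ord_ucoord false E_generic) -/j; move: jk; lia.
Qed.

Lemma chart_sub_vertex b O2 V pi : E O2 -> dvr V pi -> total_ring b O2 `<=` V ->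
  max_ideal V (ucoord b O2) -> locin A0 V `<=` VX.
Proof.
move=> h2 [lV _ _ _] RV mu; have sV := local_sa lV.
rewrite vertex_eq => _ [c [d [Ac Ad ud ->]]]; exists c, d; split=> //.
have [k [r Rr dE]] := affine_cone_total b h2 Ad.
have k0 : k != 0.
  apply/eqP => k0; rewrite k0 rmorph0 add0r in dE.
  have : max_ideal V d; last by case.
  by rewrite dE mulrC; apply: (mxM sV) => //; apply: RV.
rewrite dE; apply: (unitDmx lZ); first exact: (is_unit_iota sZ).
by rewrite mulrC; apply: (mxM sZ); [exact: (total_zs h2 Rr) | exact: ucoord_zs].
Qed.

Lemma affine_cone_sub b O2 V : E O2 -> local_ring V -> total_ring b O2 `<=` V -> A0 `<=` V.
Proof.
move=> h2 lV RV z /(affine_cone_total b h2) [c [r hr ->]]; have sV := local_sa lV.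
by have := RV _ hr; have := RV _ (ucoord_total b h2); move=> *; sa.
Qed.

(** Divisors of the chart off the zero section are divisors of the cone, where the hypothesis
    applies; the zero section is settled by [pluricanonical_zs]. Regularity in codimension one then
    reaches [F]. *)
Lemma pluricanonical_chart f k b O2 U O F pi phi : E O2 -> dvr F pi -> total_ring b O2 `<=` F ->
  form_coeff f != 0 -> open_in C U -> U O -> O `<=` locin A0 F -> phi != 0 ->
  (forall V, U V -> prime_divisor C V -> 0 <= ord V phi + ord_form iota f V *+ k) ->
  F (phi * (form_coeff f * gen b ^+ 2 / ucoord b O2) ^+ k).
Proof.
move=> h2 hF RF f0 oU UO OF phi0 hphi; set psi := phi * _.
have [lF _ _ _] := hF; have sF := local_sa lF; have sRU := total_sa b h2.
have AF := affine_cone_sub h2 lF RF.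
(* Avoiding these restricts to the divisors of the chart passing through the center of [F], hence
   lying over the given open set. *)
pose M := [set m | total_ring b O2 m /\ is_unit F m].
have hn0 := coeff_neq0 b h2 f0.
have [c [d [Rc [Rd ud] d0 e]]] : exists c d, [/\ total_ring b O2 c, M d, d != 0 & psi = c / d].
  apply: contrapT => hno.
  have [|||P [pi' [pP PM dP nP]]] := @exists_dvr _ _ iota (total_ring b O2) psi M sRU
    (@total_noeth b O2 h2) (@total_closed b O2 h2) (@total_frac b O2 h2) _ _ _ hno.
  - by move=> m [].
  - by split; [sa | exact: (is_unit1 sF)].
  - by move=> m m' [h1 h1'] [h3 h3']; split; [sa | exact: (is_unitM sF)].
  set V := localization _ P in dP nP.
  have [hl hm] := prime_loc sRU pP; have [_ lV RV _] := hl; have sV := local_sa lV.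
  have AV := affine_cone_sub h2 lV RV.
  have OV : O `<=` V.
    move=> y1 /OF [c [d [Ac Ad ud ->]]].
    have Rd : total_ring b O2 d.
      have [k' [r hr ->]] := affine_cone_total b h2 Ad.
      by have := ucoord_total b h2; move=> *; sa.
    have : is_unit V d.
      case: (unit_or_mx (RV _ Rd)) => // /(hm _ Rd); case/PM => //; exact: is_unit_neq0 ud.
    by move=> /is_unit_inV; have := AV _ Ac; move=> *; sa.
  apply: nP; apply/(ord_chart_pow _ dP phi0 hn0); rewrite -(ord_form_chart h2 dP hl f0).
  case: (unit_or_mx (RV _ (ucoord_total b h2))) => hu.
    have CV := cone_point h2 hl hu.
    by apply: hphi; [exact: open_in_generization oU UO CV OV | exact: dvr_prime_divisor dP CV].
  rewrite (dvr_zero_section h2 dP hl hu).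
  apply: (pluricanonical_zs f0 oU UO _ phi0 hphi).
  apply: subset_trans OF _; apply: (chart_sub_vertex h2 hF RF).
  case: (unit_or_mx (RF _ (ucoord_total b h2))) => // uF.
  case: (PM (ucoord b O2)); [by split=> //; exact: ucoord_total|exact: ucoord_neq0|].
  by apply/hm => //; exact: ucoord_total.
by rewrite e; have := RF _ Rc; have := is_unit_inV ud; move=> *; sa.
Qed.

Definition affine_cone : set (set K) := [set O | C O /\ A0 `<=` O].
Lemma affine_cone_open : open_in C affine_cone.
Proof.
split=> [O []//|O [CO AO]]; exists [seq z / w | z <- s]; split.
  by move=> _ /mapP [z zs ->]; apply: AO; apply: chart_in.
move=> O' CO' h; split=> //; have sO' := local_sa (proj_local CO').
by apply: (chart_min sO') => z zs; apply: h; apply: map_f.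
Qed.

(** The vertex being of larger codimension, every divisor of the affine cone is seen in a chart off
    the zero section, where the rings are normal. *)
Lemma affine_divisor_chart V : C V -> A0 `<=` V -> prime_divisor C V ->
  exists b O2 pi, [/\ E O2, is_loc (total_ring b O2) V, is_unit V (ucoord b O2) & dvr V pi].
Proof.
move=> CV AV pV; have lV := proj_local CV; have sV := local_sa lV.
have ww : w \in rcons s w by rewrite mem_rcons inE eqxx.
have hl0 : is_loc A0 V.
  rewrite -cone_chart; apply: proj_point_chart => // z; rewrite mem_rcons inE => /orP[/eqP->|zs].
    by rewrite divff //; sa.
  by apply: AV; apply: chart_in.
case: (unit_chart lV AV (is_locE hl0)) => [e|[b [O2 [h2 hl uu]]]].
  by case: vertex_not_divisor; rewrite -e.
have [_ nT hmin] := pV; rewrite hC in nT hmin.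
have [_ _ RV _] := hl.
have cV : int_closed setT V.
  exact: (int_closed_loc hl (fun _ _ => I) (subfield_setT iota) (@total_closed b O2 h2)).
have fV : setT `<=` locin V setT.
  by move=> z /(@total_frac b O2 h2) [c [d [Rc Rd ud ->]]]; exists c, d; split=> //; apply: RV.
have [|pi hpi] := prime_divisor_dvr hl (@total_noeth b O2 h2) cV fV nT.
  move=> O' hO' VO'; apply: hmin => //; apply: (cone_point h2 hO').
  exact: is_unit_mono VO' uu.
by exists b, O2, pi.
Qed.

(* The form (s0^2 / w^m)^k, with s0 a section of the m-th power of the line bundle
   on E, is a pluricanonical form regular on the affine cone. *)
Lemma pluricanonical_exists f (k : nat) : form_coeff f != 0 ->
  exists2 phi, phi != 0 &
    forall V, affine_cone V -> prime_divisor C V -> 0 <= ord V phi + ord_form iota f V *+ k.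
Proof.
move=> f0; have [m [s' [z0 [m0 zs z00 _ hz]]]] := E_sections; have [_ hz0] := hz _ zs.
have G0 : z0 ^+ 2 / w ^+ m != 0 by rewrite mulf_neq0 ?invr_eq0 ?expf_neq0.
exists ((z0 ^+ 2 / w ^+ m / form_coeff f) ^+ k).
  by rewrite expf_neq0 // mulf_neq0 ?invr_eq0.
move=> V [CV AV] pV; have [b [O2 [pi [h2 hl uu hV]]]] := affine_divisor_chart CV AV pV.
have [_ lV RV _] := hl; have sV := local_sa lV.
rewrite (ord_form_chart h2 hV hl f0).
apply/(ord_chart_pow _ hV _ (coeff_neq0 b h2 f0)); first by rewrite expf_neq0 // mulf_neq0 ?invr_eq0.
rewrite -exprMn; apply: (saX _ sV).
have s2 := local_sa (E_local h2); have u0 := ucoord_neq0 b h2; have A0' := A_neq0 h2.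
have Vs : V (z0 / A O2 ^+ m).
  by apply: RV; apply: base_total => //; apply: (adj_base _ s2); apply: hz0.
have Vt : V (tau b) by apply: RV; apply: base_total => //; exact: (adj_gen _ s2).
have Vu := is_unit_in uu.
(* Since [A O2 ^+ 2 / w = u / gen b ^+ 2], the section contributes m such factors and the form
   removes one; m > 0 keeps the exponents natural. *)
have -> : z0 ^+ 2 / w ^+ m / form_coeff f * (form_coeff f * gen b ^+ 2 / ucoord b O2) =
   (z0 / A O2 ^+ m) ^+ 2 * ucoord b O2 ^+ m.-1 * (gen b ^- 2) ^+ m.-1.
  have -> : z0 ^+ 2 / w ^+ m = (z0 / A O2 ^+ m) ^+ 2 * (ucoord b O2 / gen b ^+ 2) ^+ m.
    have -> : ucoord b O2 / gen b ^+ 2 = A O2 ^+ 2 / w.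
      by rewrite /ucoord; have g0 := gen_neq0 b; fld.
    rewrite expr_div_n -exprM mulnC exprM expr_div_n; field.
    by rewrite !expf_neq0.
  have g0 := gen_neq0 b; have G2 : gen b ^+ 2 != 0 by rewrite expf_neq0.
  have -> : (ucoord b O2 / gen b ^+ 2) ^+ m = ucoord b O2 / gen b ^+ 2 * (ucoord b O2 ^+ m.-1 * (gen b ^- 2) ^+ m.-1).
    by rewrite -{1}(prednK m0) exprS exprMn.
  move: (z0 / _) (_ ^+ m.-1) (_ ^+ m.-1) G2 => T1 T2 T3; move: (gen b ^+ 2) => T4 T40; fld.
have Vg : V (gen b ^- 2).
  rewrite -exprVn; apply: (saX _ sV); move: Vt; rewrite /gen /tau; case: (b) => // _.
  by rewrite invr1; sa.
by sa.
Qed.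

Lemma canonical_affine_cone : canonical_on iota C affine_cone.
Proof.
move=> d f dimC hf F [Y [ysP nY fY domY] [YF nF minF]] UF _.
have d3 := cone_dimension dimC; rewrite d3 in f hf *.
have f0 := form_coeff_neq0 hf.
have [ys _ YE] := ysP; rewrite YE in YF minF nF nY fY domY.
have lF := proj_local YF; have sF := local_sa lF.
have [yi [iy i0 hl]] := proj1 (proj_modelP _ _ _) YF.
have fT : function_field (proj_model iota ys) = setT by rewrite fY hC.
have [_ _ cF _] := hl.
have [pi hF] : exists pi, dvr F pi.
  apply: (prime_divisor_dvr hl); first exact: noeth_chart.
  - have h := proj1 (normalP (fun O hO => local_sa (proj_local hO))) nY.
    by rewrite -fT; apply: h.
  - rewrite -{1}fT (function_field_proj iota iy i0) => z [c [e [Ac Ae ue ->]]].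
    by exists c, e; split=> //; apply: cF.
  - by rewrite -fT.
  - move=> O' hO' FO'; rewrite -fT; apply: minF => //.
    by apply/proj_modelP; exists yi.
have exc : exists O, [set O | C O /\ dominates F O] O by have [O h1 h3] := domY _ YF; exists O.
have [Cc dc] := xgetPex setT exc; rewrite -/(center C F) in Cc dc.
have [_ Ac] := UF; have AF := subset_trans Ac (proj1 dc).
have [b [O2 [h2 RF]]] := dvr_chart hF AF.
have hlg : is_loc (alg_gen iota [set` [seq z / yi | z <- ys]]) F by rewrite -chart_finite.
have hge := ord_form_chart_ge h2 hF hlg RF f0.
have cE : center C F `<=` locin A0 F.
  have ww : w \in rcons s w by rewrite mem_rcons inE eqxx.
  have hc : is_loc A0 (center C F).
    have lc := proj_local Cc; have sc := local_sa lc.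
    rewrite -cone_chart; apply: proj_point_chart => // z; rewrite mem_rcons inE => /orP[/eqP->|zs].
      by rewrite divff //; sa.
    by apply: Ac; apply: chart_in.
  by rewrite -(is_loc_dom hc lF (proj1 dc) dc).
rewrite lerDr /ord_K_rel -lerBlDl sub0r.
(* The infimum is bounded term by term, so the limit over [k] requires no asymptotic argument. *)
apply: lb_le_inf; first by eexists; exists 1%N.
move=> _ [k k0 <-].
rewrite ler_pdivlMr ?ltr0n // mulNr.
have -> : - (((ord_form iota f F)%:~R : R) * k%:R) = (- (ord_form iota f F *+ k))%:~R.
  by rewrite rmorphN rmorphMn /= mulr_natr.
rewrite ler_int; apply: imin_ge.
  (* An actual section must be exhibited: on an empty set [imin] would be 0, which may lie below the
     required bound. *)
  have [phi p0 hphi] := pluricanonical_exists k f0.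
  exists (ord F phi), affine_cone, phi; split=> //; first exact: affine_cone_open.
    by exists (center C F).
  split; first by rewrite hC.
  by move=> _ V UV pV; rewrite mulNrn opprK; apply: hphi.
move=> _ [U [phi [oU [O UO Oc] [_ hphi] p0 ->]]].
have hphi' V : U V -> prime_divisor C V -> 0 <= ord V phi + ord_form iota f V *+ k.
  by move=> UV pV; have := hphi (elimN eqP p0) V UV pV; rewrite mulNrn opprK.
have := pluricanonical_chart h2 hF RF f0 oU UO (subset_trans Oc cE) p0 hphi'.
move/(ord_chart_pow _ hF p0 (coeff_neq0 b h2 f0)) => h.
rewrite -subr_ge0 opprK; apply: le_trans h _; rewrite lerD2l.
exact: ler_wMn2r.
Qed.

(** * The blowup of the vertex: the graph of the projection from it, in its Segre embedding *)

Definition blowup_coords : seq K := [seq z1 * z2 | z1 <- (s : seq K), z2 <- rcons s w].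
Local Notation ys := blowup_coords.
Local Notation Y := (proj_model iota ys).

Lemma blowup_mem z1 z2 : z1 \in (s : seq K) -> z2 \in rcons s w -> z1 * z2 \in ys.
Proof. by move=> h1 h3; apply/allpairsP; exists (z1, z2). Qed.
Lemma blowup_memP z : z \in ys -> exists z1 z2,
  [/\ z1 \in (s : seq K), z2 \in (s : seq K) \/ z2 = w & z = z1 * z2].
Proof.
move=> /allpairsP [[z1 z2] [/= h1 h3 ->]]; exists z1, z2; split=> //.
by move: h3; rewrite mem_rcons inE => /orP[/eqP->|]; [right|left].
Qed.
Lemma mem_s_rcons z : z \in (s : seq K) -> z \in rcons s w.
Proof. by move=> zs; rewrite mem_rcons inE zs orbT. Qed.
Lemma mem_w_rcons : w \in rcons s w.
Proof. by rewrite mem_rcons inE eqxx. Qed.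

(* The two affine charts of the blowup along each fibre: R[u] and R[1/u]. *)
Lemma blowup_point O : Y O -> exists b O2 v,
  [/\ E O2, v = ucoord b O2 \/ v = (ucoord b O2)^-1 & is_loc (adj (base_ring b O2) v) O].
Proof.
move=> hO; have lO := proj_local hO; have sO := local_sa lO.
have [pq [/blowup_memP [p [q [ps hq ->]]] pq0 hl]] := proj1 (proj_modelP _ _ _) hO.
have [p0 q0] : p != 0 /\ q != 0 by apply/andP; rewrite -negb_or -mulf_eq0.
have [_ _ cO _] := hl.
have hin z1 z2 : z1 \in (s : seq K) -> z2 \in rcons s w -> O (z1 * z2 / (p * q)).
  by move=> h1 h3; apply: cO; apply: chart_in; apply: blowup_mem.
have qr : q \in rcons s w by case: hq => [/mem_s_rcons//|->]; exact: mem_w_rcons.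
have hz z : z \in (s : seq K) -> O (z / p).
  by move=> zs; have := hin z q zs qr; rewrite (_ : _ / _ = z / p) //; fld.
have [b [O2 [h2 RO us cl]]] := chart_of lO ps p0 hz.
have sR := base_sa b h2; have sl := locin_sa sR sO.
have us' := is_unit_mono (locin_le sO RO) us.
have u0 := ucoord_neq0 b h2; have g0 := gen_neq0 b; have A0' := A_neq0 h2.
have sc0 := scale_neq0 b h2.
exists b, O2; case: hq => [qs|qw].
  have uqp : is_unit O (q / p).
    split; [by rewrite mulf_neq0 ?invr_eq0 | exact: hz|].
    by rewrite invf_div; have := hin p p ps (mem_s_rcons ps); rewrite (_ : _ / _ = p / q) //; fld.
  exists (ucoord b O2)^-1; split=> //; first by right.
  set v := (ucoord b O2)^-1.
  have vE : v = (w / q * (q / p)) * (p / (gen b ^+ 2 * A O2 ^+ 2)).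
    by rewrite /v /ucoord; fld.
  have wq : O (w / q).
    by have := hin p w ps mem_w_rcons; rewrite (_ : _ / _ = w / q) //; fld.
  have vO : O v.
    by rewrite vE; have := is_unit_in us'; have := is_unit_in uqp; move=> *; sa.
  have sv := adj_sa v sR; have Rv : adj (base_ring b O2) v `<=` O by exact: (adj_min sO RO vO).
  apply: (is_loc_trans hl sv Rv); have sL' := locin_sa sv sO.
  have LL : locin (base_ring b O2) O `<=` locin (adj (base_ring b O2) v) O.
    by move=> _ [c [d [Rc Rd ud ->]]]; exists c, d; split=> //; exact: (adj_base v sR).
  have Lz z : z \in (s : seq K) -> locin (adj (base_ring b O2) v) O (z / p).
    by move=> zs; apply: LL; apply: cl; apply: chart_in.
  have Lpq : locin (adj (base_ring b O2) v) O (p / q).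
    by rewrite -invf_div; apply: is_unit_inV; apply: (locin_unit sv sO Rv) => //; exact: Lz.
  have Lv := locin_sub sv sO (adj_gen v sR).
  have Lus := LL _ (is_unit_inV us).
  apply: (chart_min sL') => z /blowup_memP [z1 [z2 [h1 h3 ->]]].
  have -> : z1 * z2 / (p * q) = z1 / p * (z2 / p * (p / q)) by fld.
  have := Lz _ h1; case: h3 => [/Lz|->]; first by move=> *; sa.
  have -> : w / p = v * (p / (gen b ^+ 2 * A O2 ^+ 2))^-1 by rewrite /v /ucoord; fld.
  by move=> *; sa.
exists (ucoord b O2); split=> //; first by left.
set v := ucoord b O2; subst q.
have vE : v = (p / w) * (p / (gen b ^+ 2 * A O2 ^+ 2))^-1 by rewrite /v /ucoord; fld.
have pw : O (p / w).
  by have := hin p p ps (mem_s_rcons ps); rewrite (_ : _ / _ = p / w) //; fld.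
have vO : O v by rewrite vE; have := is_unit_inV us'; move=> *; sa.
have sv := adj_sa v sR; have Rv : adj (base_ring b O2) v `<=` O by exact: (adj_min sO RO vO).
apply: (is_loc_trans hl sv Rv); have sL' := locin_sa sv sO.
have LL : locin (base_ring b O2) O `<=` locin (adj (base_ring b O2) v) O.
  by move=> _ [c [d [Rc Rd ud ->]]]; exists c, d; split=> //; exact: (adj_base v sR).
have Lz z : z \in (s : seq K) -> locin (adj (base_ring b O2) v) O (z / p).
  by move=> zs; apply: LL; apply: cl; apply: chart_in.
have Lv := locin_sub sv sO (adj_gen v sR).
have Lus := LL _ (is_unit_in us).
apply: (chart_min sL') => z /blowup_memP [z1 [z2 [h1 h3 ->]]].
have -> : z1 * z2 / (p * w) = z1 / p * (z2 / w) by fld.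
have := Lz _ h1; case: h3 => [/Lz|->]; last by rewrite divff // mulr1.
have -> : z2 / w = z2 / p * (v * (p / (gen b ^+ 2 * A O2 ^+ 2))) by rewrite /v /ucoord; fld.
by move=> *; sa.
Qed.

(** Both [u] and its inverse are transcendental over the function field of S, so each chart is a
    polynomial ring over a normal base. *)
Lemma blowup_normal : normal Y.
Proof.
apply: (proj2 (normalP (fun O hO => local_sa (proj_local hO)))) => O hO.
have [b [O2 [v [h2 hv hl]]]] := blowup_point hO.
have sR := base_sa b h2.
have tv : transcendental_over FS v.
  case: hv => ->; first exact: (@ucoord_transc b O2 h2).
  exact: (transc_inv saFS (@ucoord_transc b O2 h2)).
have Kv z : locin (adj FS v) setT z.
  have : locin (adj FS (ucoord b O2)) setT z by rewrite (K_ucoord b h2).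
  have sF := subfield_adj v sFS; have Fv := adj_field_gen v sFS.
  apply: (adj_field_min sF (adj_sub_field v sFS)).
  by case: hv => e; [rewrite -e | rewrite -[ucoord _ _]invrK -e; apply: (sfV sF)].
have h : int_closed FS (base_ring b O2).
  rewrite (FS_gen b); have s2 := local_sa (E_local h2).
  exact: (adj_int_closed sFE s2 (E_sub h2) (E_normal h2) (@tau_transc b)).
have hc : int_closed setT (adj (base_ring b O2) v).
  by move=> z _; apply: (adj_int_closed sFS sR (base_FS h2) h tv).
have := int_closed_loc hl (fun _ _ => I) (subfield_setT iota) hc.
by move=> hT z _; apply: hT.
Qed.

Lemma blowup_function_field : function_field Y = setT.
Proof.
have [p ps p0] := S_pivot; have pp : p * p \in ys by apply: blowup_mem => //; exact: mem_s_rcons.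
have pp0 : p * p != 0 by rewrite mulf_neq0.
rewrite (function_field_proj iota pp pp0); apply/seteqP; split=> // z _.
have : function_field C z by rewrite hC.
rewrite /projective_cone (function_field_proj iota (mem_s_rcons ps) p0).
have sc := chart_sa iota ys (p * p); have sF := subfield_locin sc; have sFa := subfield_sa sF.
apply: (locin_min sF); apply: (chart_min sFa) => q qr; apply: (locin_sub sc (setT_sa iota)).
by have := chart_in (iota := iota) (p * p) (blowup_mem ps qr); rewrite (_ : _ / _ = q / p) //; fld.
Qed.

Lemma blowup_modification : normal_modification iota Y C.
Proof.
have [p ps p0] := S_pivot; split; last first.
- move=> O hO; have lO := proj_local hO; have sO := local_sa lO.
  have [pq [/blowup_memP [p' [q [ps' hq ->]]] pq0 [_ _ cO _]]] := proj1 (proj_modelP _ _ _) hO.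
  have [p0' q0] : p' != 0 /\ q != 0 by apply/andP; rewrite -negb_or -mulf_eq0.
  have hin z1 z2 : z1 \in (s : seq K) -> z2 \in rcons s w -> O (z1 * z2 / (p' * q)).
    by move=> h1 h3; apply: cO; apply: chart_in; apply: blowup_mem.
  have qr : q \in rcons s w by case: hq => [/mem_s_rcons//|->]; exact: mem_w_rcons.
  have [|h _ _ d] := @proj_point _ _ iota _ q O qr q0 lO; last by exists (locin (chart iota (rcons s w) q) O).
  move=> z zr; have := hin p' z ps' zr; rewrite (_ : _ / _ = z / q) //; fld.
- by rewrite blowup_function_field hC.
- exact: blowup_normal.
- exists ys => //; apply/hasP; exists (p * p); last by rewrite mulf_neq0.
  by apply: blowup_mem => //; exact: mem_s_rcons.
Qed.

Lemma zs_blowup : divisor_over iota C ZS.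
Proof.
exists Y; first exact: blowup_modification.
have [p ps p0] := S_pivot.
have pw : p * w \in ys by apply: blowup_mem => //; exact: mem_w_rcons.
have pw0 : p * w != 0 by rewrite mulf_neq0.
have Fp := section_FS ps.
have hz z : z \in ys -> ZS (z / (p * w)).
  move=> /blowup_memP [z1 [z2 [h1 h3 ->]]].
  have -> : z1 * z2 / (p * w) = z1 / p * (z2 / w) by fld.
  apply: (saM sZ); first by apply: FS_zs; apply: (sf_div sFS) => //; exact: section_FS.
  case: h3 => [h3|->]; last by rewrite divff //; sa.
  by apply: (saM sZ); [apply: FS_zs; exact: section_FS | case: zs_w].
have [hY hl' _ _] := proj_point pw pw0 lZ hz.
have sc := chart_sa iota ys (p * w); have cZ := chart_min sZ hz.
have hl : is_loc (chart iota ys (p * w)) ZS.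
  apply: (is_loc_trans zs_loc sc cZ); have sl := locin_sa sc sZ.
  have FL : FS `<=` locin (chart iota ys (p * w)) ZS.
    move=> z; rewrite -S_proj (function_field_proj iota ps p0) => -[c [d [cc cd /is_unit_setT d0 ->]]].
    have sub : chart iota s p `<=` chart iota ys (p * w).
      apply: (chart_min sc) => z' zs'.
      have := chart_in (iota := iota) (p * w) (blowup_mem zs' mem_w_rcons).
      by rewrite (_ : _ / _ = z' / p) //; fld.
    exists c, d; split; [exact: sub|exact: sub| |by []].
    apply: FS_zs_unit => //; rewrite -S_proj (function_field_proj iota ps p0).
    exact: (locin_sub (chart_sa iota s p) (setT_sa iota)).
  apply: (adj_min sl FL); have -> : w^-1 = p^-1 * (p * p / (p * w)) by fld.
  apply: (saM sl); first by apply: FL; exact: (sfV sFS).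
  apply: (locin_sub sc sZ); apply: chart_in; apply: blowup_mem => //; exact: mem_s_rcons.
have YZ : Y ZS by apply/proj_modelP; exists (p * w).
split=> //; first by rewrite blowup_function_field; exact: zs_neqT.
move=> O' hO' ZO'; rewrite blowup_function_field; apply: (dvr_over zs_dvr_w) => //.
exact: local_sa (proj_local hO').
Qed.

(* dt /\ dx/2y /\ dw/w, which has a simple pole along the exceptional divisor *)
Let log_form : Defs.form K 3 := ((w * (2 * y))^-1, coords w x t).
Let log_eval : form_eval log_form e0 = (w * (2 * y))^-1.
Proof.
rewrite /form_eval /=; have -> : \matrix_(i, j) e0 i (coords w x t j) = 1%:M.
  by apply/matrixP => i j; rewrite !mxE; have [_ -> _] := dual_e0.
by rewrite det1 mulr1.
Qed.
Let log_nonzero : form_nonzero iota log_form.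
Proof.
have [de _ _] := dual_e0; exists e0 => //.
by rewrite log_eval invr_eq0 mulf_neq0.
Qed.
Let log_coeff : form_coeff log_form = 1.
Proof. by rewrite /form_coeff log_eval -mulrA mulVf // mulf_neq0. Qed.

(** Off the zero section the logarithmic form has order 0 on the chart of [t], so [phi] itself is
    regular there. A pole of order e+1 would make its leading coefficient, a polynomial in [t], take
    coefficients in the power -2(e+1) of [A]. *)
Lemma anticanonical_zs m U O phi : open_in C U -> U O -> O `<=` VX -> phi != 0 ->
  (forall V, U V -> prime_divisor C V -> 0 <= ord V phi - ord_form iota log_form V *+ m) ->
  0 <= ord ZS phi.
Proof.
move=> oU UO OVX phi0 hphi; rewrite leNgt; apply/negP => j0; set j := ord ZS phi in j0.
have c0 : form_coeff log_form != 0 by rewrite log_coeff oner_neq0.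
have lead O2 : E O2 -> exists c, base_ring false O2 c /\ max_ideal ZS (phi / ucoord false O2 ^ j - c).
  move=> h2; apply: (near_vertex h2 oU UO OVX phi0) => V pi dV hl uu UV _.
  have CV := cone_point h2 hl uu; have [lV _ _ _] := dV; have sV := local_sa lV.
  have := hphi _ UV (dvr_prime_divisor dV CV).
  rewrite (ord_form_chart h2 dV hl c0) log_coeff /gen expr1n mulr1 div1r.
  rewrite (ord_unit dV (is_unitV uu)) mul0rn subr0 => h.
  exact/(ord_ge0 dV).
have [e jE] : exists e : nat, j = - e.+1%:Z by exists `|j|.-1; move: j0; lia.
have [c [[p hp pE] hc]] := lead _ E_generic.
have uZ : is_unit ZS (phi / ucoord false FE ^ j) := dvr_ordP (zs_dvr false E_generic) phi0.
have cn0 : c != 0 by apply/eqP => cc; rewrite cc subr0 in hc; case: hc.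
have [i pi0] : exists i, p`_i != 0.
  apply: contrapT => h; move/eqP: cn0; apply; rewrite -pE.
  suff -> : p = 0 by rewrite horner0.
  apply/polyP => i; rewrite coef0; apply/eqP/negPn/negP => hi; by apply: h; exists i.
have AF0 := A_neq0 E_generic.
have FAF : FE (A FE) by case: (hA E_generic).
(* Division by the generator at the generic point of E turns the coefficient into a rational section
   independent of the local generators. *)
apply: (@no_negative_sections (p`_i / A FE ^+ (2 * e.+1)) (2 * e.+1)) => //.
- by apply: (sf_div sFE); [exact: hp | sa].
- by rewrite mulf_neq0 ?invr_eq0 ?expf_neq0.
move=> O2 h2; have [c' [[q hq qE] hc']] := lead _ h2.
have A20 := A_neq0 h2; have FA2 : FE (A O2) by case: (hA h2).
(* The transition factor between the two local generators; it multiplies the whole leading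
   coefficient, so transcendence of [t] compares coefficients one by one. *)
set r := A O2 ^+ (2 * e.+1) / A FE ^+ (2 * e.+1).
have Fr : FE r by rewrite /r; apply: (sf_div sFE); sa.
have ue : phi / ucoord false O2 ^ j = r * (phi / ucoord false FE ^ j).
  rewrite jE /ucoord /gen !expr1n !mul1r /r -!exprnN !invrK !exprM !expr_div_n.
  by field; rewrite !expf_neq0.
have h1 : r * c - c' = 0.
  have Fc : FS c by rewrite -pE; apply: (polyin_horner saFS FE_FS (tau_FS false) hp).
  have Fc' : FS c' by rewrite -qE; apply: (polyin_horner saFS (subset_trans (E_sub h2) FE_FS) (tau_FS false) hq).
  have FSr := FE_FS Fr.
  apply: FS_zs_mx; first by sa.
  rewrite ue in hc'.
  have -> : r * c - c' = (r * (phi / ucoord false FE ^ j) - c') - r * (phi / ucoord false FE ^ j - c) by ring.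
  by apply: (mxB lZ) => //; apply: (mxM sZ) => //; exact: FS_zs.
have pq : r *: p - q = 0.
  apply: ht; last first.
    by apply/rootP; rewrite hornerD hornerN hornerZ -[t]/(tau false) pE qE.
  move=> k; rewrite coefB coefZ; have := hp k; have := E_sub h2 (hq k); move=> *; sa.
have -> : p`_i / A FE ^+ (2 * e.+1) * A O2 ^+ (2 * e.+1) = q`_i.
  have := congr1 (fun g : {poly K} => g`_i) pq; rewrite coefB coefZ coef0 => /eqP.
  by rewrite subr_eq0 => /eqP <-; rewrite /r; ring.
exact: hq.
Qed.

Lemma cone_not_klt : ~ klt_at iota C VX.
Proof.
move=> [U [oU UV [m m0 hk]]].
have UZ : U (center C ZS) by rewrite center_zs.
have := hk 3%N log_form cone_dimension3 log_nonzero ZS zs_blowup UZ.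
have c0 : form_coeff log_form != 0 by rewrite log_coeff oner_neq0.
(* The simple pole cancels the 1 in the klt condition, leaving minus the valuation of the m-th
   multiple divided by m, which is not positive. *)
have oZ : ord_form iota log_form ZS = -1.
  rewrite (ord_form_chart E_generic zs_dvr_w (zs_total false E_generic) c0) log_coeff.
  rewrite /gen expr1n mulr1 div1r (ordV zs_dvr_w) ?(ucoord_neq0 false E_generic) //.
  by rewrite (ord_ucoord false E_generic).
rewrite /ord_K_rel_m oZ rmorphN1 addrAC addNr add0r oppr_gt0 ltNge => /negP; apply.
apply: divr_ge0; last exact: ler0n.
(* Sections on every neighbourhood of a point specializing to the vertex compete in this minimum, so
   the bound is applied to arbitrary [U'] and [O]. *)
rewrite ler0z; apply: imin_ge0 => _ [U' [phi [oU' [O UO Oc] [_ hphi] p0 ->]]].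
rewrite center_zs in Oc.
apply: (anticanonical_zs oU' UO Oc p0 (m := m)) => V UV' pV.
by apply: hphi => //; exact/eqP.
Qed.

Lemma cone_canonical : canonical_at iota C VX.
Proof.
exists affine_cone; split; [exact: affine_cone_open | | exact: canonical_affine_cone].
have [CV [_ _ h _] _ _] := vertex_point; by split.
Qed.

End DualDerivations.

End Cone.

Theorem theorem4p1 (R : realType) (K : fieldType)
    (iota : {rmorphism R[i] -> K})
    (E : set (set K)) (A : set K -> K) (t : K)
    (n : nat) (s : n.+1.-tuple K) (w : K) :
  let P1 := projective_line iota t in
  let S := product iota P1 E in
  let L := box_tensor P1 E (tensor_power (twisting_sheaf [:: 1; t]) 2)
                           (tensor_power A 2) in
  let C := projective_cone iota s w in
  elliptic_curve iota E ->
  transcendental_over (function_field E) t ->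
  line_bundle E A -> ample iota E A ->
  very_ample iota S L ->
  complete_embedding iota S L s ->
  transcendental_over (function_field S) w ->
  function_field C = setT ->
  canonical_at iota C (cone_vertex iota s w) /\
  ~ klt_at iota C (cone_vertex iota s w).
Proof.
move=> P1 S L C hE ht hA aA _ hs hw hC.
have [a [b [x [y [disc tx weq eE]]]]] := hE.
have [D [dD Dx Dy]] := curve_der tx weq.
have FEE : function_field E = curve_field iota x y by rewrite eE curve_function_field.
have dD' : der_on iota (function_field E) D by rewrite FEE.
have pts O2 : E O2 -> (forall z, O2 z -> O2 (D z)) /\
    exists rho, O2 rho /\ is_unit O2 (D rho).
  by rewrite eE => /(curve_point disc tx weq dD Dx Dy) [].
have [e0 de0] := dual_wxt hE ht hA hs hw hC tx weq eE dD' Dx Dy.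
split; [eapply cone_canonical | eapply cone_not_klt]; eauto.
Qed.
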